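(* Let $(\mathfrak{h},W)$ be a finite complex reflection group and let $\mathbf{c}:\mathrm{Ref}(W)\to\mathbb{C}$ be a function invariant under $W$-conjugation. Then the restricted rational Cherednik algebra $\overline{\mathsf{H}}_{\mathbf{c}}(W)$ (at $t=0$) is BGG.
   Context: **Restricted rational Cherednik algebra.** $W$ is a non-trivial finite subgroup of $\mathrm{GL}(\mathfrak{h})$, $\mathfrak{h}$ a finite-dimensional complex vector space, generated by its set $\mathrm{Ref}(W)$ of elements $s$ with $\operatorname{Ker}(\mathrm{id}_{\mathfrak h}-s)$ of codimension one. For $s\in\mathrm{Ref}(W)$ let $\alpha_s\in\mathfrak{h}^*$ span $\operatorname{Im}(s-1)|_{\mathfrak{h}^*}$ and $\alpha_s^\vee\in\mathfrak{h}$ span $\operatorname{Im}(s-1)|_{\mathfrak{h}}$, with $\alpha_s(\alpha_s^\vee)=2$. With $(y,x)=x(y)$, $\mathsf{H}_{\mathbf{c}}(W)$ is the quotient of $T(\mathfrak{h}\oplus\mathfrak{h}^* )\rtimes W$ (tensor algebra) by the relations $[x,x']=[y,y']=0$ and $[y,x]=-\sum_{s\in\mathrm{Ref}(W)}\mathbf{c}(s)(y,\alpha_s)(\alpha_s^\vee,x)s$ for $x,x'\in\mathfrak{h}^*$, $y,y'\in\mathfrak{h}$. It is graded by $\deg\mathfrak{h}^*=-1$, $\deg\mathfrak{h}=1$, $\deg W=0$. The subalgebra $R=\mathbb{C}[\mathfrak{h}]^W\otimes\mathbb{C}[\mathfrak{h}^*]^W$ is central, and $\overline{\mathsf{H}}_{\mathbf{c}}(W)=\mathsf{H}_{\mathbf{c}}(W)/\langle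 R_+\rangle$, with $R_+$ the elements with zero constant term. $A=\overline{\mathsf{H}}_{\mathbf{c}}(W)$ has the triangular decomposition $A^-\otimes T\otimes A^+\simeq A$ (by multiplication) with $A^-=\mathbb{C}[\mathfrak{h}]^{\mathrm{co}W}=\mathbb{C}[\mathfrak{h}]/\langle\mathbb{C}[\mathfrak{h}]^W_+\rangle$, $T=\mathbb{C}W$, $A^+=\mathbb{C}[\mathfrak{h}^*]^{\mathrm{co}W}=\mathbb{C}[\mathfrak{h}^*]/\langle\mathbb{C}[\mathfrak{h}^*]^W_+\rangle$. **BGG.** $\mathcal{G}(A)$ is the category of finitely generated graded left $A$-modules. $B^\pm=A^\pm T$; $T$-modules become $B^\pm$-modules by letting nonzero degrees act by zero. $A^{\mathrm{op}}$ is graded by $(A^{\mathrm{op}})_i=A_{-i}$; $M^*=\operatorname{Hom}_{\mathbb{C}}(M,\mathbb{C})$ is a graded left $A^{\mathrm{op}}$-module with $(M^* )_i=(M_i)^*$. For a graded simple $T$-module $\lambda$, $\overline\Delta(\lambda)=A\otimes_{B^+}\lambda$ and $\overline\nabla(\lambda)=(A^{\mathrm{op}}\otimes_{(B^-)^{\mathrm{op}}}\lambda^* )^*$. $A$ is BGG if $[\overline\Delta(\lambda)]=[\overline\nabla(\lambda)]$ in the Grothendieck group $\mathrm{K}_0(\mathcal{G}(A))$ for every graded simple $T$-module $\lambda$. *)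

(* Defs.v *)
From HB Require Import structures.
From mathcomp Require Import all_boot all_order all_fingroup all_algebra generic_quotient.
From mathcomp Require Import boolp reals complex freeg.

Set Implicit Arguments.
Unset Strict Implicit.
Unset Printing Implicit Defensive.

Import GRing.Theory.
Local Open Scope ring_scope.
Local Open Scope quotient_scope.

(* An associative unital F-algebra is a ring with a ring morphism from F     *)
(* into its centre.  The library's [algType F] is not used because it        *)
(* demands 1 != 0, which for an algebra given by generators and relations is *)
(* a theorem and not part of the construction.                               *)
Record algebra (F : fieldType) := Algebra {
  al_ring :> pzRingType;
  al_scal : {rmorphism F -> al_ring};
  al_central : forall k x, al_scal k * x = x * al_scal k
}.
Arguments al_scal {F a}.
Arguments al_central {F} a k x.

Record algHom (F : fieldType) (A B : algebra F) := AlgHom {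
  ah_fun :> A -> B;
  ah_additive : zmod_morphism ah_fun;
  ah_monoid : monoid_morphism ah_fun;
  ah_scal : forall k, ah_fun (al_scal k) = al_scal k
}.

Section AlgebraTheory.
Variable F : fieldType.
Implicit Types A B C : algebra F.

Lemma base_central (k : F) (x : F) : idfun k * x = x * idfun k.
Proof. exact: mulrC. Qed.
Definition base_alg : algebra F := @Algebra F F idfun base_central.

Section AlgHomTheory.
Variables (A B : algebra F) (f : algHom A B).
HB.instance Definition _ := GRing.isZmodMorphism.Build A B f (ah_additive f).
HB.instance Definition _ := GRing.isMonoidMorphism.Build A B f (ah_monoid f).
Lemma ahB x y : f (x - y) = f x - f y. Proof. exact: ah_additive. Qed.
Lemma ah0 : f 0 = 0. Proof. exact: (raddf0 f). Qed.
Lemma ahD x y : f (x + y) = f x + f y. Proof. exact: (raddfD f). Qed.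
Lemma ah1 : f 1 = 1. Proof. by case: (ah_monoid f). Qed.
Lemma ahM x y : f (x * y) = f x * f y. Proof. by case: (ah_monoid f). Qed.
Lemma ah_sum (I : Type) (r : seq I) (P : pred I) (E : I -> A) :
  f (\sum_(i <- r | P i) E i) = \sum_(i <- r | P i) f (E i).
Proof. exact: (raddf_sum f). Qed.
End AlgHomTheory.

Section Comp.
Variables (A B C : algebra F) (g : algHom B C) (f : algHom A B).
Lemma comp_scal k : g (f (al_scal k)) = al_scal k.
Proof. by rewrite !ah_scal. Qed.
Definition ah_comp : algHom A C :=
  @AlgHom F A C (g \o f) (raddfB (g \o f)) (rmorphism_monoidP (g \o f)) comp_scal.
End Comp.

Section Opposite.
Variable A : algebra F.
Definition op_scal_fun (k : F) : A^c := al_scal k.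
Lemma op_scal_additive : zmod_morphism op_scal_fun.
Proof. by move=> k l; apply: (rmorphB (@al_scal F A)). Qed.
Lemma op_scal_monoid : monoid_morphism op_scal_fun.
Proof.
split=> [|k l]; first exact: (rmorph1 (@al_scal F A)).
by rewrite /op_scal_fun rmorphM; apply: al_central.
Qed.
HB.instance Definition _ :=
  GRing.isZmodMorphism.Build F A^c op_scal_fun op_scal_additive.
HB.instance Definition _ :=
  GRing.isMonoidMorphism.Build F A^c op_scal_fun op_scal_monoid.
Lemma op_central k (x : A^c) : op_scal_fun k * x = x * op_scal_fun k.
Proof. by apply/esym; apply: (al_central A). Qed.
Definition op_alg : algebra F := Algebra op_central.
End Opposite.

Section OppositeHom.
Variables (A B : algebra F) (f : algHom A B).
Lemma op_hom_monoid : monoid_morphism (f : op_alg A -> op_alg B).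
Proof. by split=> [|x y]; [apply: (rmorph1 f) | apply: (rmorphM f)]. Qed.
Definition op_hom : algHom (op_alg A) (op_alg B) :=
  @AlgHom F (op_alg A) (op_alg B) f (ah_additive f) op_hom_monoid (ah_scal f).
End OppositeHom.

Section OpOp.
Variable A : algebra F.
Lemma to_opop_additive : zmod_morphism (id : A -> op_alg (op_alg A)).
Proof. by []. Qed.
Lemma to_opop_monoid : monoid_morphism (id : A -> op_alg (op_alg A)).
Proof. by []. Qed.
Definition to_opop : algHom A (op_alg (op_alg A)) :=
  @AlgHom F A (op_alg (op_alg A)) id to_opop_additive to_opop_monoid
    (fun k => erefl).
End OpOp.

End AlgebraTheory.

Section QuotientAlgebra.
Variables (F : fieldType) (A : algebra F) (S : A -> Prop).

Inductive in_ideal : A -> Prop :=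
| ideal_gen x of S x : in_ideal x
| ideal0 : in_ideal 0
| idealB x y of in_ideal x & in_ideal y : in_ideal (x - y)
| idealMl a x of in_ideal x : in_ideal (a * x)
| idealMr a x of in_ideal x : in_ideal (x * a).

Definition ideal_pred : {pred A} := fun x => `[< in_ideal x >].
Lemma ideal_zmod_closed : zmod_closed ideal_pred.
Proof.
split=> [|x y]; first exact/asboolP/ideal0.
by move=> /asboolP hx /asboolP hy; apply/asboolP/idealB.
Qed.
HB.instance Definition _ := GRing.isZmodClosed.Build A ideal_pred ideal_zmod_closed.

Definition quot_ring := {ideal_quot ideal_pred}.
HB.instance Definition _ := GRing.Zmodule.on quot_ring.
HB.instance Definition _ := Quotient.on quot_ring.

Definition qpi (a : A) : quot_ring := \pi_quot_ring a.

Lemma qpiE a b : (qpi a = qpi b) <-> in_ideal (a - b).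
Proof.
split=> [e|h].
- by apply/asboolP; move/eqP: e; rewrite -Quotient.idealrBE.
- by apply/eqP; rewrite -Quotient.idealrBE; apply/asboolP.
Qed.
Lemma qpi_surj (q : quot_ring) : {a | q = qpi a}.
Proof. by exists (repr q); rewrite /qpi reprK. Qed.
Lemma qpiB : {morph qpi : x y / x - y}.
Proof. exact: (raddfB (\pi_{ideal_quot ideal_pred})). Qed.
Lemma qpiD : {morph qpi : x y / x + y}.
Proof. exact: (raddfD (\pi_{ideal_quot ideal_pred})). Qed.

Definition qmul (p q : quot_ring) : quot_ring := qpi (repr p * repr q).
Lemma repr_qpi a : in_ideal (repr (qpi a) - a).
Proof. by apply/qpiE; rewrite /qpi reprK. Qed.

Lemma in_idealD x y : in_ideal x -> in_ideal y -> in_ideal (x + y).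
Proof.
move=> hx hy; rewrite -[y]opprK; apply: idealB => //.
by rewrite -sub0r; apply: idealB => //; apply: ideal0.
Qed.

Lemma qmulE a b : qmul (qpi a) (qpi b) = qpi (a * b).
Proof.
apply/qpiE; set a' := repr _; set b' := repr _.
have -> : a' * b' - a * b = (a' - a) * b' + a * (b' - b).
  by rewrite mulrBl mulrBr addrA subrK.
by apply: in_idealD; [apply/idealMr/repr_qpi | apply/idealMl/repr_qpi].
Qed.

Lemma qmulA : associative qmul.
Proof.
move=> p q r; case: (qpi_surj p) (qpi_surj q) (qpi_surj r) => a -> [b ->] [c ->].
by rewrite !qmulE mulrA.
Qed.
Lemma qmul1q : left_id (qpi 1) qmul.
Proof. by move=> p; case: (qpi_surj p) => a ->; rewrite qmulE mul1r. Qed.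
Lemma qmulq1 : right_id (qpi 1) qmul.
Proof. by move=> p; case: (qpi_surj p) => a ->; rewrite qmulE mulr1. Qed.
Lemma qmulDl : left_distributive qmul +%R.
Proof.
move=> p q r; case: (qpi_surj p) (qpi_surj q) (qpi_surj r) => a -> [b ->] [c ->].
by rewrite -qpiD !qmulE mulrDl qpiD.
Qed.
Lemma qmulDr : right_distributive qmul +%R.
Proof.
move=> p q r; case: (qpi_surj p) (qpi_surj q) (qpi_surj r) => a -> [b ->] [c ->].
by rewrite -qpiD !qmulE mulrDr qpiD.
Qed.
HB.instance Definition _ := GRing.Zmodule_isPzRing.Build quot_ring
  qmulA qmul1q qmulq1 qmulDl qmulDr.

Lemma qpi_monoid : monoid_morphism qpi.
Proof. by split=> // x y; rewrite -qmulE. Qed.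
Definition qscal (k : F) : quot_ring := qpi (al_scal k).
Lemma qscal_additive : zmod_morphism qscal.
Proof. by move=> k l; rewrite /qscal rmorphB qpiB. Qed.
Lemma qscal_monoid : monoid_morphism qscal.
Proof.
have [q1 qM] := qpi_monoid.
by split=> [|k l]; rewrite /qscal ?rmorph1 ?rmorphM ?qM.
Qed.
HB.instance Definition _ :=
  GRing.isZmodMorphism.Build F quot_ring qscal qscal_additive.
HB.instance Definition _ :=
  GRing.isMonoidMorphism.Build F quot_ring qscal qscal_monoid.
Lemma qscal_central k (x : quot_ring) : qscal k * x = x * qscal k.
Proof.
have [q1 qM] := qpi_monoid.
by case: (qpi_surj x) => a ->; rewrite /qscal -!qM al_central.
Qed.
Definition quot_alg : algebra F := Algebra qscal_central.

Definition quot_proj : algHom A quot_alg :=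
  @AlgHom F A quot_alg qpi qpiB qpi_monoid (fun k => erefl).

Section Lift.
Variables (B : algebra F) (f : algHom A B).
Hypothesis fS : forall x, S x -> f x = 0.

Lemma ideal_lift0 x : in_ideal x -> f x = 0.
Proof.
elim=> {x} [x /fS //||x y _ hx _ hy|a x _ hx|a x _ hx].
- exact: ah0.
- by rewrite ahB hx hy subr0.
- by rewrite ahM hx mulr0.
- by rewrite ahM hx mul0r.
Qed.

Definition quot_lift_fun (q : quot_alg) : B := f (repr q).
Lemma quot_lift_funE a : quot_lift_fun (qpi a) = f a.
Proof. by apply/eqP; rewrite -subr_eq0 -ahB; apply/eqP/ideal_lift0/repr_qpi. Qed.

Lemma quot_lift_additive : zmod_morphism quot_lift_fun.
Proof.
move=> x y; case: (qpi_surj x) (qpi_surj y) => a -> [b ->].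
by rewrite -qpiB !quot_lift_funE ahB.
Qed.
Lemma quot_lift_monoid : monoid_morphism quot_lift_fun.
Proof.
have [q1 qM] := qpi_monoid.
split=> [|x y]; first by rewrite -q1 quot_lift_funE ah1.
case: (qpi_surj x) (qpi_surj y) => a -> [b ->].
by rewrite -qM !quot_lift_funE ahM.
Qed.
Lemma quot_lift_scal k : quot_lift_fun (al_scal k) = al_scal k.
Proof. by rewrite quot_lift_funE ah_scal. Qed.
Definition quot_lift : algHom quot_alg B :=
  AlgHom quot_lift_additive quot_lift_monoid quot_lift_scal.
Lemma quot_liftE a : quot_lift (quot_proj a) = f a.
Proof. exact: quot_lift_funE. Qed.
End Lift.

End QuotientAlgebra.

(* T(V) is built from formal expressions in the elements of V, modulo the    *)
(* least congruence for which they form an F-algebra in which V -> T(V) is   *)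
(* linear.                                                                   *)

Section TensorAlgebra.
Variables (F : fieldType) (V : lmodType F).

Inductive texpr :=
| TVar of V
| TCst of F
| TAdd of texpr & texpr
| TMul of texpr & texpr.

Inductive teq : texpr -> texpr -> Prop :=
| teq_refl s : teq s s
| teq_sym s t of teq s t : teq t s
| teq_trans s t u of teq s t & teq t u : teq s u
| teq_add s s' t t' of teq s s' & teq t t' : teq (TAdd s t) (TAdd s' t')
| teq_mul s s' t t' of teq s s' & teq t t' : teq (TMul s t) (TMul s' t')
| teq_addA s t u : teq (TAdd s (TAdd t u)) (TAdd (TAdd s t) u)
| teq_addC s t : teq (TAdd s t) (TAdd t s)
| teq_add0 s : teq (TAdd (TCst 0) s) s
| teq_addN s : teq (TAdd (TMul (TCst (-1)) s) s) (TCst 0)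
| teq_mulA s t u : teq (TMul s (TMul t u)) (TMul (TMul s t) u)
| teq_mul1l s : teq (TMul (TCst 1) s) s
| teq_mul1r s : teq (TMul s (TCst 1)) s
| teq_mulDl s t u : teq (TMul (TAdd s t) u) (TAdd (TMul s u) (TMul t u))
| teq_mulDr s t u : teq (TMul s (TAdd t u)) (TAdd (TMul s t) (TMul s u))
| teq_cstD a b : teq (TCst (a + b)) (TAdd (TCst a) (TCst b))
| teq_cstM a b : teq (TCst (a * b)) (TMul (TCst a) (TCst b))
| teq_cstC a s : teq (TMul (TCst a) s) (TMul s (TCst a))
| teq_var a u v :
    teq (TVar (a *: u + v)) (TAdd (TMul (TCst a) (TVar u)) (TVar v)).

HB.instance Definition _ := gen_eqMixin texpr.
HB.instance Definition _ := gen_choiceMixin texpr.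

Definition teqb (s t : texpr) : bool := `[< teq s t >].
Lemma teqb_equiv : equiv_class_of teqb.
Proof.
split=> [s|s t|t s u].
- exact/asboolP/teq_refl.
- by apply: asbool_equiv_eq; split; apply: teq_sym.
- by move=> /asboolP h1 /asboolP h2; apply/asboolP/(teq_trans h1 h2).
Qed.
Canonical teqb_equivRel := EquivRelPack teqb_equiv.
Canonical teqb_encModRel := defaultEncModRel teqb.

Definition tens_ring := {eq_quot teqb}.
HB.instance Definition _ := Choice.on tens_ring.
HB.instance Definition _ : EqQuotient texpr teqb tens_ring := EqQuotient.on tens_ring.

Definition tpi (s : texpr) : tens_ring := \pi_tens_ring s.
Lemma tpiE s t : (tpi s = tpi t) <-> teq s t.
Proof.
by split=> [/eqP|h]; [rewrite eqmodE => /asboolP | apply/eqP; rewrite eqmodE; apply/asboolP].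
Qed.
Lemma tpi_surj (q : tens_ring) : {s | q = tpi s}.
Proof. by exists (repr q); rewrite /tpi reprK. Qed.
Lemma repr_tpi s : teq (repr (tpi s)) s.
Proof. by apply/tpiE; rewrite /tpi reprK. Qed.

Definition ta_add (p q : tens_ring) := tpi (TAdd (repr p) (repr q)).
Definition ta_mul (p q : tens_ring) := tpi (TMul (repr p) (repr q)).
Definition ta_opp (p : tens_ring) := tpi (TMul (TCst (-1)) (repr p)).

Lemma ta_addE s t : ta_add (tpi s) (tpi t) = tpi (TAdd s t).
Proof. by apply/tpiE/teq_add; apply: repr_tpi. Qed.
Lemma ta_mulE s t : ta_mul (tpi s) (tpi t) = tpi (TMul s t).
Proof. by apply/tpiE/teq_mul; apply: repr_tpi. Qed.
Lemma ta_oppE s : ta_opp (tpi s) = tpi (TMul (TCst (-1)) s).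
Proof. by apply/tpiE/teq_mul; [apply: teq_refl | apply: repr_tpi]. Qed.
Definition taE := (ta_addE, ta_mulE, ta_oppE).

Lemma ta_addA : associative ta_add.
Proof.
move=> p q r; case: (tpi_surj p) (tpi_surj q) (tpi_surj r) => s -> [t ->] [u ->].
by rewrite !taE; apply/tpiE/teq_addA.
Qed.
Lemma ta_addC : commutative ta_add.
Proof.
move=> p q; case: (tpi_surj p) (tpi_surj q) => s -> [t ->].
by rewrite !taE; apply/tpiE/teq_addC.
Qed.
Lemma ta_add0 : left_id (tpi (TCst 0)) ta_add.
Proof. by move=> p; case: (tpi_surj p) => s ->; rewrite !taE; apply/tpiE/teq_add0. Qed.
Lemma ta_addN : left_inverse (tpi (TCst 0)) ta_opp ta_add.
Proof. by move=> p; case: (tpi_surj p) => s ->; rewrite !taE; apply/tpiE/teq_addN. Qed.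
HB.instance Definition _ := GRing.isZmodule.Build tens_ring
  ta_addA ta_addC ta_add0 ta_addN.

Lemma ta_mulA : associative ta_mul.
Proof.
move=> p q r; case: (tpi_surj p) (tpi_surj q) (tpi_surj r) => s -> [t ->] [u ->].
by rewrite !taE; apply/tpiE/teq_mulA.
Qed.
Lemma ta_mul1l : left_id (tpi (TCst 1)) ta_mul.
Proof. by move=> p; case: (tpi_surj p) => s ->; rewrite !taE; apply/tpiE/teq_mul1l. Qed.
Lemma ta_mul1r : right_id (tpi (TCst 1)) ta_mul.
Proof. by move=> p; case: (tpi_surj p) => s ->; rewrite !taE; apply/tpiE/teq_mul1r. Qed.
Lemma ta_mulDl : left_distributive ta_mul ta_add.
Proof.
move=> p q r; case: (tpi_surj p) (tpi_surj q) (tpi_surj r) => s -> [t ->] [u ->].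
by rewrite !taE; apply/tpiE/teq_mulDl.
Qed.
Lemma ta_mulDr : right_distributive ta_mul ta_add.
Proof.
move=> p q r; case: (tpi_surj p) (tpi_surj q) (tpi_surj r) => s -> [t ->] [u ->].
by rewrite !taE; apply/tpiE/teq_mulDr.
Qed.
HB.instance Definition _ := GRing.Zmodule_isPzRing.Build tens_ring
  ta_mulA ta_mul1l ta_mul1r ta_mulDl ta_mulDr.

Definition tscal (k : F) : tens_ring := tpi (TCst k).
Lemma tscalD : {morph tscal : a b / a + b}.
Proof. by move=> a b; rewrite [RHS]ta_addE; apply/tpiE/teq_cstD. Qed.
Lemma tscal_additive : zmod_morphism tscal.
Proof. by move=> a b; apply/eqP; rewrite eq_sym subr_eq -tscalD subrK. Qed.
Lemma tscal_monoid : monoid_morphism tscal.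
Proof. by split=> // a b; rewrite [RHS]ta_mulE; apply/tpiE/teq_cstM. Qed.
HB.instance Definition _ :=
  GRing.isZmodMorphism.Build F tens_ring tscal tscal_additive.
HB.instance Definition _ :=
  GRing.isMonoidMorphism.Build F tens_ring tscal tscal_monoid.
Lemma tscal_central k (x : tens_ring) : tscal k * x = x * tscal k.
Proof.
by case: (tpi_surj x) => s ->; rewrite [LHS]ta_mulE [RHS]ta_mulE; apply/tpiE/teq_cstC.
Qed.
Definition tens_alg : algebra F := Algebra tscal_central.

Definition tvar (v : V) : tens_alg := tpi (TVar v).
Lemma tvar_linear k u v : tvar (k *: u + v) = al_scal k * tvar u + tvar v.
Proof.
have -> : al_scal k * tvar u = tpi (TMul (TCst k) (TVar u)) by exact: ta_mulE.
by rewrite [RHS]ta_addE; apply/tpiE/teq_var.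
Qed.

Lemma tens_ind (P : tens_alg -> Prop) :
  (forall v, P (tvar v)) -> (forall k, P (al_scal k)) ->
  (forall x y, P x -> P y -> P (x + y)) ->
  (forall x y, P x -> P y -> P (x * y)) -> forall x, P x.
Proof.
move=> Pv Pc PD PM x; case: (tpi_surj x) => s ->; elim: s => [v|k|s Ps t Pt|s Ps t Pt].
- exact: Pv.
- exact: Pc.
- by rewrite -ta_addE; apply: PD.
- by rewrite -ta_mulE; apply: PM.
Qed.

Section Lift.
Variables (B : algebra F) (f : V -> B).
Hypothesis f_lin : forall k u v, f (k *: u + v) = al_scal k * f u + f v.

Fixpoint teval (s : texpr) : B :=
  match s with
  | TVar v => f v
  | TCst k => al_scal k
  | TAdd s t => teval s + teval t
  | TMul s t => teval s * teval t
  end.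

Lemma teval_teq s t : teq s t -> teval s = teval t.
Proof.
elim=> {s t} /=; try by move=> *; congruence.
- by move=> *; rewrite addrA.
- by move=> *; rewrite addrC.
- by move=> *; rewrite rmorph0 add0r.
- by move=> *; rewrite rmorphN rmorph1 mulN1r addNr rmorph0.
- by move=> *; rewrite mulrA.
- by move=> *; rewrite rmorph1 mul1r.
- by move=> *; rewrite rmorph1 mulr1.
- by move=> *; rewrite mulrDl.
- by move=> *; rewrite mulrDr.
- by move=> *; rewrite rmorphD.
- by move=> *; rewrite rmorphM.
- by move=> *; rewrite al_central.
- by move=> *; rewrite f_lin.
Qed.

Definition tens_lift_fun (p : tens_alg) : B := teval (repr p).
Lemma tens_lift_funE s : tens_lift_fun (tpi s) = teval s.
Proof. exact/teval_teq/repr_tpi. Qed.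

Lemma tens_lift_additive : zmod_morphism tens_lift_fun.
Proof.
move=> x y; case: (tpi_surj x) (tpi_surj y) => s -> [t ->].
rewrite [X in _ + X]ta_oppE [X in tens_lift_fun X]ta_addE !tens_lift_funE /=.
by rewrite rmorphN rmorph1 mulN1r.
Qed.
Lemma tens_lift_monoid : monoid_morphism tens_lift_fun.
Proof.
split=> [|x y]; first by rewrite tens_lift_funE /= rmorph1.
case: (tpi_surj x) (tpi_surj y) => s -> [t ->].
by rewrite [X in tens_lift_fun X]ta_mulE !tens_lift_funE.
Qed.
Lemma tens_lift_scal k : tens_lift_fun (al_scal k) = al_scal k.
Proof. exact: tens_lift_funE. Qed.
Definition tens_lift : algHom tens_alg B :=
  AlgHom tens_lift_additive tens_lift_monoid tens_lift_scal.
Lemma tens_liftE v : tens_lift (tvar v) = f v.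
Proof. exact: tens_lift_funE. Qed.
End Lift.

End TensorAlgebra.

Record wrep (F : fieldType) (W : finGroupType) := WRep {
  wr_sp :> lmodType F;
  wr_act : W -> wr_sp -> wr_sp;
  wr_linear : forall w, linear (wr_act w);
  wr_act1 : forall v, wr_act 1%g v = v;
  wr_actM : forall w w' v, wr_act (w * w')%g v = wr_act w (wr_act w' v)
}.

Record walg (F : fieldType) (W : finGroupType) := WAlg {
  wa_alg :> algebra F;
  wa_act : W -> algHom wa_alg wa_alg;
  wa_act1 : forall b, wa_act 1%g b = b;
  wa_actM : forall w w' b, wa_act (w * w')%g b = wa_act w (wa_act w' b)
}.

Section SkewGroupAlgebra.
Variables (F : fieldType) (W : finGroupType) (B : walg F W).

(* b : {ffun W -> B} stands for \sum_w b(w) w, and (b w)(b' w') = b w(b') ww'. *)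
Definition skew_ring := {ffun W -> B}.
HB.instance Definition _ := GRing.Zmodule.on skew_ring.
Implicit Types p q r : skew_ring.

Definition sk_one : skew_ring := [ffun w => (w == 1%g)%:R].
Definition sk_mul p q : skew_ring :=
  [ffun v => \sum_(w : W) p w * wa_act B w (q (w^-1 * v)%g)].

Lemma sk_mulA : associative sk_mul.
Proof.
move=> p q r; apply/ffunP=> v; rewrite !ffunE.
transitivity (\sum_(w : W) \sum_(w' : W)
    p w * wa_act B w (q w') * wa_act B (w * w')%g (r ((w * w')^-1 * v)%g)).
  apply: eq_bigr => w _; rewrite ffunE ah_sum mulr_sumr; apply: eq_bigr => w' _.
  by rewrite ahM mulrA wa_actM invMg mulgA.
rewrite exchange_big /=.
under [RHS]eq_bigr => m _ do rewrite ffunE mulr_suml.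
rewrite [RHS]exchange_big /= exchange_big /=; apply: eq_bigr => w _.
rewrite [RHS](reindex_inj (mulgI w)) /=; apply: eq_bigr => w' _.
by rewrite mulKg.
Qed.
Lemma sk_mul1l : left_id sk_one sk_mul.
Proof.
move=> p; apply/ffunP=> v; rewrite ffunE (bigD1 1%g) //= ffunE eqxx mul1r.
rewrite wa_act1 invg1 mul1g big1 ?addr0 // => w /negPf w1.
by rewrite ffunE w1 mul0r.
Qed.
Lemma sk_mul1r : right_id sk_one sk_mul.
Proof.
move=> p; apply/ffunP=> v; rewrite ffunE (bigD1 v) //= ffunE mulVg eqxx ah1 mulr1.
rewrite big1 ?addr0 // => w /negPf wv; rewrite ffunE.
by rewrite -eq_mulVg1 wv ah0 mulr0.
Qed.
Lemma sk_mulDl : left_distributive sk_mul +%R.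
Proof.
move=> p q r; apply/ffunP=> v; rewrite !ffunE -big_split; apply: eq_bigr => w _.
by rewrite ffunE mulrDl.
Qed.
Lemma sk_mulDr : right_distributive sk_mul +%R.
Proof.
move=> p q r; apply/ffunP=> v; rewrite !ffunE -big_split; apply: eq_bigr => w _.
by rewrite ffunE ahD mulrDr.
Qed.
HB.instance Definition _ := GRing.Zmodule_isPzRing.Build skew_ring
  sk_mulA sk_mul1l sk_mul1r sk_mulDl sk_mulDr.

Lemma sk_mulE p q v : (p * q) v = \sum_(w : W) p w * wa_act B w (q (w^-1 * v)%g).
Proof. exact: ffunE. Qed.

Definition sk_mon (b : B) (w : W) : skew_ring := [ffun v => if v == w then b else 0].

Lemma sk_monM b w b' w' :
  sk_mon b w * sk_mon b' w' = sk_mon (b * wa_act B w b') (w * w')%g.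
Proof.
apply/ffunP=> v; rewrite sk_mulE (bigD1 w) //= !ffunE eqxx big1 ?addr0.
  rewrite (can2_eq (mulKVg w) (mulKg w)); case: eqP => // _.
  by rewrite ah0 mulr0.
by move=> w1 /negPf ww1; rewrite ffunE ww1 mul0r.
Qed.
Lemma sk_monB b b' w : sk_mon (b - b') w = sk_mon b w - sk_mon b' w.
Proof. by apply/ffunP=> v; rewrite !ffunE; case: eqP => // _; rewrite subr0. Qed.
Lemma sk_mon1 : sk_mon 1 1%g = 1.
Proof. by apply/ffunP=> v; rewrite !ffunE; case: eqP. Qed.
Lemma sk_decomp p : p = \sum_(w : W) sk_mon (p w) w.
Proof.
apply/ffunP=> v; rewrite sum_ffunE (bigD1 v) //= ffunE eqxx big1 ?addr0 // => w.
by move/negPf=> wv; rewrite ffunE eq_sym wv.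
Qed.

Definition sk_scal (k : F) : skew_ring := sk_mon (al_scal k) 1%g.
Lemma sk_scal_additive : zmod_morphism sk_scal.
Proof. by move=> k l; rewrite /sk_scal rmorphB sk_monB. Qed.
Lemma sk_scal_monoid : monoid_morphism sk_scal.
Proof.
split=> [|k l]; first by rewrite /sk_scal rmorph1 sk_mon1.
by rewrite /sk_scal sk_monM wa_act1 mulg1 rmorphM.
Qed.
HB.instance Definition _ :=
  GRing.isZmodMorphism.Build F skew_ring sk_scal sk_scal_additive.
HB.instance Definition _ :=
  GRing.isMonoidMorphism.Build F skew_ring sk_scal sk_scal_monoid.
Lemma sk_scal_central k p : sk_scal k * p = p * sk_scal k.
Proof.
rewrite (sk_decomp p) mulr_sumr mulr_suml; apply: eq_bigr => w _.
by rewrite /sk_scal !sk_monM wa_act1 ah_scal al_central mulg1 mul1g.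
Qed.
Definition skew_alg : algebra F := Algebra sk_scal_central.

Definition sk_in_fun (b : B) : skew_alg := sk_mon b 1%g.
Lemma sk_in_additive : zmod_morphism sk_in_fun.
Proof. by move=> b b'; apply: sk_monB. Qed.
Lemma sk_in_monoid : monoid_morphism sk_in_fun.
Proof.
split=> [|b b']; first exact: sk_mon1.
by rewrite [RHS]sk_monM wa_act1 mulg1.
Qed.
Definition sk_in : algHom B skew_alg :=
  AlgHom sk_in_additive sk_in_monoid (fun k => erefl).

Definition sk_grp (w : W) : skew_alg := sk_mon 1 w.
Lemma sk_grp1 : sk_grp 1%g = 1.
Proof. exact: sk_mon1. Qed.
Lemma sk_grpM w w' : sk_grp (w * w')%g = sk_grp w * sk_grp w'.
Proof. by rewrite [RHS]sk_monM ah1 mulr1. Qed.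
Lemma sk_comm w b : sk_grp w * sk_in b = sk_in (wa_act B w b) * sk_grp w.
Proof. by rewrite [LHS]sk_monM [RHS]sk_monM mul1r ah1 mulr1 mulg1 mul1g. Qed.

Section Lift.
Variables (A : algebra F) (f : algHom B A) (u : W -> A).
Hypotheses (u1 : u 1%g = 1) (uM : forall w w', u (w * w')%g = u w * u w').
Hypothesis fu : forall w b, u w * f b = f (wa_act B w b) * u w.

Definition skew_lift_fun (p : skew_alg) : A := \sum_(w : W) f (p w) * u w.
Lemma skew_lift_mon b w : skew_lift_fun (sk_mon b w) = f b * u w.
Proof.
rewrite /skew_lift_fun (bigD1 w) //= ffunE eqxx big1 ?addr0 // => w' /negPf ww'.
by rewrite ffunE ww' ah0 mul0r.
Qed.
Lemma skew_lift_additive : zmod_morphism skew_lift_fun.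
Proof.
move=> p q; rewrite /skew_lift_fun -sumrB; apply: eq_bigr => w _.
by rewrite !ffunE ahB mulrBl.
Qed.
HB.instance Definition _ :=
  GRing.isZmodMorphism.Build skew_alg A skew_lift_fun skew_lift_additive.
Lemma skew_lift_monoid : monoid_morphism skew_lift_fun.
Proof.
split=> [|p q].
  by rewrite -sk_mon1; apply: (etrans (skew_lift_mon _ _)); rewrite ah1 u1 mulr1.
rewrite (sk_decomp p) (sk_decomp q) mulr_suml !raddf_sum mulr_suml /=.
apply: eq_bigr => w _; rewrite mulr_sumr raddf_sum mulr_sumr /=.
apply: eq_bigr => w' _.
transitivity (skew_lift_fun (sk_mon (p w * wa_act B w (q w')) (w * w')%g)).
  by rewrite -sk_monM.
rewrite !skew_lift_mon ahM uM.
by rewrite -!mulrA [in RHS]mulrA -[in RHS]mulrA [X in _ = _ * X]mulrA fu !mulrA.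
Qed.
Lemma skew_lift_scal k : skew_lift_fun (al_scal k) = al_scal k.
Proof. by rewrite skew_lift_mon u1 mulr1 ah_scal. Qed.
Definition skew_lift : algHom skew_alg A :=
  AlgHom skew_lift_additive skew_lift_monoid skew_lift_scal.
End Lift.

End SkewGroupAlgebra.

Section GroupAlgebra.
Variables (F : fieldType) (W : finGroupType).
Lemma idHom_scal (A : algebra F) k : (idfun : A -> A) (al_scal k) = al_scal k.
Proof. by []. Qed.
Lemma idHom_additive (A : algebra F) : zmod_morphism (idfun : A -> A).
Proof. by []. Qed.
Lemma idHom_monoid (A : algebra F) : monoid_morphism (idfun : A -> A).
Proof. by []. Qed.
Definition idHom (A : algebra F) : algHom A A :=
  AlgHom (@idHom_additive A) (@idHom_monoid A) (@idHom_scal A).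
Definition triv_walg : walg F W :=
  @WAlg F W (base_alg F) (fun _ => idHom _) (fun _ => erefl) (fun _ _ _ => erefl).
Definition group_alg : algebra F := skew_alg triv_walg.
End GroupAlgebra.

Section QuotientAction.
Variables (F : fieldType) (W : finGroupType) (B : walg F W) (S : B -> Prop).
Hypothesis S_stable : forall w x, S x -> S (wa_act B w x).

Lemma quot_act_kills w x : S x -> ah_comp (quot_proj S) (wa_act B w) x = 0.
Proof.
move=> Sx; rewrite -[RHS](ah0 (quot_proj S)); apply/qpiE; rewrite subr0.
exact/ideal_gen/S_stable.
Qed.
Definition quot_act w : algHom (quot_alg S) (quot_alg S) :=
  quot_lift (@quot_act_kills w).
Lemma quot_actE w b : quot_act w (quot_proj S b) = quot_proj S (wa_act B w b).
Proof. exact: quot_liftE. Qed.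
Lemma quot_act1 q : quot_act 1%g q = q.
Proof.
case: (qpi_surj q) => b ->; rewrite -[qpi _ b]/(quot_proj S b) quot_actE.
by rewrite wa_act1.
Qed.
Lemma quot_actM w w' q : quot_act (w * w')%g q = quot_act w (quot_act w' q).
Proof.
case: (qpi_surj q) => b ->; rewrite -[qpi _ b]/(quot_proj S b) !quot_actE.
by rewrite wa_actM.
Qed.
Definition quot_walg : walg F W := WAlg quot_act1 quot_actM.
End QuotientAction.

Section SymmetricAlgebra.
Variables (F : fieldType) (W : finGroupType) (V : wrep F W).

Lemma tens_act_subproof w k (u v : V) :
  tvar (wr_act w (k *: u + v)) = al_scal k * tvar (wr_act w u) + tvar (wr_act w v).
Proof. by rewrite wr_linear tvar_linear. Qed.
Definition tens_act w : algHom (tens_alg V) (tens_alg V) :=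
  tens_lift (tens_act_subproof w).
Lemma tens_actE w v : tens_act w (tvar v) = tvar (wr_act w v).
Proof. exact: tens_liftE. Qed.
Lemma tens_act1 p : tens_act 1%g p = p.
Proof.
elim/tens_ind: p => [v|k|x y hx hy|x y hx hy].
- by rewrite tens_actE wr_act1.
- by rewrite ah_scal.
- by rewrite ahD hx hy.
- by rewrite ahM hx hy.
Qed.
Lemma tens_actM w w' p : tens_act (w * w')%g p = tens_act w (tens_act w' p).
Proof.
elim/tens_ind: p => [v|k|x y hx hy|x y hx hy].
- by rewrite !tens_actE wr_actM.
- by rewrite !ah_scal.
- by rewrite !ahD hx hy.
- by rewrite !ahM hx hy.
Qed.
Definition tens_walg : walg F W := WAlg tens_act1 tens_actM.

(* S(V) = F[V^* ] is the quotient of T(V) by the commutators of elements of V *)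
Definition sym_rel (t : tens_walg) : Prop :=
  exists u v : V, t = tvar u * tvar v - tvar v * tvar u.
Lemma sym_rel_stable w t : sym_rel t -> sym_rel (wa_act tens_walg w t).
Proof.
move=> [u [v ->]]; exists (wr_act w u), (wr_act w v).
by rewrite -[wa_act tens_walg w]/(tens_act w) ahB !ahM !tens_actE.
Qed.
Definition sym_walg : walg F W := quot_walg sym_rel_stable.
Definition svar (v : V) : sym_walg := quot_proj sym_rel (tvar v).

Lemma zero_map_linear k (u v : V) :
  0 = al_scal k * 0 + 0 :> base_alg F.
Proof. by rewrite mulr0 addr0. Qed.
Lemma zero_map_kills t : sym_rel t -> tens_lift zero_map_linear t = 0.
Proof. by move=> [u [v ->]]; rewrite ahB !ahM !tens_liftE mulr0 subrr. Qed.
Definition const_term : algHom sym_walg (base_alg F) := quot_lift zero_map_kills.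

Definition sym_inv (p : sym_walg) : Prop := forall w, wa_act sym_walg w p = p.

Definition coinv_rel (p : sym_walg) : Prop := sym_inv p /\ const_term p = 0.
Lemma coinv_rel_stable w p : coinv_rel p -> coinv_rel (wa_act sym_walg w p).
Proof. by move=> [hp p0]; split; [move=> w'|]; rewrite !hp. Qed.
Definition coinv_walg : walg F W := quot_walg coinv_rel_stable.

Lemma coinv_const_kills p : coinv_rel p -> const_term p = 0.
Proof. by case. Qed.
Definition coinv_const : algHom coinv_walg (base_alg F) :=
  quot_lift coinv_const_kills.
Lemma coinv_constE p : coinv_const (quot_proj coinv_rel p) = const_term p.
Proof. exact: quot_liftE. Qed.

Lemma sym_ind (P : sym_walg -> Prop) :
  (forall v, P (svar v)) -> (forall k, P (al_scal k)) ->
  (forall x y, P x -> P y -> P (x + y)) ->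
  (forall x y, P x -> P y -> P (x * y)) -> forall x, P x.
Proof.
move=> Pv Pc PD PM x; case: (qpi_surj x) => t ->.
rewrite -[qpi _ t]/(quot_proj sym_rel t).
elim/tens_ind: t => [v|k|s t hs ht|s t hs ht].
- exact: Pv.
- by rewrite ah_scal; apply: Pc.
- by rewrite ahD; apply: PD.
- by rewrite ahM; apply: PM.
Qed.

Lemma const_term_svar v : const_term (svar v) = 0.
Proof. by rewrite /const_term /svar quot_liftE tens_liftE. Qed.
Lemma sym_actE w v : wa_act sym_walg w (svar v) = svar (wr_act w v).
Proof.
rewrite -[wa_act sym_walg w]/(quot_act sym_rel_stable w) quot_actE.
by rewrite -[wa_act tens_walg w]/(tens_act w) tens_actE.
Qed.
Lemma const_term_act w p : const_term (wa_act sym_walg w p) = const_term p.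
Proof.
elim/sym_ind: p => [v|k|x y hx hy|x y hx hy].
- by rewrite sym_actE !const_term_svar.
- by rewrite !ah_scal.
- by rewrite !ahD hx hy.
- by rewrite !ahM hx hy.
Qed.

Section Lift.
Variables (A : algebra F) (e : V -> A).
Hypothesis e_lin : forall k u v, e (k *: u + v) = al_scal k * e u + e v.
Hypothesis e_comm : forall u v, e u * e v = e v * e u.
Lemma sym_lift_kills t : sym_rel t -> tens_lift e_lin t = 0.
Proof. by move=> [u [v ->]]; rewrite ahB !ahM !tens_liftE e_comm subrr. Qed.
Definition sym_lift : algHom sym_walg A := quot_lift sym_lift_kills.
Lemma sym_liftE v : sym_lift (svar v) = e v.
Proof. by rewrite /sym_lift quot_liftE tens_liftE. Qed.

Variable u : W -> A.
Hypothesis ue : forall w v, u w * e v = e (wr_act w v) * u w.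
Lemma sym_lift_act w p : u w * sym_lift p = sym_lift (wa_act sym_walg w p) * u w.
Proof.
elim/sym_ind: p => [v|k|x y hx hy|x y hx hy].
- by rewrite sym_actE !sym_liftE ue.
- by rewrite !ah_scal al_central.
- by rewrite !ahD mulrDr mulrDl hx hy.
- by rewrite !ahM mulrA hx -mulrA hy mulrA.
Qed.
End Lift.

End SymmetricAlgebra.

(* With V = h (resp. V = h^* ), borel V is B^+ = A^+ T (resp. B^- = A^- T):   *)
(* the triangular decomposition identifies it with the subalgebra A^+- T of A *)
(* as A^+- is the coinvariant algebra and T normalizes it.  borel_proj kills  *)
(* the nonzero degrees, so restriction along it turns a T-module into a       *)
(* B^+- module on which these degrees act by zero.                            *)
Section BorelAlgebra.
Variables (F : fieldType) (W : finGroupType) (V : wrep F W).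

Definition borel : algebra F := skew_alg (coinv_walg V).

Lemma borel_proj_comm w (b : coinv_walg V) :
  sk_grp (triv_walg F W) w * ah_comp (sk_in (triv_walg F W)) (coinv_const V) b
  = ah_comp (sk_in (triv_walg F W)) (coinv_const V) (wa_act (coinv_walg V) w b)
    * sk_grp (triv_walg F W) w.
Proof.
case: (qpi_surj b) => p ->; rewrite -[qpi _ p]/(quot_proj (@coinv_rel _ _ V) p).
rewrite -[wa_act (coinv_walg V) w]/(quot_act (@coinv_rel_stable _ _ V) w) quot_actE.
rewrite -![ah_comp _ _ _]/(sk_in (triv_walg F W) (coinv_const V _)).
by rewrite !coinv_constE const_term_act sk_comm.
Qed.
Definition borel_proj : algHom borel (group_alg F W) :=
  skew_lift (sk_grp1 _) (@sk_grpM _ _ _) borel_proj_comm.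

Section Lift.
Variables (A : algebra F) (f : algHom (sym_walg V) A) (u : W -> A).
Hypothesis f_kills : forall p, coinv_rel p -> f p = 0.
Hypotheses (u1 : u 1%g = 1) (uM : forall w w', u (w * w')%g = u w * u w').
Hypothesis fu : forall w p, u w * f p = f (wa_act (sym_walg V) w p) * u w.
Lemma borel_lift_comm w (b : coinv_walg V) :
  u w * quot_lift f_kills b
  = quot_lift f_kills (wa_act (coinv_walg V) w b) * u w.
Proof.
case: (qpi_surj b) => p ->; rewrite -[qpi _ p]/(quot_proj (@coinv_rel _ _ V) p).
rewrite -[wa_act (coinv_walg V) w]/(quot_act (@coinv_rel_stable _ _ V) w) quot_actE.
by rewrite !quot_liftE fu.
Qed.
Definition borel_lift : algHom borel A := skew_lift u1 uM borel_lift_comm.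
End Lift.

End BorelAlgebra.

Record frep (F : fieldType) (W : finGroupType) := FRep {
  fr_sp :> vectType F;
  fr_act : W -> 'End(fr_sp);
  fr_act1 : fr_act 1%g = \1%VF;
  fr_actM : forall w w', fr_act (w * w')%g = (fr_act w \o fr_act w')%VF
}.

Section FRep.
Variables (F : fieldType) (W : finGroupType) (h : frep F W).

Definition dual_sp := 'Hom(h, F^o).
Definition dual_act_fun (w : W) (x : dual_sp) : dual_sp :=
  (x \o fr_act h w^-1)%VF.
Lemma dual_act_linear w : linear (dual_act_fun w).
Proof. by move=> k x y; rewrite /dual_act_fun comp_lfunDl comp_lfunZl. Qed.
HB.instance Definition _ w :=
  GRing.isLinear.Build F dual_sp dual_sp _ (dual_act_fun w) (dual_act_linear w).
Definition dual_act w : 'End(dual_sp) := linfun (dual_act_fun w).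
Lemma dual_actE w x y : dual_act w x y = x (fr_act h w^-1 y).
Proof. by rewrite lfunE /= comp_lfunE. Qed.
Lemma dual_act1 : dual_act 1%g = \1%VF.
Proof.
apply/lfunP=> x; apply/lfunP=> y.
by rewrite dual_actE invg1 fr_act1 !id_lfunE.
Qed.
Lemma dual_actM w w' : dual_act (w * w')%g = (dual_act w \o dual_act w')%VF.
Proof.
apply/lfunP=> x; apply/lfunP=> y.
by rewrite comp_lfunE !dual_actE invMg fr_actM comp_lfunE.
Qed.
Definition dual_frep : frep F W := FRep dual_act1 dual_actM.

Lemma fr_linear w : linear (fr_act h w).
Proof. exact: linearP. Qed.
Lemma fr_wact1 v : fr_act h 1%g v = v.
Proof. by rewrite fr_act1 id_lfunE. Qed.
Lemma fr_wactM w w' v : fr_act h (w * w')%g v = fr_act h w (fr_act h w' v).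
Proof. by rewrite fr_actM comp_lfunE. Qed.
Definition frep_wrep : wrep F W := WRep fr_linear fr_wact1 fr_wactM.

Definition reflections : {set W} :=
  [set s | (\dim (lker (\1 - fr_act h s)%VF)).+1 == \dim {:h}].

(* Injectivity makes W a subgroup of GL(h). *)
Definition reflection_group : Prop :=
  [/\ injective (fr_act h), [set: W] != 1%g & <<reflections>>%g = [set: W]].

Definition root_data (al : W -> dual_sp) (alv : W -> h) : Prop :=
  forall s, s \in reflections ->
  [/\ <[al s]>%VS = limg (dual_act s - \1)%VF,
      <[alv s]>%VS = limg (fr_act h s - \1)%VF
    & al s (alv s) = 2%:R].

(* Only the values of c on the reflections matter. *)
Definition conj_invariant (c : W -> F) : Prop :=
  forall s w, s \in reflections -> c (s ^ w)%g = c s.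

End FRep.

Coercion frep_wrep : frep >-> wrep.

Section Cherednik.
Variables (F : fieldType) (W : finGroupType) (h : frep F W).
Variables (c : W -> F) (al : W -> dual_sp h) (alv : W -> h).

Notation h' := (dual_frep h).

Definition dbl_act (w : W) (v : h * h') : h * h' :=
  (fr_act h w v.1, fr_act h' w v.2).
Lemma dbl_linear w : linear (dbl_act w).
Proof. by move=> k u v; rewrite /dbl_act /= !linearP. Qed.
Lemma dbl_act1 v : dbl_act 1%g v = v.
Proof. by case: v => y x; rewrite /dbl_act !fr_wact1. Qed.
Lemma dbl_actM w w' v : dbl_act (w * w')%g v = dbl_act w (dbl_act w' v).
Proof. by rewrite /dbl_act !fr_wactM. Qed.
Definition dbl_wrep : wrep F W := WRep dbl_linear dbl_act1 dbl_actM.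

(* T(h + h^* ) >< W *)
Definition tens_skew : algebra F := skew_alg (tens_walg dbl_wrep).

Definition ty (y : h) : tens_skew :=
  sk_in (tens_walg dbl_wrep) (tvar ((y, 0) : dbl_wrep)).
Definition tx (x : h') : tens_skew :=
  sk_in (tens_walg dbl_wrep) (tvar ((0, x) : dbl_wrep)).
Definition tw (w : W) : tens_skew := sk_grp (tens_walg dbl_wrep) w.

Inductive cherednik_rel : tens_skew -> Prop :=
| rel_xx x x' : cherednik_rel (tx x * tx x' - tx x' * tx x)
| rel_yy y y' : cherednik_rel (ty y * ty y' - ty y' * ty y)
| rel_yx y x : cherednik_rel
    ((ty y * tx x - tx x * ty y)
     - - \sum_(s in reflections h)
           al_scal (c s * (al s : 'Hom(h, F^o)) y * (x : 'Hom(h, F^o)) (alv s)) * tw s).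

Definition cherednik : algebra F := quot_alg cherednik_rel.

Definition cy (y : h) : cherednik := quot_proj cherednik_rel (ty y).
Definition cx (x : h') : cherednik := quot_proj cherednik_rel (tx x).
Definition cw (w : W) : cherednik := quot_proj cherednik_rel (tw w).

Lemma cy_lin k u v : cy (k *: u + v) = al_scal k * cy u + cy v.
Proof.
have -> : cy (k *: u + v) =
    quot_proj cherednik_rel (sk_in (tens_walg dbl_wrep) (tvar (k *: ((u, 0) : dbl_wrep) + (v, 0)))).
  congr (quot_proj _ (sk_in (tens_walg dbl_wrep) (tvar _))).
  by apply: injective_projections => //=; rewrite scaler0 addr0.
by rewrite tvar_linear !ahD !ahM !ah_scal.
Qed.
Lemma cx_lin k u v : cx (k *: u + v) = al_scal k * cx u + cx v.
Proof.
have -> : cx (k *: u + v) =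
    quot_proj cherednik_rel (sk_in (tens_walg dbl_wrep) (tvar (k *: ((0, u) : dbl_wrep) + (0, v)))).
  congr (quot_proj _ (sk_in (tens_walg dbl_wrep) (tvar _))).
  by apply: injective_projections => //=; rewrite scaler0 addr0.
by rewrite tvar_linear !ahD !ahM !ah_scal.
Qed.
Lemma cy_comm u v : cy u * cy v = cy v * cy u.
Proof.
by rewrite /cy -2!(ahM (quot_proj cherednik_rel)); apply/qpiE/ideal_gen/rel_yy.
Qed.
Lemma cx_comm u v : cx u * cx v = cx v * cx u.
Proof.
by rewrite /cx -2!(ahM (quot_proj cherednik_rel)); apply/qpiE/ideal_gen/rel_xx.
Qed.
Lemma cw1 : cw 1%g = 1.
Proof. by rewrite /cw /tw sk_grp1 ah1. Qed.
Lemma cwM w w' : cw (w * w')%g = cw w * cw w'.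
Proof. by rewrite /cw /tw sk_grpM ahM. Qed.
Lemma cw_cy w y : cw w * cy y = cy (@wr_act F W h w y) * cw w.
Proof.
rewrite /cw /cy /tw /ty -2!(ahM (quot_proj cherednik_rel)) sk_comm.
rewrite -[wa_act (tens_walg dbl_wrep) w]/(tens_act dbl_wrep w) tens_actE.
by rewrite /= /dbl_act /= linear0.
Qed.
Lemma cw_cx w x : cw w * cx x = cx (@wr_act F W h' w x) * cw w.
Proof.
rewrite /cw /cx /tw /tx -2!(ahM (quot_proj cherednik_rel)) sk_comm.
rewrite -[wa_act (tens_walg dbl_wrep) w]/(tens_act dbl_wrep w) tens_actE.
by rewrite /= /dbl_act /= linear0.
Qed.

(* C[h^* ] = S(h) and C[h] = S(h^* ) inside the Cherednik algebra *)
Definition pol_y : algHom (sym_walg h) cherednik :=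
  @sym_lift F W h _ cy cy_lin cy_comm.
Definition pol_x : algHom (sym_walg h') cherednik :=
  @sym_lift F W h' _ cx cx_lin cx_comm.

(* r lies in R_+ : r is the image of \sum_i p_i (x) q_i in                   *)
(* C[h]^W (x) C[h^* ]^W, and the constant term of this tensor vanishes       *)
Definition in_Rplus (r : cherednik) : Prop :=
  exists s : seq (sym_walg h' * sym_walg h),
  [/\ forall pq, pq \in s -> sym_inv pq.1 /\ sym_inv pq.2,
      \sum_(pq <- s) const_term h' pq.1 * const_term h pq.2 = 0
    & r = \sum_(pq <- s) pol_x pq.1 * pol_y pq.2].

Definition rcherednik : algebra F := quot_alg in_Rplus.
Definition rproj : algHom cherednik rcherednik := quot_proj in_Rplus.

(* deg h^* = -1, deg h = 1, deg W = 0 *)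
Inductive gen_deg : int -> rcherednik -> Prop :=
| gd_x x : gen_deg (-1) (rproj (cx x))
| gd_y y : gen_deg 1 (rproj (cy y))
| gd_w w : gen_deg 0 (rproj (cw w))
| gd_scal k : gen_deg 0 (al_scal k)
| gd_zero i : gen_deg i 0
| gd_sub i a b of gen_deg i a & gen_deg i b : gen_deg i (a - b)
| gd_mul i j a b of gen_deg i a & gen_deg j b : gen_deg (i + j) (a * b).

Lemma sym_inv1 (V : wrep F W) : sym_inv (1 : sym_walg V).
Proof. by move=> w; rewrite ah1. Qed.
Lemma rpol_y_kills p : coinv_rel p -> ah_comp rproj pol_y p = 0.
Proof.
move=> [p_inv p0]; rewrite -[RHS](ah0 rproj); apply/qpiE; rewrite subr0.
apply: ideal_gen; exists [:: (1, p)]; split.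
- by move=> pq; rewrite inE => /eqP -> /=; split=> //; apply: sym_inv1.
- by rewrite big_seq1 -[(1, p).2]/p p0 mulr0.
- by rewrite big_seq1 -[(1, p).1]/1 (ah1 pol_x) mul1r.
Qed.
Lemma rpol_x_kills p : coinv_rel p -> ah_comp rproj pol_x p = 0.
Proof.
move=> [p_inv p0]; rewrite -[RHS](ah0 rproj); apply/qpiE; rewrite subr0.
apply: ideal_gen; exists [:: (p, 1)]; split.
- by move=> pq; rewrite inE => /eqP -> /=; split=> //; apply: sym_inv1.
- by rewrite big_seq1 -[(p, 1).1]/p p0 mul0r.
- by rewrite big_seq1 -[(p, 1).2]/1 (ah1 pol_y) mulr1.
Qed.

Definition rw (w : W) : rcherednik := rproj (cw w).
Lemma rw1 : rw 1%g = 1. Proof. by rewrite /rw cw1 ah1. Qed.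
Lemma rwM w w' : rw (w * w')%g = rw w * rw w'.
Proof. by rewrite /rw cwM ahM. Qed.
Lemma rpol_y_comm w p :
  rw w * ah_comp rproj pol_y p = ah_comp rproj pol_y (wa_act (sym_walg h) w p) * rw w.
Proof.
rewrite -![ah_comp rproj pol_y _]/(rproj (pol_y _)) -2!(ahM rproj).
by rewrite /pol_y (@sym_lift_act F W h _ _ _ _ _ cw_cy).
Qed.
Lemma rpol_x_comm w p :
  rw w * ah_comp rproj pol_x p = ah_comp rproj pol_x (wa_act (sym_walg h') w p) * rw w.
Proof.
rewrite -![ah_comp rproj pol_x _]/(rproj (pol_x _)) -2!(ahM rproj).
by rewrite /pol_x (@sym_lift_act F W h' _ _ _ _ _ cw_cx).
Qed.

Definition borel_plus : algebra F := borel h.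
Definition borel_minus : algebra F := borel h'.
Definition borel_plus_in : algHom borel_plus rcherednik :=
  borel_lift rpol_y_kills rw1 rwM rpol_y_comm.
Definition borel_minus_in : algHom borel_minus rcherednik :=
  borel_lift rpol_x_kills rw1 rwM rpol_x_comm.

End Cherednik.

Record gralg (F : fieldType) := GrAlg {
  ga_alg :> algebra F;
  ga_deg : int -> ga_alg -> Prop
}.

(* (A^op)_i = A_{-i} *)
Definition op_gralg (F : fieldType) (A : gralg F) : gralg F :=
  @GrAlg F (op_alg A) (fun i (a : op_alg A) => @ga_deg F A (- i) a).

Record grmod (F : fieldType) (A : algebra F) := GrMod {
  gm_mod :> lmodType A;
  gm_deg : int -> gm_mod -> Prop
}.

(* M = \bigoplus_i M_i and A_i M_j is contained in M_(i + j) *)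
Definition is_graded (F : fieldType) (A : gralg F) (M : grmod A) : Prop :=
  [/\ forall i, gm_deg i (0 : M)
        /\ forall m n : M, gm_deg i m -> gm_deg i n -> gm_deg i (m - n),
      forall i j (a : A) (m : M),
        ga_deg i a -> gm_deg j m -> gm_deg (i + j) (a *: m),
      forall m : M, exists (s : seq int) (f : int -> M),
        (forall i, gm_deg i (f i)) /\ m = \sum_(i <- s) f i
    & forall (s : seq int) (f : int -> M), uniq s ->
        (forall i, gm_deg i (f i)) -> \sum_(i <- s) f i = 0 ->
        forall i, i \in s -> f i = 0].

Definition fin_gen (R : pzRingType) (M : lmodType R) : Prop :=
  exists g : seq M, forall m : M, exists a : nat -> R,
    m = \sum_(i < size g) a i *: g`_i.

(* M is an object of G(A) *)
Definition in_G (F : fieldType) (A : gralg F) (M : grmod A) : Prop :=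
  is_graded M /\ fin_gen M.

Definition graded_submodule (F : fieldType) (A : algebra F) (M : grmod A)
    (N : M -> Prop) : Prop :=
  [/\ N 0, forall m n, N m -> N n -> N (m - n),
      forall (a : A) m, N m -> N (a *: m)
    & forall m, N m -> exists (s : seq int) (f : int -> M),
        (forall i, gm_deg i (f i) /\ N (f i)) /\ m = \sum_(i <- s) f i].

Definition graded_simple (F : fieldType) (A : gralg F) (M : grmod A) : Prop :=
  [/\ in_G M, exists m : M, m <> 0
    & forall N : M -> Prop, graded_submodule N ->
        (forall m, N m -> m = 0) \/ (forall m, N m)].

(* K_0(G(A)) is presented by the classes of the objects of G(A) and the      *)
(* relations [M] = [M'] + [M''] for the short exact sequences                *)
(* 0 -> M' -> M -> M'' -> 0 of G(A); K0_eq is equality in this group.  It is *)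
(* kept as a setoid because the objects of G(A) form a large type, on which  *)
(* a zmodType cannot be based.                                               *)

Section Grothendieck.
Variables (F : fieldType) (A : gralg F).

Definition degree0 (M N : grmod A) (f : {linear M -> N}) : Prop :=
  forall i m, gm_deg i m -> gm_deg i (f m).

Definition short_exact (M' M M'' : grmod A) : Prop :=
  exists (f : {linear M' -> M}) (g : {linear M -> M''}),
  [/\ degree0 f /\ degree0 g, injective f,
      forall m'', exists m, g m = m''
    & forall m, g m = 0 <-> exists m', f m' = m].

Inductive K0_expr :=
| K0_class M of @in_G F A M
| K0_zero
| K0_opp of K0_expr
| K0_add of K0_expr & K0_expr.

Inductive K0_eq : K0_expr -> K0_expr -> Prop :=
| K0_refl x : K0_eq x x
| K0_sym x y of K0_eq x y : K0_eq y x
| K0_trans x y z of K0_eq x y & K0_eq y z : K0_eq x z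
| K0_oppC x y of K0_eq x y : K0_eq (K0_opp x) (K0_opp y)
| K0_addC x x' y y' of K0_eq x x' & K0_eq y y' :
    K0_eq (K0_add x y) (K0_add x' y')
| K0_addA x y z : K0_eq (K0_add x (K0_add y z)) (K0_add (K0_add x y) z)
| K0_comm x y : K0_eq (K0_add x y) (K0_add y x)
| K0_add0 x : K0_eq (K0_add K0_zero x) x
| K0_addN x : K0_eq (K0_add (K0_opp x) x) K0_zero
| K0_exact M' M M'' (h' : in_G M') (h : in_G M) (h'' : in_G M'') :
    short_exact M' M M'' ->
    K0_eq (K0_class h) (K0_add (K0_class h') (K0_class h'')).

End Grothendieck.

Section Restriction.
Variables (F : fieldType) (A B : algebra F) (f : algHom B A).
Section Mod.
Variable M : lmodType A.
Definition res_sp : Type := M.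
HB.instance Definition _ := GRing.Zmodule.on res_sp.
Definition res_scale (b : B) (m : res_sp) : res_sp := f b *: (m : M).
Lemma res_scaleA a b v : res_scale a (res_scale b v) = res_scale (a * b) v.
Proof. by rewrite /res_scale ahM -scalerA. Qed.
Lemma res_scale1 : left_id 1 res_scale.
Proof. by move=> v; rewrite /res_scale ah1; apply: (scale1r (v : M)). Qed.
Lemma res_scaleDr : right_distributive res_scale +%R.
Proof. by move=> b u v; apply: (scalerDr (f b) (u : M) v). Qed.
Lemma res_scaleDl v : {morph res_scale^~ v : a b / a + b}.
Proof. by move=> a b; rewrite /res_scale ahD; apply: (scalerDl (v : M)). Qed.
HB.instance Definition _ := GRing.Zmodule_isLmodule.Build B res_sp
  res_scaleA res_scale1 res_scaleDr res_scaleDl.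
End Mod.
Definition res (M : grmod A) : grmod B :=
  @GrMod F B (res_sp M) (fun i (m : res_sp M) => @gm_deg F A M i m).
End Restriction.

Section Induction.
Variables (F : fieldType) (B : algebra F) (A : gralg F) (phi : algHom B A).

Section Mod.
Variable N : lmodType B.

Definition free_AN := {freeg (A * N)%type / int}.
HB.instance Definition _ := GRing.Lmodule.on free_AN.
Definition fpair (a : A) (n : N) : free_AN := << (a, n) >>.

Inductive tensor_rel : free_AN -> Prop :=
| tr_addl a a' n : tensor_rel (fpair (a + a') n - fpair a n - fpair a' n)
| tr_addr a n n' : tensor_rel (fpair a (n + n') - fpair a n - fpair a n')
| tr_bal a b n : tensor_rel (fpair (a * phi b) n - fpair a (b *: n))
| tr_zero : tensor_rel 0
| tr_sub x y of tensor_rel x & tensor_rel y : tensor_rel (x - y).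

Definition tensor_pred : {pred free_AN} := fun x => `[< tensor_rel x >].
Lemma tensor_zmod_closed : zmod_closed tensor_pred.
Proof.
split=> [|x y]; first exact/asboolP/tr_zero.
by move=> /asboolP hx /asboolP hy; apply/asboolP/tr_sub.
Qed.
HB.instance Definition _ :=
  GRing.isZmodClosed.Build free_AN tensor_pred tensor_zmod_closed.

Definition ind_sp := {ideal_quot tensor_pred}.
HB.instance Definition _ := GRing.Zmodule.on ind_sp.
HB.instance Definition _ := Quotient.on ind_sp.

Definition ipi (x : free_AN) : ind_sp := \pi_ind_sp x.
Lemma ipiE x y : (ipi x = ipi y) <-> tensor_rel (x - y).
Proof.
split=> [e|h].
- by apply/asboolP; move/eqP: e; rewrite -Quotient.idealrBE.
- by apply/eqP; rewrite -Quotient.idealrBE; apply/asboolP.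
Qed.
Lemma ipi_surj (q : ind_sp) : {x | q = ipi x}.
Proof. by exists (repr q); rewrite /ipi reprK. Qed.
Lemma ipiB : {morph ipi : x y / x - y}.
Proof. exact: (raddfB (\pi_{ideal_quot tensor_pred})). Qed.
Lemma ipiD : {morph ipi : x y / x + y}.
Proof. exact: (raddfD (\pi_{ideal_quot tensor_pred})). Qed.
Lemma repr_ipi x : tensor_rel (repr (ipi x) - x).
Proof. by apply/ipiE; rewrite /ipi reprK. Qed.

Definition tens (a : A) (n : N) : ind_sp := ipi (fpair a n).

Definition fact (a : A) (x : free_AN) : free_AN :=
  fglift (fun p : (A * N)%type => fpair (a * p.1) p.2) x.
Lemma fact_additive a : zmod_morphism (fact a).
Proof. exact: (@lift_is_additive _ _ free_AN). Qed.
HB.instance Definition _ a :=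
  GRing.isZmodMorphism.Build free_AN free_AN (fact a) (fact_additive a).
Lemma fact_pair a b n : fact a (fpair b n) = fpair (a * b) n.
Proof. by rewrite /fact liftU scale1r. Qed.
Lemma free_ind (P : free_AN -> Prop) :
  (forall a n, P (fpair a n)) -> P 0 -> (forall x y, P x -> P y -> P (x - y)) ->
  forall x, P x.
Proof.
move=> Pp P0 PB x.
have PN y : P y -> P (- y) by move=> Py; rewrite -sub0r; apply: PB.
have PD y z : P y -> P z -> P (y + z).
  by move=> Py Pz; rewrite -[z]opprK; apply/PB/PN.
have Pn y n : P y -> P (y *+ n).
  by move=> Py; elim: n => [|n IHn]; rewrite ?mulr0n ?mulrS //; apply: PD.
have Pk k a n : P << k *g (a, n) >>.
  rewrite -[k]intz -freegU_mulz; case: k => k; last first.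
    by rewrite NegzE mulrNz; apply/PN/Pn/Pp.
  exact/Pn/Pp.
rewrite -(freeg_sumE x); elim/big_ind: _ => // -[a n] _; exact: Pk.
Qed.

Lemma tensor_relD x y : tensor_rel x -> tensor_rel y -> tensor_rel (x + y).
Proof.
move=> hx hy; rewrite -[y]opprK; apply: tr_sub => //.
by rewrite -sub0r; apply: tr_sub => //; apply: tr_zero.
Qed.

Lemma fact_rel a x : tensor_rel x -> tensor_rel (fact a x).
Proof.
elim=> {x} [b b' n|b n n'|b b' n||x y _ hx _ hy].
- by rewrite !raddfB /= !fact_pair mulrDr; apply: tr_addl.
- by rewrite !raddfB /= !fact_pair; apply: tr_addr.
- by rewrite raddfB /= !fact_pair mulrA; apply: tr_bal.
- by rewrite raddf0; apply: tr_zero.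
- by rewrite raddfB; apply: tr_sub.
Qed.

Definition ind_scale (a : A) (q : ind_sp) : ind_sp := ipi (fact a (repr q)).
Lemma ind_scaleE a x : ind_scale a (ipi x) = ipi (fact a x).
Proof. by apply/ipiE; rewrite -raddfB; apply/fact_rel/repr_ipi. Qed.

Lemma ind_scaleA a b v : ind_scale a (ind_scale b v) = ind_scale (a * b) v.
Proof.
case: (ipi_surj v) => x ->; rewrite !ind_scaleE; congr ipi.
elim/free_ind: x => [c n||x y hx hy]; first by rewrite !fact_pair mulrA.
  by rewrite !raddf0.
by rewrite !raddfB /= hx hy.
Qed.
Lemma ind_scale1 : left_id 1 ind_scale.
Proof.
move=> v; case: (ipi_surj v) => x ->; rewrite !ind_scaleE; congr ipi.
elim/free_ind: x => [c n||x y hx hy]; first by rewrite !fact_pair mul1r.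
  by rewrite !raddf0.
by rewrite !raddfB /= hx hy.
Qed.
Lemma ind_scaleDr : right_distributive ind_scale +%R.
Proof.
move=> a u v; case: (ipi_surj u) (ipi_surj v) => x -> [y ->].
by rewrite -ipiD !ind_scaleE raddfD ipiD.
Qed.
Lemma subB_addB (Z : zmodType) (p q r s t u : Z) :
  p - q - ((r - s) + (t - u)) = (p - (r + t)) - (q - (s + u)).
Proof.
have -> : (r - s) + (t - u) = (r + t) - (s + u) by rewrite addrACA -opprD.
by rewrite !opprB addrACA [in RHS]addrACA; congr (_ + _); rewrite addrC.
Qed.
Lemma ind_scaleDl v : {morph ind_scale^~ v : a b / a + b}.
Proof.
move=> a b; case: (ipi_surj v) => x ->; rewrite !ind_scaleE -ipiD; apply/ipiE.
elim/free_ind: x => [c n||x y hx hy].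
- by rewrite !fact_pair opprD addrA mulrDl; apply: tr_addl.
- by rewrite !raddf0 addr0 subr0; apply: tr_zero.
- rewrite !raddfB /=.
  rewrite subB_addB; exact: tr_sub.
Qed.
HB.instance Definition _ := GRing.Zmodule_isLmodule.Build A ind_sp
  ind_scaleA ind_scale1 ind_scaleDr ind_scaleDl.

End Mod.

(* A (x)_B N, whose degree k part is spanned by the a (x) n with a in A_i,   *)
(* n in N_j and i + j = k                                                   *)
Inductive ind_deg (N : grmod B) : int -> ind_sp N -> Prop :=
| id_tens i j (a : A) (n : N) of ga_deg i a & gm_deg j n :
    ind_deg (i + j) (tens a n)
| id_zero i : ind_deg i 0
| id_sub i x y of ind_deg i x & ind_deg i y : ind_deg i (x - y).

Definition ind (N : grmod B) : grmod A := @GrMod F A (ind_sp N) (@ind_deg N).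

End Induction.

Section Dual.
Variables (F : fieldType) (A : algebra F).

Section Mod.
Variable M : lmodType A.

Definition is_functional (f : M -> F) : Prop :=
  (forall m n, f (m + n) = f m + f n) /\
  (forall k m, f (al_scal k *: m) = k * f m).

Record dual_mod := DualMod { df :> M -> F; dfP : is_functional df }.
HB.instance Definition _ := gen_eqMixin dual_mod.
HB.instance Definition _ := gen_choiceMixin dual_mod.

Lemma dual_eq (f g : dual_mod) : (forall m, f m = g m) -> f = g.
Proof.
case: f g => f hf [g hg] /= e; have {e} e : f = g by apply: funext.
by rewrite e in hf *; congr DualMod; apply: Prop_irrelevance.
Qed.

Lemma dfD (f : dual_mod) m n : f (m + n) = f m + f n.
Proof. by case: f => f []. Qed.
Lemma dfZ (f : dual_mod) k m : f (al_scal k *: m) = k * f m.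
Proof. by case: f => f []. Qed.

Lemma dm_zeroP : is_functional (fun _ => 0).
Proof. by split=> *; rewrite ?addr0 ?mulr0. Qed.
Lemma dm_oppP (f : dual_mod) : is_functional (fun m => - f m).
Proof. by split=> *; rewrite ?dfD ?dfZ ?opprD ?mulrN. Qed.
Lemma dm_addP (f g : dual_mod) : is_functional (fun m => f m + g m).
Proof. by split=> *; rewrite ?dfD ?dfZ ?mulrDr // addrACA. Qed.
Lemma dm_scaleP (a : A) (f : dual_mod) : is_functional (fun m => f (a *: m)).
Proof.
split=> *; rewrite ?scalerDr ?dfD //.
by rewrite scalerA -al_central -scalerA dfZ.
Qed.
Definition dm_zero := DualMod dm_zeroP.
Definition dm_opp f := DualMod (dm_oppP f).
Definition dm_add f g := DualMod (dm_addP f g).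
Lemma dm_addA : associative dm_add.
Proof. by move=> f g k; apply: dual_eq => m; apply: addrA. Qed.
Lemma dm_addC : commutative dm_add.
Proof. by move=> f g; apply: dual_eq => m; apply: addrC. Qed.
Lemma dm_add0 : left_id dm_zero dm_add.
Proof. by move=> f; apply: dual_eq => m; apply: add0r. Qed.
Lemma dm_addN : left_inverse dm_zero dm_opp dm_add.
Proof. by move=> f; apply: dual_eq => m; apply: addNr. Qed.
HB.instance Definition _ := GRing.isZmodule.Build dual_mod
  dm_addA dm_addC dm_add0 dm_addN.

Definition dm_scale (a : op_alg A) (f : dual_mod) : dual_mod :=
  DualMod (dm_scaleP (a : A) f).
Lemma dm_scaleA a b v : dm_scale a (dm_scale b v) = dm_scale (a * b) v.
Proof. by apply: dual_eq => m /=; rewrite scalerA. Qed.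
Lemma dm_scale1 : left_id 1 dm_scale.
Proof. by move=> f; apply: dual_eq => m /=; rewrite scale1r. Qed.
Lemma dm_scaleDr : right_distributive dm_scale +%R.
Proof. by move=> a f g; apply: dual_eq. Qed.
Lemma dm_scaleDl v : {morph dm_scale^~ v : a b / a + b}.
Proof. by move=> a b; apply: dual_eq => m /=; rewrite scalerDl dfD. Qed.
HB.instance Definition _ := GRing.Zmodule_isLmodule.Build (op_alg A) dual_mod
  dm_scaleA dm_scale1 dm_scaleDr dm_scaleDl.
End Mod.

(* M^* = Hom_F(M, F) with (M^* )_i = (M_i)^*, the functionals that vanish    *)
(* on M_j for all j != i                                                    *)
Definition dual (M : grmod A) : grmod (op_alg A) :=
  @GrMod F (op_alg A) (dual_mod M)
    (fun i (f : dual_mod M) => forall j m, j != i -> @gm_deg F A M j m -> f m = 0).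

End Dual.

Section BGG.
Variables (F : fieldType) (T : gralg F) (Bp Bm : algebra F) (A : gralg F).
Variables (ip : algHom Bp A) (pp : algHom Bp T).
Variables (im : algHom Bm A) (pm : algHom Bm T).

Definition standard (la : grmod T) : grmod A := ind ip (res pp la).

Definition costandard (la : grmod T) : grmod A :=
  res (to_opop A)
    (dual (@ind F _ (op_gralg A) (op_hom im) (res (op_hom pm) (dual la)))).

(* The conclusion includes that both modules are objects of G(A). *)
Definition is_BGG : Prop :=
  forall la : grmod T, graded_simple la ->
  exists (Hs : in_G (standard la)) (Hc : in_G (costandard la)),
    K0_eq (K0_class Hs) (K0_class Hc).
End BGG.

Section RestrictedCherednikBGG.
Variables (F : fieldType) (W : finGroupType) (h : frep F W).
Variables (c : W -> F) (al : W -> dual_sp h) (alv : W -> h).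

Definition rcherednik_gr : gralg F :=
  @GrAlg F (rcherednik c al alv) (@gen_deg F W h c al alv).

Definition group_gralg : gralg F :=
  @GrAlg F (group_alg F W) (fun i a => i = 0 \/ a = 0).

Definition rcherednik_BGG : Prop :=
  @is_BGG F group_gralg (borel_plus h) (borel_minus h) rcherednik_gr
    (borel_plus_in c al alv) (borel_proj h)
    (borel_minus_in c al alv) (borel_proj (dual_frep h)).

End RestrictedCherednikBGG.

(* Main.v *)
From HB Require Import structures.
From mathcomp Require Import freeg.
From mathcomp Require Import all_boot all_order all_fingroup all_algebra generic_quotient.
From mathcomp Require Import boolp reals complex.
From mathcomp Require Import ring.
Require Import Defs.

(** Write V for the space providing the variables X, U for its dual providing *)
(** the Y.  Three facts carry the proof.                                      *)
(**                                                                           *)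
(** Graded characters determine classes (K0_eq_gchar).  Two finite-           *)
(** dimensional graded modules M and N with the same graded character of W    *)
(** have isomorphic top components, and the Y kill these.  The graph of a     *)
(** nonzero W-map between them generates a submodule P of M + N whose top     *)
(** component is the graph itself, because the X lower the degree             *)
(** (xspan_stable).  The kernels and cokernels of P -> M and P -> N express   *)
(** [M] - [N] through modules with smaller top components, and induction      *)
(** applies (top_step).                                                       *)
(**                                                                           *)
(** Standard modules are as large as possible.  The relations show that       *)
(** the induced module is spanned by the products of coinvariants of V with   *)
(** la.  These are independent because A acts on coinv(V) (x) la, U by Dunkl  *)
(** operators and V by multiplication (std_free).  This representation needs  *)
(** that divided differences kill invariants (D_inv), so that they act on     *)
(** coinvariants, and that an invariant polynomial in Dunkl operators is the  *)
(** scalar given by its constant term (vY_invariant).  The opposite algebra   *)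
(** has a presentation of the same kind, with h and h^* exchanged             *)
(** (triangular_op), so this covers costandard modules too, up to a duality.  *)
(**                                                                           *)
(** Both modules have the same graded character.  Write h' and la' for the    *)
(** duals of h and la.  The standard module is coinv(h') (x) la, the          *)
(** costandard one is the dual of coinv(h) (x) la', with coinvariants of      *)
(** degree d placed in degree -d relative to la in both.  An invariant        *)
(** hermitian form is a conjugate-linear equivariant bijection of h with h'   *)
(** (herm_dual), so the characters of coinv(h) and coinv(h') are conjugate in *)
(** each degree (coinv_dual_basis), while the dual of coinv(h) has the        *)
(** character w |-> tr(w^-1), which is the conjugate of tr(w) as well         *)
(** (block_trace_inv).                                                        *)

Set Implicit Arguments.
Unset Strict Implicit.
Unset Printing Implicit Defensive.

Import Order.TTheory GRing.Theory Num.Theory.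
Local Open Scope ring_scope.
Local Open Scope quotient_scope.

(** * Linear algebra over the scalars of an algebra *)

Section Additive.
Variables (V V' : zmodType) (f : V -> V').
Hypothesis fB : forall x y, f (x - y) = f x - f y.
Lemma morphB0 : f 0 = 0. Proof. by have := fB 0 0; rewrite !subrr. Qed.
Lemma morphBD x y : f (x + y) = f x + f y.
Proof. by rewrite -{1}[y]opprK fB -[- y]sub0r fB morphB0 sub0r opprK. Qed.
End Additive.

(** Modules over an F-algebra are vector spaces through al_scal only, hence a *)
(** linear algebra of families indexed by a finite type.                      *)

Notation "k *! m" := (al_scal k *: m) (at level 40).

Section Combinations.
Variables (F : fieldType) (A : algebra F) (M : lmodType A).
Implicit Types (k l : F) (m : M).

Lemma fscA k l m : k *! (l *! m) = (k * l) *! m.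
Proof. by rewrite scalerA -rmorphM. Qed.
Lemma fsc0 k : k *! (0 : M) = 0. Proof. exact: scaler0. Qed.
Lemma fsc0r m : (0 : F) *! m = 0. Proof. by rewrite rmorph0 scale0r. Qed.
Lemma fsc1 m : (1 : F) *! m = m. Proof. by rewrite rmorph1 scale1r. Qed.
Lemma fscDl k l m : (k + l) *! m = k *! m + l *! m.
Proof. by rewrite rmorphD scalerDl. Qed.
Lemma fscBl k l m : (k - l) *! m = k *! m - l *! m.
Proof. by rewrite rmorphB scalerBl. Qed.
Lemma fscDr k m (n : M) : k *! (m + n) = k *! m + k *! n.
Proof. exact: scalerDr. Qed.
Lemma fscBr k m (n : M) : k *! (m - n) = k *! m - k *! n.
Proof. exact: scalerBr. Qed.
Lemma fsc_sum (I : Type) (r : seq I) (P : pred I) k (E : I -> M) :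
  k *! (\sum_(i <- r | P i) E i) = \sum_(i <- r | P i) k *! E i.
Proof. exact: scaler_sumr. Qed.
Lemma fsc_suml (I : Type) (r : seq I) (P : pred I) m (E : I -> F) :
  (\sum_(i <- r | P i) E i) *! m = \sum_(i <- r | P i) E i *! m.
Proof. by rewrite rmorph_sum scaler_suml. Qed.
Lemma fscC k (a : A) m : k *! (a *: m) = a *: (k *! m).
Proof. by rewrite !scalerA al_central. Qed.
Lemma fsc_eq0 k m : k != 0 -> k *! m = 0 -> m = 0.
Proof. by move=> k0 km; rewrite -(fsc1 m) -(mulVf k0) -fscA km fsc0. Qed.
Lemma fsc_natr p m : (p%:R : F) *! m = m *+ p.
Proof. by rewrite rmorph_nat scaler_nat. Qed.

Definition comb (I : finType) (e : I -> M) (c : I -> F) : M :=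
  \sum_i c i *! e i.
Definition spans (I : finType) (e : I -> M) := forall m, exists c, m = comb e c.
Definition free (I : finType) (e : I -> M) :=
  forall c, comb e c = 0 -> forall i, c i = 0.
Definition is_basis (I : finType) (e : I -> M) := spans e /\ free e.

Section Family.
Variables (I : finType) (e : I -> M).
Lemma combB c c' : comb e (fun i => c i - c' i) = comb e c - comb e c'.
Proof. by rewrite /comb -sumrB; apply: eq_bigr => i _; rewrite fscBl. Qed.
Lemma combD c c' : comb e (fun i => c i + c' i) = comb e c + comb e c'.
Proof. by rewrite /comb -big_split; apply: eq_bigr => i _; rewrite fscDl. Qed.
Lemma combZ k c : comb e (fun i => k * c i) = k *! comb e c.
Proof. by rewrite /comb fsc_sum; apply: eq_bigr => i _; rewrite fscA. Qed.
Lemma comb0 : comb e (fun=> 0) = 0.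
Proof. by rewrite /comb big1 // => i _; rewrite fsc0r. Qed.
Lemma comb_delta i : comb e (fun j => (j == i)%:R) = e i.
Proof.
rewrite /comb (bigD1 i) //= eqxx fsc1 big1 ?addr0 // => j /negPf ->.
by rewrite fsc0r.
Qed.
Lemma comb_sum (J : finType) (E : J -> I -> F) :
  comb e (fun i => \sum_j E j i) = \sum_j comb e (E j).
Proof.
rewrite /comb exchange_big; apply: eq_bigr => i _.
by rewrite fsc_suml.
Qed.
Lemma eq_comb c c' : c =1 c' -> comb e c = comb e c'.
Proof. by move=> cc'; apply: eq_bigr => i _; rewrite cc'. Qed.

Definition coord (m : M) : I -> F :=
  if pselect (exists c, m = comb e c) is left h then projT1 (cid h) else fun=> 0.
Lemma coordK m : spans e -> comb e (coord m) = m.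
Proof.
move=> se; rewrite /coord; case: pselect => [h|[]]; last exact: se.
by case: cid => c /= ->.
Qed.
Hypothesis eb : is_basis e.
Lemma comb_inj c c' : comb e c = comb e c' -> c =1 c'.
Proof.
move=> cc' i; apply/eqP; rewrite -subr_eq0; apply/eqP.
by apply: (eb.2 (fun i => c i - c' i)); rewrite combB cc' subrr.
Qed.
Lemma combK c : coord (comb e c) =1 c.
Proof. by apply: comb_inj; rewrite coordK //; case: eb. Qed.
Lemma coord_basis i j : coord (e i) j = (j == i)%:R.
Proof. by rewrite -[e i]comb_delta combK. Qed.
Lemma coordB m n i : coord (m - n) i = coord m i - coord n i.
Proof.
case: eb => se _.
by rewrite -[in LHS](coordK m se) -[in LHS](coordK n se) -combB combK.
Qed.
Lemma coordD m n i : coord (m + n) i = coord m i + coord n i.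
Proof.
case: eb => se _.
by rewrite -[in LHS](coordK m se) -[in LHS](coordK n se) -combD combK.
Qed.
Lemma coordZ k m i : coord (k *! m) i = k * coord m i.
Proof. by case: eb => se _; rewrite -[in LHS](coordK m se) -combZ combK. Qed.
Lemma coord0 i : coord 0 i = 0.
Proof. by rewrite -comb0 combK. Qed.
Lemma coord_comb (J : finType) (f : J -> M) c i :
  coord (comb f c) i = \sum_j c j * coord (f j) i.
Proof.
rewrite /comb; elim/big_rec2: _ => [|j x y _ IH]; first exact: coord0.
by rewrite coordD IH coordZ.
Qed.
End Family.

Definition fdim := exists n (e : 'I_n -> M), spans e.

Lemma is_basis_ord (I : finType) (e : I -> M) :
  is_basis e -> is_basis (fun i : 'I_#|I| => e (enum_val i)).
Proof.
have cE c : comb (fun i : 'I_#|I| => e (enum_val i)) c = comb e (fun i => c (enum_rank i)).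
  rewrite /comb (reindex (@enum_rank I)) /=; last exact/onW_bij/enum_rank_bij.
  by apply: eq_bigr => i _; rewrite enum_rankK.
move=> [se fe]; split=> [m|c].
  have [c ->] := se m; exists (fun i => c (enum_val i)).
  by rewrite cE; apply: eq_comb => i; rewrite enum_rankK.
by rewrite cE => /fe h i; rewrite -(enum_valK i) h.
Qed.

Lemma spans_ord (I : finType) (e : I -> M) :
  spans e -> spans (fun i : 'I_#|I| => e (enum_val i)).
Proof.
move=> se m; have [c ->] := se m; exists (fun i => c (enum_val i)).
rewrite /comb [in RHS](reindex (@enum_rank I)) /=; last exact/onW_bij/enum_rank_bij.
by apply: eq_bigr => i _; rewrite enum_rankK.
Qed.

(** A redundant vector of a spanning family can be dropped, so a basis may be *)
(** chosen inside any finite spanning family.                                 *)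
Lemma spans_basis n (e : 'I_n -> M) :
  spans e -> exists p (f : 'I_p -> 'I_n), is_basis (e \o f).
Proof.
elim: n e => [|n IH] e se; first by exists 0%N, id; split=> // c _ [].
have [fe|] := pselect (free e); first by exists n.+1, id.
move=> /existsNP [c /not_implyP [c0 /existsNP [i /eqP ci]]].
have [] := IH (e \o lift i); last first.
  by move=> m [f fb]; exists m, (lift i \o f).
have ei : e i = comb (e \o lift i) (fun j => - (c i)^-1 * c (lift i j)).
  rewrite -[e i]fsc1 -(mulVf ci) -fscA combZ.
  move: c0; rewrite /comb (bigD1_ord i) //= => /eqP; rewrite addr_eq0 => /eqP ->.
  by rewrite rmorphN scaleNr scalerN.
move=> m; have [d ->] := se m; rewrite /comb (bigD1_ord i) //= ei -combZ.
by rewrite -[X in _ + X]/(comb (e \o lift i) (fun j => d (lift i j))) -combD; eexists.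
Qed.

Lemma fdim_basis : fdim -> exists n (e : 'I_n -> M), is_basis e.
Proof. by move=> [n [e /spans_basis [m [f fb]]]]; exists m, (e \o f). Qed.

Lemma free_leq n p (e : 'I_n -> M) (f : 'I_p -> M) : spans e -> free f -> (p <= n)%N.
Proof.
move=> se ff; pose B : 'M[F]_(p, n) := \matrix_(i, j) coord e (f i) j.
suff /eqP <- : row_free B by rewrite rank_leq_col.
rewrite -kermx_eq0; apply/eqP/row_matrixP => i; rewrite row0.
set v := row i _; have : v *m B = 0 by apply/sub_kermxP/row_sub.
move=> vB; apply/rowP => j; rewrite [RHS]mxE.
apply: (ff (fun j => v 0 j)); rewrite -(comb0 e) /comb.
under eq_bigr => k _ do rewrite -(coordK (f k) se) -combZ.
rewrite -comb_sum; apply: eq_comb => k.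
move/rowP/(_ k): vB; rewrite [LHS]mxE [RHS]mxE; apply: etrans.
by apply: eq_bigr => l _; rewrite [B _ _]mxE.
Qed.

(** A free family of maximal length in a subspace spans it: the length is     *)
(** bounded by the dimension of the whole space.                              *)
Lemma subspace_basis (S : M -> Prop) :
  fdim -> S 0 -> (forall m n, S m -> S n -> S (m - n)) ->
  (forall k m, S m -> S (k *! m)) ->
  exists n (e : 'I_n -> M), [/\ forall i, S (e i), free e
    & forall m, S m -> exists c, m = comb e c].
Proof.
move=> [N [b sb]] S0 SB SZ.
pose P n := `[< exists e : 'I_n -> M, (forall i, S (e i)) /\ free e >].
have P0 : P 0%N.
  apply/asboolP; exists (fun=> 0); split=> // c _ [] //.
have Pb n : P n -> (n <= N)%N by move=> /asboolP [e [_ fe]]; apply: free_leq sb fe.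
have exP : exists n, P n by exists 0%N.
have [n /asboolP [e [Se fe]] nmax] := ex_maxnP exP Pb.
exists n, e; split=> // m Sm; apply: contrapT => nm.
suff /nmax : P n.+1 by rewrite ltnn.
apply/asboolP; exists (fun i => oapp e m (unlift ord0 i)); split.
  by move=> i; case: unliftP => [j|] _ /=.
move=> c; rewrite /comb big_ord_recl unlift_none /=.
under eq_bigr => i _ do rewrite liftK /=.
move=> c0; have cm : c ord0 = 0.
  apply: contrapT => /eqP cn0; apply: nm.
  exists (fun i => - (c ord0)^-1 * c (lift ord0 i)).
  move/eqP: c0; rewrite addr_eq0 => /eqP c0.
  by rewrite combZ rmorphN scaleNr -scalerN -c0 fscA mulVf // fsc1.
move: c0; rewrite cm fsc0r add0r => /(fe (fun i => c (lift ord0 i))) ce i.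
by case: (unliftP ord0 i) => [j|] ->.
Qed.
End Combinations.

Arguments comb {F A M I}.
Arguments coord {F A M I}.

(** * Traces *)

Section FLinear.
Variables (F : fieldType) (A B : algebra F) (M : lmodType A) (N : lmodType B).
Definition flinear (f : M -> N) :=
  (forall m n, f (m - n) = f m - f n) /\ (forall k m, f (k *! m) = k *! f m).
Variable f : M -> N.
Hypothesis fl : flinear f.
Lemma flin0 : f 0 = 0. Proof. exact: morphB0 fl.1. Qed.
Lemma flinB m n : f (m - n) = f m - f n. Proof. exact: fl.1. Qed.
Lemma flinD m n : f (m + n) = f m + f n. Proof. exact: (morphBD fl.1). Qed.
Lemma flin_sum (I : Type) (r : seq I) (P : pred I) (E : I -> M) :
  f (\sum_(i <- r | P i) E i) = \sum_(i <- r | P i) f (E i).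
Proof. exact: (big_morph f flinD flin0). Qed.
Lemma flin_comb (I : finType) (e : I -> M) c : f (comb e c) = comb (f \o e) c.
Proof. by rewrite flin_sum; apply: eq_bigr => i _; rewrite fl.2. Qed.
End FLinear.

Section Trace.
Variables (F : fieldType) (A : algebra F) (M : lmodType A).

Definition trace_in (I : finType) (e : I -> M) (T : M -> M) : F :=
  \sum_i coord e (T (e i)) i.

(** Trace of X Y = trace of Y X, for the two change of basis matrices.        *)
Lemma trace_in_eq (I J : finType) (e : I -> M) (f : J -> M) (T : M -> M) :
  is_basis e -> is_basis f -> flinear T -> trace_in e T = trace_in f T.
Proof.
move=> eb fb Tl; rewrite /trace_in.
transitivity (\sum_i \sum_k \sum_l
    coord f (e i) k * (coord f (T (f k)) l * coord e (f l) i)).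
  apply: eq_bigr => i _.
  rewrite -[in LHS](coordK (e i) fb.1) (flin_comb Tl) coord_comb //.
  apply: eq_bigr => k _ /=; rewrite -[in LHS](coordK (T (f k)) fb.1) coord_comb //.
  by rewrite mulr_sumr.
rewrite exchange_big; apply: eq_bigr => k _; rewrite exchange_big /=.
transitivity (\sum_l coord f (T (f k)) l * coord f (f l) k).
  apply: eq_bigr => l _.
  rewrite -[in RHS](coordK (f l) eb.1) coord_comb // mulr_sumr.
  by apply: eq_bigr => i _; rewrite [LHS]mulrC -mulrA.
rewrite (bigD1 k) //= coord_basis // eqxx mulr1 big1 ?addr0 // => l /negPf lk.
by rewrite coord_basis // eq_sym lk mulr0.
Qed.

Definition ftrace (T : M -> M) : F :=
  if pselect (exists n (e : 'I_n -> M), is_basis e) is left h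
  then trace_in (projT1 (cid (projT2 (cid h)))) T else 0.

Lemma ftraceE (I : finType) (e : I -> M) (T : M -> M) :
  is_basis e -> flinear T -> ftrace T = trace_in e T.
Proof.
move=> eb Tl; rewrite /ftrace; case: pselect => [h|[]]; last first.
  by exists #|I|, (fun i => e (enum_val i)); apply: is_basis_ord.
by apply: trace_in_eq => //; exact: (projT2 (cid (projT2 (cid h)))).
Qed.
End Trace.

(** Traces add up along short exact sequences: in a basis made of one of the  *)
(** kernel and lifts of one of the cokernel, the matrix is block triangular.  *)
Lemma ftrace_exact (F : fieldType) (A A' A'' : algebra F)
    (M' : lmodType A') (M : lmodType A) (M'' : lmodType A'')
    (f : M' -> M) (g : M -> M'') (T' : M' -> M') (T : M -> M) (T'' : M'' -> M'') :
  fdim M' -> fdim M'' -> flinear f -> flinear g ->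
  injective f -> (forall m'', exists m, g m = m'') ->
  (forall m, g m = 0 <-> exists m', f m' = m) ->
  flinear T' -> flinear T -> flinear T'' ->
  (forall m', T (f m') = f (T' m')) -> (forall m, T'' (g m) = g (T m)) ->
  ftrace T = ftrace T' + ftrace T''.
Proof.
move=> /fdim_basis [p [e' eb']] /fdim_basis [q [e'' eb'']] fl gl finj gsurj ex.
move=> Tl' Tl Tl'' Tf gT.
have /choice [s gs] := gsurj.
pose e (i : 'I_p + 'I_q) := match i with inl i => f (e' i) | inr j => s (e'' j) end.
have combE c : comb e c = f (comb e' (fun i => c (inl i)))
                          + comb (s \o e'') (fun j => c (inr j)).
  by rewrite (flin_comb fl) /comb big_sumType.
have gf m' : g (f m') = 0 by apply/ex; exists m'.
have gcomb c : g (comb e c) = comb e'' (fun j => c (inr j)).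
  rewrite combE (flinD gl) gf add0r (flin_comb gl).
  by apply: eq_bigr => j _ /=; rewrite gs.
have eb : is_basis e.
  split=> [m|c c0].
    pose d := coord e'' (g m).
    have /ex [m' em'] : g (m - comb (s \o e'') d) = 0.
      rewrite gl.1 (flin_comb gl); apply/eqP; rewrite subr_eq0 -[g m](coordK _ eb''.1).
      by apply/eqP/eq_bigr => j _ /=; rewrite gs.
    exists (fun i => match i with inl i => coord e' m' i | inr j => d j end).
    by rewrite combE (coordK _ eb'.1) em' subrK.
  have c2 j : c (inr j) = 0.
    by apply: (eb''.2 (fun j => c (inr j))); rewrite -gcomb c0 flin0.
  have c1 : forall i, c (inl i) = 0.
    apply: (eb'.2 (fun i => c (inl i))); apply: finj; rewrite flin0 // -c0 combE.
    by rewrite [X in _ + X]big1 ?addr0 // => j _; rewrite c2 fsc0r.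
  by case.
rewrite (ftraceE eb' Tl') (ftraceE eb'' Tl'') (ftraceE eb Tl).
rewrite /trace_in big_sumType /=; congr (_ + _); apply: eq_bigr => i _.
  have -> : T (f (e' i)) = comb e (fun l => match l with
      inl l => coord e' (T' (e' i)) l | inr _ => 0 end).
    rewrite Tf combE (coordK _ eb'.1) [X in _ + X]big1 ?addr0 // => j _.
    by rewrite fsc0r.
  by rewrite combK.
by rewrite -[in RHS](gs (e'' i)) gT -[T _](coordK _ eb.1) gcomb !combK.
Qed.

(** * Graded modules *)

Lemma big_supp (V : zmodType) (s s' : seq int) (f : int -> V) :
  uniq s -> uniq s' -> {subset s <= s'} -> (forall i, i \notin s -> f i = 0) ->
  \sum_(i <- s') f i = \sum_(i <- s) f i.
Proof.
move=> us us' ss' f0; rewrite (bigID (mem s)) /= [X in _ + X]big1 ?addr0; last first.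
  by move=> i /f0.
rewrite -big_filter; apply: perm_big; apply: uniq_perm => //; first exact: filter_uniq.
by move=> i; rewrite mem_filter; case: (boolP (i \in s)) => // /ss' ->.
Qed.

Section Grading.
Variables (F : fieldType) (A : gralg F).
Hypothesis scal0 : forall k, @ga_deg F A 0 (al_scal k).

(** Additive projections on the components make the sum direct.               *)
Lemma is_graded_intro (M : grmod A) (p : int -> M -> M) :
  (forall i, gm_deg i (0 : M)
     /\ forall m n : M, gm_deg i m -> gm_deg i n -> gm_deg i (m - n)) ->
  (forall i j (a : A) (m : M), ga_deg i a -> gm_deg j m -> gm_deg (i + j) (a *: m)) ->
  (forall i m n, p i (m - n) = p i m - p i n) ->
  (forall i m, gm_deg i (p i m)) ->
  (forall i j m, gm_deg i m -> p j m = if j == i then m else 0) ->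
  (forall m, exists s, m = \sum_(i <- s) p i m) ->
  is_graded M.
Proof.
move=> d0 dM pB pd pE pS; split; [exact: d0|exact: dM|move=> m|move=> s f us fd fs i si].
  by have [s ms] := pS m; exists s, (fun i => p i m); split.
have p0 j := morphB0 (pB j); have pD j := morphBD (pB j).
have := p0 i; rewrite -fs (big_morph (p i) (pD i) (p0 i)) (bigD1_seq i) //=.
rewrite (pE i) // eqxx big1 ?addr0 // => j /negPf ji.
by rewrite (pE j) // eq_sym ji.
Qed.

Section Parts.
Variables (M : grmod A) (Mg : is_graded M).

Definition hdecomp (m : M) (f : int -> M) (s : seq int) :=
  [/\ uniq s, forall i, gm_deg i (f i), forall i, i \notin s -> f i = 0
    & m = \sum_(i <- s) f i].

Lemma gm_deg0 i : gm_deg i (0 : M). Proof. by case: Mg => d0 _ _ _; case: (d0 i). Qed.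
Lemma gm_degB i (m n : M) : gm_deg i m -> gm_deg i n -> gm_deg i (m - n).
Proof. by case: Mg => d0 _ _ _; case: (d0 i) => _; apply. Qed.
Lemma gm_degD i (m n : M) : gm_deg i m -> gm_deg i n -> gm_deg i (m + n).
Proof.
move=> mi ni; rewrite -[n]opprK -[- n]sub0r; apply: gm_degB => //.
by apply: gm_degB => //; apply: gm_deg0.
Qed.
Lemma gm_degM i j (a : A) (m : M) :
  ga_deg i a -> gm_deg j m -> gm_deg (i + j) (a *: m).
Proof. by case: Mg => _ h _ _; apply: h. Qed.
Lemma gm_degZ i k (m : M) : gm_deg i m -> gm_deg i (k *! m).
Proof. by move=> mi; rewrite -(add0r i); apply: gm_degM. Qed.
Lemma gm_deg_sum i (I : Type) (r : seq I) (P : pred I) (E : I -> M) :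
  (forall j, P j -> gm_deg i (E j)) -> gm_deg i (\sum_(j <- r | P j) E j).
Proof.
by move=> PE; elim/big_ind: _ => // [|m n]; [apply: gm_deg0 | apply: gm_degD].
Qed.

Lemma hdecomp_ex m : exists f, exists s, hdecomp m f s.
Proof.
case: Mg => _ _ /(_ m) [s [f [fd ->]]] _.
exists (fun i => f i *+ count_mem i s), (undup s); split=> [|i|i|].
- exact: undup_uniq.
- by rewrite -fsc_natr; apply: gm_degZ.
- by rewrite mem_undup => /count_memPn ->.
- by rewrite -big_undup_iterop_count.
Qed.

Lemma hdecomp_uniq m f s f' s' : hdecomp m f s -> hdecomp m f' s' -> f =1 f'.
Proof.
move=> [us fd f0 ms] [us' fd' f0' ms'] i.
pose t := undup (s ++ s').
have ut : uniq t by apply: undup_uniq.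
have st : {subset s <= t} by move=> j; rewrite mem_undup mem_cat => ->.
have st' : {subset s' <= t} by move=> j; rewrite mem_undup mem_cat orbC => ->.
have [it|it] := boolP (i \in t); last first.
  by rewrite f0 ?f0' //; apply: contra it; [apply: st' | apply: st].
case: Mg => _ _ _ /(_ t (fun i => f i - f' i) ut) dir.
apply/eqP; rewrite -subr_eq0; apply/eqP; apply: dir => //.
  by move=> j; apply: gm_degB.
by rewrite sumrB (big_supp us ut) // (big_supp us' ut) // -ms -ms' subrr.
Qed.

Definition hpart (i : int) (m : M) : M :=
  if pselect (exists f, exists s, hdecomp m f s) is left h
  then projT1 (cid h) i else 0.

Lemma hpartE m f s : hdecomp m f s -> forall i, hpart i m = f i.
Proof.
move=> mfs i; rewrite /hpart; case: pselect => [h|[]]; last by exists f, s.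
by case: cid => f' /= [s' mfs']; apply: (hdecomp_uniq mfs' mfs).
Qed.
Lemma hpart_decomp m : exists s, hdecomp m (hpart^~ m) s.
Proof.
have [f [s mfs]] := hdecomp_ex m; exists s.
have e := hpartE mfs; case: mfs => us fd f0 ms; split=> // [i|i|].
- by rewrite e.
- by move=> /f0; rewrite e.
- by rewrite {1}ms; apply: eq_bigr => i _; rewrite e.
Qed.
Lemma hpart_deg i m : gm_deg i (hpart i m).
Proof. by have [s [_ d _ _]] := hpart_decomp m. Qed.
Lemma hpart_sum m : exists s, m = \sum_(i <- s) hpart i m.
Proof. by have [s [_ _ _ e]] := hpart_decomp m; exists s. Qed.

Lemma hpart_hom i j m : gm_deg i m -> hpart j m = if j == i then m else 0.
Proof.
move=> mi; apply: (@hpartE m (fun j => if j == i then m else 0) [:: i]); split=> //.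
- by move=> k; case: eqP => [->|_] //; apply: gm_deg0.
- by move=> k; rewrite inE => /negPf ->.
- by rewrite big_seq1 eqxx.
Qed.
Lemma hpart_id i m : gm_deg i m -> hpart i m = m.
Proof. by move=> /hpart_hom ->; rewrite eqxx. Qed.

Lemma hpartB i m n : hpart i (m - n) = hpart i m - hpart i n.
Proof.
have [s [us fd f0 ms]] := hpart_decomp m.
have [s' [us' fd' f0' ms']] := hpart_decomp n.
pose t := undup (s ++ s').
have ut : uniq t by apply: undup_uniq.
have st : {subset s <= t} by move=> j; rewrite mem_undup mem_cat => ->.
have st' : {subset s' <= t} by move=> j; rewrite mem_undup mem_cat orbC => ->.
apply: (@hpartE _ (fun i => hpart i m - hpart i n) t); split=> // [j|j jt|].
- exact: gm_degB.
- rewrite f0 ?f0' ?subr0 //; apply: contra jt; [exact: st' | exact: st].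
- by rewrite sumrB (big_supp us ut) // (big_supp us' ut) // -ms -ms'.
Qed.
Lemma hpart0 i : hpart i 0 = 0. Proof. exact: morphB0 (hpartB i). Qed.
Lemma hpartD i m n : hpart i (m + n) = hpart i m + hpart i n.
Proof. exact: (morphBD (hpartB i)). Qed.
Lemma hpart_eq0 m : (forall i, hpart i m = 0) -> m = 0.
Proof. by move=> h; have [s ->] := hpart_sum m; rewrite big1. Qed.
End Parts.

Lemma hpart_map (M N : grmod A) (Mg : is_graded M) (Ng : is_graded N) (h : M -> N) j :
  (forall m n, h (m + n) = h m + h n) -> h 0 = 0 ->
  (forall i m, gm_deg i m -> gm_deg (j + i) (h m)) ->
  forall i m, hpart (j + i) (h m) = h (hpart i m).
Proof.
move=> hD h0 hd i m; have [s [us fd f0 e]] := hpart_decomp Mg m.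
rewrite {1}e (big_morph h hD h0).
rewrite (big_morph (hpart (j + i)) (hpartD Ng (j + i)) (hpart0 Ng _)).
have [si|si] := boolP (i \in s); last first.
  rewrite f0 // h0 big_seq big1 // => k ks.
  rewrite (hpart_hom Ng _ (hd k _ (fd k))) (inj_eq (addrI j)).
  by case: eqP => // ik; rewrite -ik f0.
rewrite (bigD1_seq i) //= (hpart_hom Ng _ (hd i _ (fd i))) eqxx.
rewrite big1 ?addr0 // => k /negPf ki.
by rewrite (hpart_hom Ng _ (hd k _ (fd k))) (inj_eq (addrI j)) eq_sym ki.
Qed.

Section PartsMod.
Variables (M : grmod A) (Mg : is_graded M).
Lemma hpartM i j (a : A) (m : M) : ga_deg j a -> hpart (j + i) (a *: m) = a *: hpart i m.
Proof.
move=> ja; apply: (hpart_map Mg Mg (h := fun m => a *: m)) => [u v||k u].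
- exact: scalerDr.
- exact: scaler0.
- exact: gm_degM.
Qed.
Lemma hpartM0 i (a : A) (m : M) : ga_deg 0 a -> hpart i (a *: m) = a *: hpart i m.
Proof. by move=> /hpartM h; rewrite -[in LHS](add0r i) h. Qed.
Lemma hpart_flin i : flinear (@hpart M i).
Proof. by split=> [m n|k m]; [apply: hpartB | apply: hpartM0]. Qed.
Lemma scale_flin (a : A) : flinear (fun m : M => a *: m).
Proof. by split=> [m n|k m]; [apply: scalerBr | rewrite fscC]. Qed.
End PartsMod.

Lemma hpart_degree0 (M N : grmod A) (Mg : is_graded M) (Ng : is_graded N)
    (f : {linear M -> N}) i m : degree0 f -> hpart i (f m) = f (hpart i m).
Proof.
move=> fd; rewrite -[in LHS](add0r i); apply: (hpart_map Mg Ng) => [u v||k u].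
- exact: raddfD.
- exact: raddf0.
- by rewrite add0r; apply: fd.
Qed.

(** * Submodules, quotients and direct sums of graded modules *)

Section Submodule.
Variables (M : grmod A) (S : M -> Prop).
Hypotheses (S0 : S 0) (SB : forall m n, S m -> S n -> S (m - n)).
Hypotheses (SZ : forall (a : A) m, S m -> S (a *: m)).
Definition sub_pred : {pred M} := fun m => `[< S m >].
Lemma sub_closed : submod_closed sub_pred.
Proof.
split=> [|a m n /asboolP mS /asboolP nS]; first exact/asboolP.
apply/asboolP; rewrite -[n]opprK -[- n]sub0r; apply: SB; first exact: SZ.
exact: SB.
Qed.
HB.instance Definition _ := GRing.isSubmodClosed.Build A M sub_pred sub_closed.
Definition subm_sp := {m : M | sub_pred m}.
HB.instance Definition _ := [isSub of subm_sp for @sval _ _].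
HB.instance Definition _ := [Choice of subm_sp by <:].
HB.instance Definition _ := [SubChoice_isSubLmodule of subm_sp by <:].
Definition subm : grmod A := @GrMod F A subm_sp (fun i m => gm_deg i (sval m)).
Definition subm_in : {linear subm -> M} := \val.
Lemma subm_in_inj : injective subm_in. Proof. exact: val_inj. Qed.
Lemma subm_inP (m : subm) : S (subm_in m). Proof. exact/asboolP/(valP m). Qed.
Lemma subm_exP m : S m <-> exists m' : subm, subm_in m' = m.
Proof.
split=> [mS|[m' <-]]; last exact: subm_inP.
by exists (Sub m (asboolT mS)).
Qed.

Definition subm_lift (X : grmod A) (f : {linear X -> M}) (fS : forall x, S (f x))
  (x : X) : subm := Sub (f x) (asboolT (fS x)).
Lemma subm_lift_linear X f fS : linear (@subm_lift X f fS).
Proof. by move=> a x y; apply: val_inj; rewrite /= linearP. Qed.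

Hypothesis Mg : is_graded M.
Hypothesis SH : forall i m, S m -> S (hpart i m).
Lemma subm_graded : is_graded subm.
Proof.
pose p i (m : subm) : subm := Sub (hpart i (subm_in m)) (asboolT (SH i (subm_inP m))).
apply: (@is_graded_intro _ p).
- move=> i; split=> [|m n mi ni].
    by rewrite -[gm_deg _ _]/(gm_deg i (subm_in 0)) raddf0; apply: gm_deg0.
  by rewrite -[gm_deg _ _]/(gm_deg i (subm_in (m - n))) raddfB; apply: gm_degB.
- move=> i j a m ai mj; rewrite -[gm_deg _ _]/(gm_deg (i + j) (subm_in (a *: m))).
  by rewrite linearZ; apply: (gm_degM Mg ai mj).
- by move=> i m n; apply: val_inj; rewrite /= hpartB.
- by move=> i m; apply: hpart_deg.
- move=> i j m mi; apply: val_inj; rewrite /= (hpart_hom Mg _ mi).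
  by case: (j == i).
- move=> m; have [s e] := hpart_sum Mg (subm_in m); exists s; apply: val_inj.
  by rewrite raddf_sum.
Qed.

Lemma subm_fdim : fdim M -> fdim subm.
Proof.
move=> fM; have [|n [e [eS fe se]]] := subspace_basis fM S0 SB.
  by move=> k m; apply: SZ.
exists n, (fun i => Sub (e i) (asboolT (eS i)) : subm) => m.
have [c mc] := se _ (subm_inP m); exists c; apply: val_inj.
rewrite [LHS]mc /comb raddf_sum; apply: eq_bigr => i _.
by rewrite -[RHS]/(subm_in _) linearZ.
Qed.
End Submodule.

Section Quotient.
Variables (M : grmod A) (S : M -> Prop).
Hypotheses (S0 : S 0) (SB : forall m n, S m -> S n -> S (m - n)).
Hypotheses (SZ : forall (a : A) m, S m -> S (a *: m)).
Definition quo_pred : {pred M} := fun m => `[< S m >].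
Lemma quo_closed : zmod_closed quo_pred.
Proof.
split=> [|m n /asboolP mS /asboolP nS]; first exact/asboolP.
exact/asboolP/SB.
Qed.
HB.instance Definition _ := GRing.isZmodClosed.Build M quo_pred quo_closed.
Definition quom_sp := {ideal_quot quo_pred}.
HB.instance Definition _ := GRing.Zmodule.on quom_sp.
HB.instance Definition _ := Quotient.on quom_sp.
Definition quom_pi (m : M) : quom_sp := \pi_quom_sp m.
Lemma quom_piP m n : (quom_pi m = quom_pi n) <-> S (m - n).
Proof.
split=> [e|h].
- by apply/asboolP; move/eqP: e; rewrite -Quotient.idealrBE.
- by apply/eqP; rewrite -Quotient.idealrBE; apply/asboolP.
Qed.
Lemma quom_pi_surj (q : quom_sp) : exists m, quom_pi m = q.
Proof. by exists (repr q); rewrite /quom_pi reprK. Qed.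
Lemma quom_piB : {morph quom_pi : x y / x - y}.
Proof. exact: (raddfB (\pi_{ideal_quot quo_pred})). Qed.
Lemma quom_piD : {morph quom_pi : x y / x + y}.
Proof. exact: (raddfD (\pi_{ideal_quot quo_pred})). Qed.
Lemma quom_repr m : S (repr (quom_pi m) - m).
Proof. by apply/quom_piP; rewrite /quom_pi reprK. Qed.
Definition quom_scale (a : A) (q : quom_sp) : quom_sp := quom_pi (a *: repr q).
Lemma quom_scaleE a m : quom_scale a (quom_pi m) = quom_pi (a *: m).
Proof. by apply/quom_piP; rewrite -scalerBr; apply/SZ/quom_repr. Qed.
Lemma quom_scaleA a b v : quom_scale a (quom_scale b v) = quom_scale (a * b) v.
Proof. by have [m <-] := quom_pi_surj v; rewrite !quom_scaleE scalerA. Qed.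
Lemma quom_scale1 : left_id 1 quom_scale.
Proof. by move=> v; have [m <-] := quom_pi_surj v; rewrite quom_scaleE scale1r. Qed.
Lemma quom_scaleDr : right_distributive quom_scale +%R.
Proof.
move=> a u v; have [m <-] := quom_pi_surj u; have [n <-] := quom_pi_surj v.
by rewrite -quom_piD !quom_scaleE scalerDr quom_piD.
Qed.
Lemma quom_scaleDl v : {morph quom_scale^~ v : a b / a + b}.
Proof.
by move=> a b; have [m <-] := quom_pi_surj v; rewrite !quom_scaleE scalerDl quom_piD.
Qed.
HB.instance Definition _ := GRing.Zmodule_isLmodule.Build A quom_sp
  quom_scaleA quom_scale1 quom_scaleDr quom_scaleDl.
Definition quom : grmod A :=
  @GrMod F A quom_sp (fun i q => exists m, gm_deg i m /\ quom_pi m = q).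
Lemma quom_pi_linear : linear (quom_pi : M -> quom).
Proof. by move=> a m n; rewrite quom_piD -quom_scaleE. Qed.
HB.instance Definition _ := GRing.isLinear.Build A M quom *:%R quom_pi quom_pi_linear.
Definition quom_proj : {linear M -> quom} := quom_pi.
Lemma quom_proj_eq0 m : quom_proj m = 0 <-> S m.
Proof. by rewrite -(linear0 quom_proj) -[in X in _ <-> X](subr0 m); apply: quom_piP. Qed.

Hypothesis Mg : is_graded M.
Hypothesis SH : forall i m, S m -> S (hpart i m).
Lemma quom_graded : is_graded quom.
Proof.
pose p i (q : quom) : quom := quom_pi (hpart i (repr q)).
have pE i m : p i (quom_pi m) = quom_pi (hpart i m).
  by apply/quom_piP; rewrite -hpartB //; apply/SH/quom_repr.
apply: (@is_graded_intro _ p).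
- move=> i; split=> [|_ _ [m [mi <-]] [n [ni <-]]].
    by exists 0; split; [apply: gm_deg0 | apply: (linear0 quom_proj)].
  by exists (m - n); split; [apply: gm_degB | apply: quom_piB].
- move=> i j a _ ai [m [mj <-]]; exists (a *: m); split; first exact: gm_degM.
  by rewrite -quom_scaleE.
- move=> i u v; have [m <-] := quom_pi_surj u; have [n <-] := quom_pi_surj v.
  by rewrite -[quom_pi m - _]quom_piB !pE hpartB // quom_piB.
- by move=> i m; exists (hpart i (repr m)); split=> //; apply: hpart_deg.
- move=> i j _ [m [mi <-]]; rewrite pE (hpart_hom Mg _ mi).
  by case: (j == i) => //; apply: (linear0 quom_proj).
- move=> q; have [m <-] := quom_pi_surj q.
  have [s e] := hpart_sum Mg m; exists s.
  rewrite [in LHS]e (raddf_sum quom_proj); apply: eq_bigr => i _.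
  by rewrite pE.
Qed.

Lemma quom_fdim : fdim M -> fdim quom.
Proof.
move=> [n [e se]]; exists n, (quom_proj \o e) => q.
have [m <-] := quom_pi_surj q; have [c ->] := se m; exists c.
by rewrite -[quom_pi _]/(quom_proj _) /comb raddf_sum; apply: eq_bigr => i _; apply: (linearZ_LR quom_proj).
Qed.
End Quotient.

Section DirectSum.
Variables (M N : grmod A).
Definition dsum : grmod A :=
  @GrMod F A (M * N)%type (fun i p => gm_deg i p.1 /\ gm_deg i p.2).
Definition dsum_l (m : M) : dsum := (m, 0).
Definition dsum_fst (p : dsum) : M := p.1.
Definition dsum_snd (p : dsum) : N := p.2.
Lemma dsum_l_linear : linear dsum_l.
Proof. by move=> a m n; apply: injective_projections; rewrite //= scaler0 addr0. Qed.
Lemma dsum_fst_linear : linear dsum_fst. Proof. by []. Qed.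
Lemma dsum_snd_linear : linear dsum_snd. Proof. by []. Qed.
HB.instance Definition _ := GRing.isLinear.Build A M dsum *:%R dsum_l dsum_l_linear.
HB.instance Definition _ := GRing.isLinear.Build A dsum M *:%R dsum_fst dsum_fst_linear.
HB.instance Definition _ := GRing.isLinear.Build A dsum N *:%R dsum_snd dsum_snd_linear.

Hypotheses (Mg : is_graded M) (Ng : is_graded N).
Lemma dsum_graded : is_graded dsum.
Proof.
pose p i (q : dsum) : dsum := (hpart i q.1, hpart i q.2).
apply: (@is_graded_intro _ p).
- move=> i; split=> [|m n [m1 m2] [n1 n2]]; split; try exact: gm_deg0; exact: gm_degB.
- by move=> i j a m ai [m1 m2]; split; apply: gm_degM.
- by move=> i m n; rewrite /p !hpartB.
- by move=> i m; split; apply: hpart_deg.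
- move=> i j [m n] [/= mi ni]; rewrite /p (hpart_hom Mg _ mi) (hpart_hom Ng _ ni).
  by case: eqP.
- move=> [m n]; have [s [us _ f0 ms]] := hpart_decomp Mg m.
  have [s' [us' _ f0' ms']] := hpart_decomp Ng n.
  pose t := undup (s ++ s').
  have ut : uniq t by apply: undup_uniq.
  have st : {subset s <= t} by move=> j; rewrite mem_undup mem_cat => ->.
  have st' : {subset s' <= t} by move=> j; rewrite mem_undup mem_cat orbC => ->.
  exists t; apply: injective_projections.
    by rewrite -[RHS]/(dsum_fst _) raddf_sum /= (big_supp us ut).
  by rewrite -[RHS]/(dsum_snd _) raddf_sum /= (big_supp us' ut).
Qed.
Lemma dsum_fdim : fdim M -> fdim N -> fdim dsum.
Proof.
move=> [p [e se]] [q [f sf]].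
pose b (x : 'I_p + 'I_q) : dsum :=
  match x with inl i => (e i, 0) | inr j => (0, f j) end.
have sb : spans b.
  move=> [m n]; have [c ->] := se m; have [d ->] := sf n.
  exists (fun x => match x with inl i => c i | inr j => d j end).
  rewrite /comb big_sumType /=; apply: injective_projections.
    rewrite -[RHS]/(dsum_fst _) raddfD !raddf_sum /= [X in _ + X]big1 ?addr0 // => i _.
    exact: fsc0.
  rewrite -[RHS]/(dsum_snd _) raddfD !raddf_sum /= [X in _ = X + _]big1 ?add0r // => i _.
  exact: fsc0.
by exists #|{: 'I_p + 'I_q}|, (fun i => b (enum_val i)); apply: spans_ord.
Qed.

Lemma dsum_exact : short_exact M dsum N.
Proof.
exists dsum_l, dsum_snd; split.
- split=> [i m mi|i m []] //; split=> //=; exact: gm_deg0.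
- by move=> m n [].
- by move=> n; exists ((0, n) : dsum).
- by move=> [m n]; split=> [/= nz|[m' <-]] //; exists m; rewrite /dsum_l -nz.
Qed.
End DirectSum.
End Grading.

(** * Characters of finite groups *)

Section Unitary.
Variables (C : numClosedFieldType) (W : finGroupType).

Definition adjmx m n (B : 'M[C]_(m, n)) : 'M[C]_(n, m) := map_mx Num.conj B^T.
Lemma adjmxM m n p (A : 'M[C]_(m, n)) (B : 'M_(n, p)) :
  adjmx (A *m B) = adjmx B *m adjmx A.
Proof. by rewrite /adjmx trmx_mul map_mxM. Qed.
Lemma tr_adjmx n (B : 'M[C]_n) : \tr (adjmx B) = (\tr B)^*.
Proof. by rewrite /adjmx /mxtrace rmorph_sum; apply: eq_bigr => i _; rewrite !mxE. Qed.

Lemma adj_sq (n : nat) (v : 'rV[C]_n) : v *m adjmx v = 0 -> v = 0.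
Proof.
move/matrixP/(_ 0 0); rewrite !mxE => /eqP; rewrite psumr_eq0; last first.
  by move=> i _; rewrite !mxE mul_conjC_ge0.
move=> /allP h; apply/rowP => i; rewrite mxE; apply/eqP.
by rewrite -mul_conjC_eq0; have := h i (mem_index_enum i); rewrite !mxE.
Qed.

Variables (n : nat) (G : W -> 'M[C]_n).
Hypotheses (G1 : G 1%g = 1%:M) (GM : forall v w, G v *m G w = G (w * v)%g).

(** Weyl's unitary trick: averaging a positive definite hermitian form makes  *)
(** every matrix G w unitary for it, and the inverse of a unitary matrix is   *)
(** similar to its adjoint.  E is a self-adjoint endomorphism of the          *)
(** representation, such as the projection on an invariant block.             *)
Lemma trace_inv (E : 'M[C]_n) w :
  adjmx E = E -> (forall w, E *m G w = G w *m E) ->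
  \tr (E *m G w^-1%g) = (\tr (E *m G w))^*.
Proof.
move=> EE EG; pose H := \sum_w G w *m adjmx (G w).
have HG v : G v *m H *m adjmx (G v) = H.
  rewrite /H mulmx_sumr mulmx_suml [in RHS](reindex_inj (mulIg v)) /=.
  by apply: eq_bigr => u _; rewrite mulmxA -mulmxA -adjmxM GM.
have HE : E *m H = H *m E.
  rewrite /H mulmx_sumr mulmx_suml; apply: eq_bigr => v _.
  by rewrite mulmxA EG -!mulmxA -{1}EE -adjmxM -EG adjmxM EE.
have Hu : H \in unitmx.
  rewrite -row_free_unit -kermx_eq0; apply/eqP/row_matrixP => i; rewrite row0.
  set x := row i _; have xH : x *m H = 0 by apply/sub_kermxP/row_sub.
  have : \sum_v (x *m G v) *m adjmx (x *m G v) = 0.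
    transitivity (x *m H *m adjmx x); last by rewrite xH mul0mx.
    rewrite /H mulmx_sumr mulmx_suml; apply: eq_bigr => v _.
    by rewrite adjmxM !mulmxA.
  move/matrixP/(_ 0 0); rewrite summxE [RHS]mxE => /eqP; rewrite psumr_eq0.
    move/allP/(_ 1%g (mem_index_enum _)) => /eqP h; rewrite -[x]mulmx1 -G1.
    by apply: adj_sq; apply/matrixP => a b; rewrite !ord1 h mxE.
  by move=> v _; rewrite mxE sumr_ge0 // => j _; rewrite !mxE mul_conjC_ge0.
have -> : G w^-1%g = H *m adjmx (G w) *m invmx H.
  have e : adjmx (G w^-1%g) *m adjmx (G w) = 1%:M.
    by rewrite -adjmxM GM mulVg G1 /adjmx trmx1 map_mx1.
  have <- : G w^-1%g *m H = H *m adjmx (G w).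
    by rewrite -[in RHS](HG w^-1%g) -!mulmxA e mulmx1.
  by rewrite mulmxK.
by rewrite !mulmxA HE mxtrace_mulC !mulmxA mulVmx // mul1mx -{1}EE -adjmxM tr_adjmx EG.
Qed.

(** The case where the basis is graded, W acts by block matrices and D        *)
(** selects the basis vectors of one degree.                                  *)
Lemma block_trace_inv (D : pred 'I_n) :
  (forall w k l, D k != D l -> G w k l = 0) ->
  forall w, \sum_(k | D k) G w^-1%g k k = (\sum_(k | D k) G w k k)^*.
Proof.
move=> GD w; pose S := diag_mx (\row_k (D k)%:R : 'rV[C]_n).
have chiE v : \sum_(k | D k) G v k k = \tr (S *m G v).
  rewrite /mxtrace big_mkcond; apply: eq_bigr => k _.
  by rewrite mul_diag_mx !mxE; case: (D k); rewrite ?mul1r ?mul0r.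
rewrite !chiE; apply: trace_inv => [|v].
  by apply/matrixP => i j; rewrite !mxE rmorphMn /= rmorph_nat eq_sym; case: eqP => [->|].
apply/matrixP => i j; rewrite mul_diag_mx mul_mx_diag !mxE.
have [/eqP ->|/GD ->] := boolP (D i == D j); first exact: mulrC.
by rewrite mul0r mulr0.
Qed.
End Unitary.

Section Intertwiner.
Variables (C : numClosedFieldType) (W : finGroupType) (m n : nat).
Variables (G : W -> 'M[C]_m) (K : W -> 'M[C]_n).
Hypotheses (G1 : G 1%g = 1%:M) (GM : forall v w, G v *m G w = G (w * v)%g).
Hypotheses (KM : forall v w, K v *m K w = K (w * v)%g).
Variables (D : pred 'I_m) (E : pred 'I_n).
Hypotheses (GD : forall w k l, D k != D l -> G w k l = 0).
Hypotheses (KE : forall w k l, E k != E l -> K w k l = 0).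
Hypothesis GK : forall w, \sum_(k | D k) G w k k = \sum_(k | E k) K w k k.

(** If two representations G and K have the same character chi, some          *)
(** elementary matrix has a nonzero average over the group: otherwise         *)
(** \sum_w chi(w^-1) chi(w) = \sum_w |chi(w)|^2 would vanish, while chi(1) is *)
(** the dimension.                                                            *)
Lemma intertwiner_ex k0 : D k0 ->
  exists B : 'M[C]_(m, n), [/\ exists k l, B k l != 0,
    forall k l, B k l != 0 -> D k /\ E l
  & forall w, G w *m B = B *m K w].
Proof.
move=> Dk0; pose B i j := \sum_w G w^-1%g *m delta_mx i j *m K w.
have BE i j k l : B i j k l = \sum_w G w^-1%g k i * K w j l.
  rewrite summxE; apply: eq_bigr => w _; rewrite mxE (bigD1 j) //=.
  rewrite big1 ?addr0.
    rewrite mxE (bigD1 i) //= big1 ?addr0; first by rewrite mxE !eqxx mulr1.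
    by move=> p /negPf pi; rewrite mxE pi mulr0.
  move=> p /negPf pj; rewrite mxE big1 ?mul0r // => q _.
  by rewrite mxE pj andbF mulr0.
have BG i j w : G w *m B i j = B i j *m K w.
  rewrite /B mulmx_sumr mulmx_suml [in RHS](reindex_inj (mulgI w^-1%g)) /=.
  apply: eq_bigr => v _; rewrite !mulmxA GM -[in RHS]mulmxA KM.
  by rewrite invMg invgK mulKVg.
have [ij|] := pselect (exists i j, [/\ D i, E j & exists k l, B i j k l != 0]).
  have [i [j [Di Ej [k [l Bkl]]]]] := ij.
  exists (B i j); split=> //; first by exists k, l.
  move=> k' l'; rewrite BE => nz.
  have [/eqP Dk|Dk] := boolP (D k' == D i); last first.
    by move: nz; rewrite big1 ?eqxx // => w _; rewrite GD ?mul0r.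
  have [/eqP El|El] := boolP (E j == E l'); last first.
    by move: nz; rewrite big1 ?eqxx // => w _; rewrite KE ?mulr0.
  by rewrite Dk -El Di Ej.
move=> nex; exfalso.
(* The entry (i, j) of the average of an elementary matrix at (i, j) is one
   term of the scalar product of the two characters. *)
have B0 i j : D i -> E j -> B i j i j = 0.
  move=> Di Ej; apply/eqP/negPn/negP => nz; apply: nex.
  by exists i, j; split=> //; exists i, j.
pose chi w := \sum_(k | D k) G w k k.
have chiV w : chi w^-1%g = (chi w)^* by apply: block_trace_inv.
have : \sum_w chi w * (chi w)^* = 0.
  transitivity (\sum_(i | D i) \sum_(j | E j) B i j i j).
    under [RHS]eq_bigr => i _ do under eq_bigr => j _ do rewrite BE.
    under [RHS]eq_bigr => i _ do rewrite exchange_big /=.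
    rewrite exchange_big /=; apply: eq_bigr => w _.
    rewrite -chiV mulrC /chi mulr_suml; apply: eq_bigr => i _.
    by rewrite GK mulr_sumr.
  by rewrite big1 // => i Di; rewrite big1 // => j Ej; apply: B0.
move/eqP; rewrite psumr_eq0; last by move=> w _; apply: mul_conjC_ge0.
move=> /allP /(_ 1%g (mem_index_enum _)); rewrite mul_conjC_eq0.
rewrite /chi G1; under eq_bigr => k _ do rewrite mxE eqxx.
by rewrite sumr_const pnatr_eq0 => /eqP /card0_eq /(_ k0); rewrite !unfold_in /= Dk0.
Qed.
End Intertwiner.

(** * Generators and relations of Cherednik algebras *)

(** The relations of a Cherednik algebra, with the two reflection             *)
(** representations abstracted: V carries the variables X, U the variables Y, *)
(** and kap w u v is the coefficient of w in the commutator of Y u and X v.   *)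
(** They hold in the restricted Cherednik algebra (X from h^*, Y from h), in  *)
(** its opposite (with the two exchanged and w acting as w^-1), and for the   *)
(** Dunkl operators.                                                          *)
Record cherednik_gen (F : fieldType) (W : finGroupType) (V U : wrep F W)
    (kap : W -> U -> V -> F) (A : algebra F) (X : V -> A) (Y : U -> A) (g : W -> A)
    : Prop := CherednikGen {
  cg_Xlin : forall k u v, X (k *: u + v) = al_scal k * X u + X v;
  cg_Ylin : forall k u v, Y (k *: u + v) = al_scal k * Y u + Y v;
  cg_XX : forall u v, X u * X v = X v * X u;
  cg_YY : forall u v, Y u * Y v = Y v * Y u;
  cg_g1 : g 1%g = 1;
  cg_gM : forall w w', g (w * w')%g = g w * g w';
  cg_gX : forall w v, g w * X v = X (wr_act w v) * g w;
  cg_gY : forall w u, g w * Y u = Y (wr_act w u) * g w;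
  cg_YX : forall u v, Y u * X v = X v * Y u + \sum_w al_scal (kap w u v) * g w
}.

Definition generated (F : fieldType) (A : algebra F) (I J W : Type)
    (X : I -> A) (Y : J -> A) (g : W -> A) : Prop :=
  forall P : A -> Prop, (forall v, P (X v)) -> (forall u, P (Y u)) ->
  (forall w, P (g w)) -> (forall k, P (al_scal k)) ->
  (forall a b, P a -> P b -> P (a - b)) -> (forall a b, P a -> P b -> P (a * b)) ->
  forall a, P a.

Section XSpan.
Variables (F : fieldType) (W : finGroupType) (V U : wrep F W).
Variables (kap : W -> U -> V -> F) (A : algebra F).
Variables (X : V -> A) (Y : U -> A) (g : W -> A).
Hypotheses (rels : cherednik_gen kap X Y g) (gens : generated X Y g).
Variables (M : lmodType A) (S : M -> Prop).

Inductive xspan : M -> Prop :=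
| xs_base m of S m : xspan m
| xs_0 : xspan 0
| xs_B m n of xspan m & xspan n : xspan (m - n)
| xs_X v m of xspan m : xspan (X v *: m).

Hypotheses (SZ : forall k m, S m -> S (k *! m)).
Hypotheses (Sg : forall w m, S m -> S (g w *: m)).
Hypotheses (SY : forall u m, S m -> Y u *: m = 0).

Lemma xspanD m n : xspan m -> xspan n -> xspan (m + n).
Proof.
move=> hm hn; rewrite -[n]opprK -[- n]sub0r; apply: xs_B => //.
by apply: xs_B => //; apply: xs_0.
Qed.
Lemma xspanZ k m : xspan m -> xspan (k *! m).
Proof.
elim=> {m} [m /SZ h||m n _ hm _ hn|v m _ hm].
- exact: xs_base.
- by rewrite fsc0; apply: xs_0.
- by rewrite fscBr; apply: xs_B.
- by rewrite fscC; apply: xs_X.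
Qed.
Lemma xspang w m : xspan m -> xspan (g w *: m).
Proof.
elim=> {m} [m /Sg h||m n _ hm _ hn|v m _ hm].
- exact: xs_base.
- by rewrite scaler0; apply: xs_0.
- by rewrite scalerBr; apply: xs_B.
- by rewrite scalerA (cg_gX rels) -scalerA; apply: xs_X.
Qed.
Lemma xspanY u m : xspan m -> xspan (Y u *: m).
Proof.
elim=> {m} [m /SY h||m n _ hm _ hn|v m hm IH].
- by rewrite h; apply: xs_0.
- by rewrite scaler0; apply: xs_0.
- by rewrite scalerBr; apply: xs_B.
- rewrite scalerA (cg_YX rels) scalerDl -scalerA; apply: xspanD; first exact: xs_X.
  rewrite scaler_suml; elim/big_ind: _ => [||w _]; [exact: xs_0|exact: xspanD|].
  by rewrite -scalerA; apply/xspanZ/xspang.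
Qed.

(** Vectors killed by Y and stable under W generate the submodule spanned by  *)
(** their X-monomial multiples: this is the easy half A = A^- T A^+ of the    *)
(** triangular decomposition.                                                 *)
Lemma xspan_stable a m : xspan m -> xspan (a *: m).
Proof.
move: a m; apply: gens => [v m|u m|w m|k m|a b ha hb m hm|a b ha hb m hm].
- exact: xs_X.
- exact: xspanY.
- exact: xspang.
- exact: xspanZ.
- by rewrite scalerBl; apply: xs_B; [apply: ha | apply: hb].
- by rewrite -scalerA; apply/ha/hb.
Qed.
End XSpan.

(** * The Grothendieck group of graded modules *)

Section Objects.
Variables (F : fieldType) (A : gralg F).
Hypothesis scal0 : forall k, @ga_deg F A 0 (al_scal k).

Definition fd_graded (M : grmod A) := is_graded M /\ fdim M.

Lemma fd_in_G (M : grmod A) : fd_graded M -> in_G M.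
Proof.
move=> [Mg [n [e se]]]; split=> //; exists [seq e i | i : 'I_n] => m.
have [c ->] := se m.
exists (fun i => if insub i is Some j then al_scal (c j) else 0).
rewrite size_image card_ord /comb; apply: eq_bigr => i _.
rewrite insubT // => ltin; rewrite (nth_map i) ?size_enum_ord //.
have ei : nth i (enum 'I_n) i = i by apply: nth_ord_enum.
by rewrite ei; congr (al_scal (c _) *: _); apply: val_inj.
Qed.

Notation "x =K y" := (K0_eq x y) (at level 70).
Definition cls (M : grmod A) (h : fd_graded M) : K0_expr A := K0_class (fd_in_G h).

Lemma K0_in_G_irr (M : grmod A) (h h' : in_G M) : K0_class h =K K0_class h'.
Proof. by rewrite (Prop_irrelevance h h'); apply: K0_refl. Qed.

Lemma cls_exact M' M M'' (h' : fd_graded M') (h : fd_graded M) (h'' : fd_graded M'') :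
  short_exact M' M M'' -> cls h =K K0_add (cls h') (cls h'').
Proof. exact: K0_exact. Qed.

Lemma K0_addl (x y z : K0_expr A) : y =K z -> K0_add x y =K K0_add x z.
Proof. by move=> h; apply: K0_addC => //; apply: K0_refl. Qed.
Lemma K0_addr (x y z : K0_expr A) : y =K z -> K0_add y x =K K0_add z x.
Proof. by move=> h; apply: K0_addC => //; apply: K0_refl. Qed.
Lemma K0_addK (x y z : K0_expr A) : K0_add x y =K K0_add x z -> y =K z.
Proof.
have e u : K0_add (K0_opp x) (K0_add x u) =K u.
  apply: K0_trans (K0_addA _ _ _) _; apply: K0_trans (K0_addr _ (K0_addN _)) _.
  exact: K0_add0.
move=> h; apply: K0_trans (K0_sym (e y)) _.
by apply: K0_trans (K0_addl _ h) _; apply: e.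
Qed.
Lemma K0_addAC (x y z : K0_expr A) : K0_add (K0_add x y) z =K K0_add (K0_add x z) y.
Proof.
apply: K0_trans (K0_sym (K0_addA _ _ _)) _; apply: K0_trans (K0_addl _ (K0_comm _ _)) _.
exact: K0_addA.
Qed.

(** From m + k1 = p + c1, n + k2 = p + c2 and k2 + c1 = k1 + c2 one gets      *)
(** m = n.                                                                    *)
Lemma K0_compare (m n p k1 k2 c1 c2 : K0_expr A) :
  K0_add m k1 =K K0_add p c1 -> K0_add n k2 =K K0_add p c2 ->
  K0_add k2 c1 =K K0_add k1 c2 -> m =K n.
Proof.
move=> h1 h2 h3.
have e1 : K0_add (K0_add m k1) c2 =K K0_add (K0_add p c1) c2 by apply: K0_addr.
have e2 : K0_add (K0_add n k2) c1 =K K0_add (K0_add p c2) c1 by apply: K0_addr.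
apply: (@K0_addK (K0_add k1 c2)).
apply: K0_trans (K0_comm _ _) _; apply: K0_trans (K0_addA _ _ _) _.
apply: K0_trans e1 _; apply: K0_trans (K0_addAC _ _ _) _.
apply: K0_trans (K0_sym e2) _; apply: K0_trans (K0_sym (K0_addA _ _ _)) _.
by apply: K0_trans (K0_addl _ h3) _; apply: K0_comm.
Qed.

Lemma lin_flinear (M N : lmodType A) (f : {linear M -> N}) : flinear f.
Proof. by split=> [m n|k m]; [apply: raddfB | apply: linearZ_LR]. Qed.

Lemma cls_trivial (M N : grmod A) (h : fd_graded M) (h' : fd_graded N) :
  (forall m : M, m = 0) -> (forall n : N, n = 0) -> cls h =K cls h'.
Proof.
have E M' N' (h1 : fd_graded M') (h2 : fd_graded N') : (forall m : M', m = 0) ->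
    (forall n : N', n = 0) -> cls h2 =K K0_add (cls h1) (cls h2).
  move=> M0 N0; apply: cls_exact; exists (\0 : {linear M' -> N'}), (idfun : {linear N' -> N'}).
  split=> //; first by split=> // i m _; case: h2 => h2g _; apply: (gm_deg0 h2g).
  - by move=> m m' _; rewrite (M0 m) (M0 m').
  - by move=> n; exists n.
  - by move=> n; split=> // _; exists 0; rewrite (N0 n).
have Z M' (h1 : fd_graded M') : (forall m : M', m = 0) -> cls h1 =K K0_zero A.
  move=> M0; apply: (@K0_addK (cls h1)).
  apply: K0_trans (K0_sym (E _ _ h1 h1 M0 M0)) _.
  by apply: K0_trans (K0_sym (K0_add0 _)) _; apply: K0_comm.
by move=> M0 N0; apply: K0_trans (Z _ h M0) _; apply/K0_sym/Z.
Qed.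

Lemma dsum_fd M N : fd_graded M -> fd_graded N -> fd_graded (dsum M N).
Proof.
by move=> [Mg Mf] [Ng Nf]; split; [apply: dsum_graded | apply: dsum_fdim].
Qed.
Lemma cls_dsum M N (h : fd_graded M) (h' : fd_graded N) :
  cls (dsum_fd h h') =K K0_add (cls h) (cls h').
Proof. by apply: cls_exact; apply: dsum_exact; case: h'. Qed.

(** The kernel, image and cokernel of a morphism.                             *)
Lemma ker_coker (X Y : grmod A) (f : {linear X -> Y}) :
  fd_graded X -> fd_graded Y -> degree0 f ->
  exists (K I C : grmod A) (k : {linear K -> X}) (p : {linear X -> I})
         (j : {linear I -> Y}) (c : {linear Y -> C}),
  [/\ [/\ fd_graded K, fd_graded I & fd_graded C],
      [/\ degree0 k, degree0 p & forall i x, gm_deg i (j x) -> gm_deg i x],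
      [/\ injective k, injective j, forall x, j (p x) = f x &
          forall q i, gm_deg i q -> exists2 y, gm_deg i y & c y = q],
      (forall x, f x = 0 <-> exists x', k x' = x) /\
      (forall y, c y = 0 <-> exists x, f x = y)
    & short_exact K X I /\ short_exact I Y C].
Proof.
move=> [Xg Xf] [Yg Yf] fd.
have fB m n : f (m - n) = f m - f n by apply: raddfB.
have fZ (a : A) m : f (a *: m) = a *: f m by apply: linearZ_LR.
pose Sk x := f x = 0; pose Si y := exists x, f x = y.
have k0 : Sk 0 by apply: raddf0.
have kB m n : Sk m -> Sk n -> Sk (m - n) by rewrite /Sk fB => -> ->; rewrite subrr.
have kZ (a : A) m : Sk m -> Sk (a *: m) by rewrite /Sk fZ => ->; rewrite scaler0.
have kH i m : Sk m -> Sk (hpart i m).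
  by rewrite /Sk -(hpart_degree0 scal0 Xg Yg) // => ->; apply: hpart0.
have i0 : Si 0 by exists 0; apply: raddf0.
have iB m n : Si m -> Si n -> Si (m - n).
  by move=> [x <-] [y <-]; exists (x - y); apply: raddfB.
have iZ (a : A) m : Si m -> Si (a *: m).
  by move=> [x <-]; exists (a *: x); apply: linearZ_LR.
have iH i m : Si m -> Si (hpart i m).
  by move=> [x <-]; exists (hpart i x); rewrite (hpart_degree0 scal0 Xg Yg).
have fS x : Si (f x) by exists x.
pose I := subm i0 iB iZ.
pose p : X -> I := subm_lift i0 iB iZ fS.
pose pL := GRing.isLinear.Build A X I *:%R p (subm_lift_linear i0 iB iZ fS).
pose pl : {linear X -> I} := HB.pack p pL.
exists (subm k0 kB kZ), I, (quom i0 iB iZ), (subm_in k0 kB kZ), pl.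
exists (subm_in i0 iB iZ), (quom_proj i0 iB iZ).
have exk x : f x = 0 <-> exists x', subm_in k0 kB kZ x' = x by apply: subm_exP.
have exc y : quom_proj i0 iB iZ y = 0 <-> exists x, f x = y by apply: quom_proj_eq0.
have pd : degree0 pl by move=> i x; apply: fd.
have jp x : subm_in i0 iB iZ (pl x) = f x by [].
split=> //.
- split; split.
  + exact: subm_graded.
  + exact: subm_fdim.
  + exact: subm_graded.
  + exact: subm_fdim.
  + exact: quom_graded.
  + exact: quom_fdim.
- by split.
- split; [exact: subm_in_inj|exact: subm_in_inj|exact: jp|].
  by move=> _ i [y [yi <-]]; exists y.
- split.
  + exists (subm_in k0 kB kZ), pl.
    split; [by split|exact: subm_in_inj| |].
      move=> y; have [x xy] := subm_inP y; exists x.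
      exact: (@subm_in_inj _ _ _ _ i0 iB iZ).
    move=> x; rewrite -exk -jp; split=> [->|h]; first exact: raddf0.
    by apply: (@subm_in_inj _ _ _ _ i0 iB iZ); rewrite h raddf0.
  + exists (subm_in i0 iB iZ), (quom_proj i0 iB iZ); split.
    * by split=> // i y yi; exists y.
    * exact: subm_in_inj.
    * by move=> q; apply: quom_pi_surj.
    * by move=> y; rewrite exc; apply: subm_exP.
Qed.

(** * Graded characters *)

Variables (W : finGroupType) (g : W -> A).

(** The value at w of the character of W on the component of degree i.        *)
Definition gchar (M : grmod A) (i : int) (w : W) : F :=
  ftrace (fun m : M => hpart i (g w *: m)).

Lemma gchar_flin (M : grmod A) (Mg : is_graded M) i w :
  flinear (fun m : M => hpart i (g w *: m)).
Proof.
split=> [m n|k m]; first by rewrite scalerBr hpartB.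
by rewrite -fscC hpartM0.
Qed.

Lemma gchar_exact M' M M'' i w :
  fd_graded M' -> fd_graded M -> fd_graded M'' -> short_exact M' M M'' ->
  gchar M i w = gchar M' i w + gchar M'' i w.
Proof.
move=> [Mg' Mf'] [Mg Mf] [Mg'' Mf''] [f [h [[fd hd] finj hsurj ex]]].
apply: (ftrace_exact Mf' Mf'' (lin_flinear f) (lin_flinear h)) => //.
- exact: gchar_flin.
- exact: gchar_flin.
- exact: gchar_flin.
- by move=> m; rewrite -linearZ_LR (hpart_degree0 scal0 Mg' Mg).
- by move=> m; rewrite -linearZ_LR (hpart_degree0 scal0 Mg Mg'').
Qed.

Lemma hbasis_ex (M : grmod A) : fd_graded M ->
  exists n (e : 'I_n -> M) (d : 'I_n -> int),
  is_basis e /\ forall k, gm_deg (d k) (e k).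
Proof.
move=> [Mg [n [e se]]].
have /choice [s es] (k : 'I_n) := hpart_decomp scal0 Mg (e k).
pose t := undup (flatten [seq s k | k : 'I_n]).
have ut : uniq t by apply: undup_uniq.
have st k : {subset s k <= t}.
  move=> i ik; rewrite mem_undup; apply/flatten_mapP; exists k => //.
  by rewrite mem_enum.
pose b (x : 'I_n * 'I_(size t)) : M := hpart t`_x.2 (e x.1).
have sb : spans b.
  move=> m; have [c ->] := se m; exists (fun x => c x.1).
  rewrite /comb -(pair_bigA _ (fun k l => c k *! b (k, l))) /=.
  apply: eq_bigr => k _; rewrite -fsc_sum; congr (_ *: _).
  have [us _ f0 ek] := es k; rewrite {1}ek -(big_supp us ut (st k)) //.
  by rewrite (big_nth 0) big_mkord.
have [p [f fb]] := spans_basis (spans_ord sb).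
exists p, (fun k => b (enum_val (f k))), (fun k => t`_(enum_val (f k)).2).
by split=> [|k]; [apply: fb | apply: hpart_deg].
Qed.

Section HBasis.
Variables (M : grmod A) (Mg : is_graded M) (I : finType) (e : I -> M) (d : I -> int).
Hypotheses (eb : is_basis e) (ed : forall k, gm_deg (d k) (e k)).

Lemma hpart_comb i c : hpart i (comb e c) = comb e (fun k => if d k == i then c k else 0).
Proof.
rewrite (flin_comb (hpart_flin scal0 Mg i)); apply: eq_bigr => k _ /=.
rewrite (hpart_hom Mg i (ed k)) eq_sym; case: eqP => // _.
by rewrite fsc0 fsc0r.
Qed.
Lemma coord_hpart i m k : coord e (hpart i m) k = if d k == i then coord e m k else 0.
Proof. by rewrite -[in LHS](coordK m eb.1) hpart_comb combK. Qed.

Lemma gcharE i w : gchar M i w = \sum_(k | d k == i) coord e (g w *: e k) k.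
Proof.
rewrite /gchar (ftraceE eb (gchar_flin Mg i w)) /trace_in [RHS]big_mkcond.
by apply: eq_bigr => k _; rewrite coord_hpart.
Qed.
Lemma gm_deg_comb i m : gm_deg i m -> forall k, d k != i -> coord e m k = 0.
Proof.
by move=> /(hpart_id Mg) <- k /negPf ki; rewrite coord_hpart ki.
Qed.
End HBasis.

Lemma gchar_dim (M : grmod A) i : g 1%g = 1 -> fd_graded M ->
  exists r : nat, gchar M i 1%g = r%:R /\ (r = 0%N <-> forall m : M, gm_deg i m -> m = 0).
Proof.
move=> g1 Mh; have Mg := Mh.1; have [n [e [d [eb ed]]]] := hbasis_ex Mh.
exists #|[pred k | d k == i]|; split.
  rewrite (gcharE Mg eb ed) g1; under eq_bigr => k _ do rewrite scale1r coord_basis // eqxx.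
  by rewrite sumr_const.
split=> [/card0_eq h m mi|h].
  rewrite -(coordK m eb.1) -(comb0 e); apply: eq_comb => k.
  by apply: (gm_deg_comb Mg eb ed mi); have := h k; rewrite !inE => ->.
apply: eq_card0 => k; rewrite !inE; apply/negP => /eqP ki.
have ei : gm_deg i (e k) by rewrite -ki.
have /(congr1 (fun m => coord e m k)) := h _ ei.
by rewrite coord_basis // eqxx coord0 // => /eqP; rewrite oner_eq0.
Qed.

Definition supported (M : grmod A) (lo hi : int) :=
  forall i (m : M), ~~ (lo <= i < hi) -> gm_deg i m -> m = 0.

Lemma supported_ex (M : grmod A) : fd_graded M ->
  exists lo n, forall lo' (n' : nat), lo' <= lo -> (lo + n%:Z <= lo' + n'%:Z) ->
  supported M lo' (lo' + n'%:Z).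
Proof.
move=> Mh; have Mg := Mh.1; have [n [e [d [eb ed]]]] := hbasis_ex Mh.
pose N := (\sum_k `|d k|)%N.
exists (- N%:Z), (N + N).+1 => lo' n' hlo hhi i m ni mi.
rewrite -(coordK m eb.1) -(comb0 e); apply: eq_comb => k.
apply: (gm_deg_comb Mg eb ed mi); apply: contra ni => /eqP <-.
have dN : (`|d k| <= N)%N by rewrite /N (bigD1 k) //= leq_addr.
have : (`|d k|%N%:Z <= N%:Z) by [].
rewrite abszE ler_norml => /andP [h1 h2].
apply/andP; split; first exact: le_trans hlo h1.
apply: lt_le_trans hhi; rewrite -addn1 !PoszD !addrA addNr add0r.
by rewrite ltzD1.
Qed.
End Objects.

Section CharacterK0.
Variables (C : numClosedFieldType) (W : finGroupType) (V U : wrep C W).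
Variables (kap : W -> U -> V -> C) (A : gralg C).
Variables (X : V -> A) (Y : U -> A) (g : W -> A).
Hypotheses (rels : cherednik_gen kap X Y g) (gens : generated X Y g).
Hypotheses (X_deg : forall v, @ga_deg C A (-1) (X v)).
Hypotheses (Y_deg : forall u, @ga_deg C A 1 (Y u)).
Hypotheses (g_deg : forall w, @ga_deg C A 0 (g w)).
Hypotheses (scal_deg : forall k, @ga_deg C A 0 (al_scal k)).

Section TopDegree.
Variables (M N : grmod A) (Mh : fd_graded M) (Nh : fd_graded N).
Variable top : int.
Hypotheses (Mtop : forall m : M, gm_deg (1 + top) m -> m = 0).
Hypotheses (Ntop : forall n : N, gm_deg (1 + top) n -> n = 0).
Hypothesis MN : forall w, gchar g M top w = gchar g N top w.
Hypothesis Mne : exists2 m : M, gm_deg top m & m <> 0.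

(** A nonzero W-map between the top degree components, given by its graph.    *)
Lemma top_graph : exists S : dsum M N -> Prop,
  [/\ S 0, (forall p q, S p -> S q -> S (p - q)), (forall k p, S p -> S (k *! p)),
      (forall w p, S p -> S (g w *: p))
    & [/\ forall p, S p -> gm_deg top p, (forall p, S p -> p.1 = 0 -> p = 0),
      forall m, gm_deg top m -> exists n, S (m, n) & exists2 p, S p & p.2 <> 0]].
Proof.
have [Mg _] := Mh; have [Ng _] := Nh.
have [a [e [d [eb ed]]]] := hbasis_ex scal_deg Mh.
have [b [f [d' [fb fd]]]] := hbasis_ex scal_deg Nh.
pose G w : 'M[C]_a := \matrix_(k, l) coord e (g w *: e k) l.
pose K w : 'M[C]_b := \matrix_(k, l) coord f (g w *: f k) l.
have ge w k : g w *: e k = comb e (G w k).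
  by rewrite -[LHS](coordK _ eb.1); apply: eq_comb => l; rewrite mxE.
have gf w k : g w *: f k = comb f (K w k).
  by rewrite -[LHS](coordK _ fb.1); apply: eq_comb => l; rewrite mxE.
have gcomb (P : grmod A) c (q : 'I_c -> P) (J : W -> 'M_c) w x :
    (forall k, g w *: q k = comb q (J w k)) ->
    g w *: comb q x = comb q (fun l => \sum_k x k * J w k l).
  move=> h; rewrite (flin_comb (scale_flin P (g w))) comb_sum; apply: eq_bigr => k _ /=.
  by rewrite h -combZ.
have G1 : G 1%g = 1%:M.
  by apply/matrixP => k l; rewrite !mxE (cg_g1 rels) scale1r coord_basis // eq_sym.
have GM v w : G v *m G w = G (w * v)%g.
  apply/matrixP => k l; rewrite [RHS]mxE (cg_gM rels) -scalerA ge.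
  by rewrite (gcomb _ _ _ G) // combK // mxE.
have KM v w : K v *m K w = K (w * v)%g.
  apply/matrixP => k l; rewrite [RHS]mxE (cg_gM rels) -scalerA gf.
  by rewrite (gcomb _ _ _ K) // combK // mxE.
have GD w k l : (d k == top) != (d l == top) -> G w k l = 0.
  move=> kl; rewrite mxE; have: gm_deg (d k) (g w *: e k).
    by rewrite -(add0r (d k)); apply: gm_degM.
  by move=> /(gm_deg_comb scal_deg Mg eb ed); apply; apply: contra kl => /eqP ->.
have KE w k l : (d' k == top) != (d' l == top) -> K w k l = 0.
  move=> kl; rewrite mxE; have: gm_deg (d' k) (g w *: f k).
    by rewrite -(add0r (d' k)); apply: gm_degM.
  by move=> /(gm_deg_comb scal_deg Ng fb fd); apply; apply: contra kl => /eqP ->.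
have GK w : \sum_(k | d k == top) G w k k = \sum_(k | d' k == top) K w k k.
  have := MN w; rewrite (gcharE scal_deg g Mg eb ed) (gcharE scal_deg g Ng fb fd).
  under [X in _ -> X = _]eq_bigr => k _ do rewrite mxE.
  by under [X in _ -> _ = X]eq_bigr => k _ do rewrite mxE.
have [k0 k0top] : exists k0, d k0 == top.
  have [m mt m0] := Mne; apply: contrapT => nk; apply: m0.
  rewrite -(coordK m eb.1) -(comb0 e); apply: eq_comb => k.
  by apply: (gm_deg_comb scal_deg Mg eb ed mt); apply/negP => kt; apply: nk; exists k.
have [B [[k1 [l1 B1]] BD BG]] := intertwiner_ex G1 GM KM GD KE GK k0top.
pose im c : 'I_b -> C := fun l => \sum_k c k * B k l.
pose gr c : dsum M N := (comb e c, comb f (im c)).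
pose S p := exists c, (forall k, d k != top -> c k = 0) /\ p = gr c.
have grB c c' : gr (fun k => c k - c' k) = gr c - gr c'.
  rewrite /gr combB; congr pair; rewrite -combB; apply: eq_comb => l.
  by rewrite /im -sumrB; apply: eq_bigr => k _; rewrite mulrBl.
have grZ k c : gr (fun i => k * c i) = k *! gr c.
  rewrite /gr combZ; congr pair; rewrite -combZ; apply: eq_comb => l.
  by rewrite /im mulr_sumr; apply: eq_bigr => i _; rewrite mulrA.
have grg w c : g w *: gr c = gr (fun l => \sum_k c k * G w k l).
  rewrite -[LHS]/(g w *: comb e c, g w *: comb f (im c)).
  rewrite (gcomb _ _ _ G) // (gcomb _ _ _ K) //; congr pair; apply: eq_comb => l.
  have /matrixP := BG w => BGw.
  transitivity (\sum_i c i * \sum_k B i k * K w k l).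
    under [RHS]eq_bigr => i _ do rewrite mulr_sumr.
    rewrite [RHS]exchange_big; apply: eq_bigr => k _; rewrite mulr_suml.
    by apply: eq_bigr => i _; rewrite mulrA.
  rewrite /im; under [RHS]eq_bigr => k _ do rewrite mulr_suml.
  rewrite [RHS]exchange_big; apply: eq_bigr => i _.
  have := BGw i l; rewrite !mxE => <-; rewrite mulr_sumr.
  by apply: eq_bigr => k _; rewrite mulrA.
have top_comb c : (forall k, d k != top -> c k = 0) -> gm_deg top (comb e c).
  move=> ct; apply: gm_deg_sum => // k _.
  have [<-|/ct ->] := eqVneq (d k) top; first exact: gm_degZ.
  by rewrite fsc0r; apply: gm_deg0.
have top_im c : gm_deg top (comb f (im c)).
  apply: gm_deg_sum => // l _; have [<-|lt] := eqVneq (d' l) top; first exact: gm_degZ.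
  rewrite /im big1 ?fsc0r; first exact: gm_deg0.
  move=> k _; have [->|/BD [_ lt']] := eqVneq (B k l) 0; first by rewrite mulr0.
  by rewrite lt' in lt.
have gr0 : gr (fun=> 0) = 0.
  rewrite /gr comb0; congr pair; rewrite -(comb0 f); apply: eq_comb => l.
  by rewrite /im big1 // => k _; rewrite mul0r.
exists S; split.
- by exists (fun=> 0).
- move=> _ _ [c [ct ->]] [c' [ct' ->]]; exists (fun k => c k - c' k).
  by split=> // k kt; rewrite ct // ct' // subrr.
- move=> x _ [c [ct ->]]; exists (fun k => x * c k).
  by split=> // k kt; rewrite ct // mulr0.
- move=> w _ [c [ct ->]]; exists (fun l => \sum_k c k * G w k l).
  split=> // l lt; rewrite big1 // => k _.
  have [kt|/ct ->] := eqVneq (d k) top; last by rewrite mul0r.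
  by rewrite GD ?mulr0 // kt eqxx (negPf lt).
- split.
  + by move=> _ [c [ct ->]]; split; [apply: top_comb | apply: top_im].
  + move=> _ [c [ct ->]] /= c0.
    have -> : c = (fun=> 0) by apply: funext => k; apply: (eb.2 _ c0).
    exact: gr0.
  + move=> m mt; exists (comb f (im (coord e m))), (coord e m).
    by split; [apply: gm_deg_comb | rewrite /gr (coordK m eb.1)].
  + have k1t : d k1 == top by case: (BD _ _ B1).
    exists (gr (fun k => (k == k1)%:R)).
      exists (fun k => (k == k1)%:R); split=> // k kt.
      by case: eqP => // kk1; move: kt; rewrite kk1 k1t.
    move=> /= /(fb.2) /(_ l1); rewrite /im (bigD1 k1) //= eqxx mul1r big1 ?addr0.
      by move/eqP; rewrite (negPf B1).
    by move=> k /negPf ->; rewrite mul0r.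
Qed.

Hypothesis MN_all : forall i w, gchar g M i w = gchar g N i w.

(** Let P be the submodule of M + N generated by the graph of the previous    *)
(** lemma.  In the top degree it is no larger than the graph.  Comparing M    *)
(** and N with P through kernels and cokernels of the two projections         *)
(** replaces them by modules whose top component is strictly smaller.         *)
Lemma top_step : exists (R R' : grmod A) (Rh : fd_graded R) (R'h : fd_graded R'),
  [/\ forall i w, gchar g R i w = gchar g R' i w,
      forall i, (forall m : M, gm_deg i m -> m = 0) ->
        (forall n : N, gm_deg i n -> n = 0) ->
        (forall m : R, gm_deg i m -> m = 0) /\ (forall m : R', gm_deg i m -> m = 0),
      exists2 r, r <> 0%N & gchar g M top 1%g = gchar g R top 1%g + r%:R
    & K0_eq (cls Rh) (cls R'h) -> K0_eq (cls Mh) (cls Nh)].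
Proof.
have [S [S0 SB SZ Sg [St Sinj Sfst [p0 Sp0 p02]]]] := top_graph.
have Mg := Mh.1; have Ng := Nh.1.
pose D := dsum M N; have Dh : fd_graded D := dsum_fd scal_deg Mh Nh.
have Dg := Dh.1.
have Dtop (p : D) : gm_deg (1 + top) p -> p = 0.
  by move=> [/Mtop p1 /Ntop p2]; apply: injective_projections.
have SY u p : S p -> Y u *: p = 0.
  by move=> /St pt; apply: Dtop; apply: (gm_degM Dg).
pose xs := @xspan _ _ V A X D S.
have xs0 : xs 0 by apply: xs_0.
have xsB m n : xs m -> xs n -> xs (m - n) by apply: xs_B.
have xsM a m : xs m -> xs (a *: m) := @xspan_stable _ _ _ _ _ _ _ _ _ rels gens D S SZ Sg SY a m.
have xsH i m : xs m -> xs (hpart i m).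
  move=> xm; elim: xm i => {m} [m Sm||m n _ hm _ hn|v m _ hm] i.
  - rewrite (hpart_hom Dg _ (St _ Sm)); case: eqP => _ //.
    exact: xs_base.
  - by rewrite hpart0.
  - by rewrite hpartB //; apply: xsB.
  - have -> : i = -1 + (i + 1) by rewrite addrC addrK.
    by rewrite hpartM //; apply/xs_X/hm.
have xstop m : xs m -> S (hpart top m).
  elim=> {m} [m Sm||m n _ hm _ hn|v m _ hm].
  - by rewrite (hpart_id Dg) //; apply: St.
  - by rewrite hpart0.
  - by rewrite hpartB //; apply: SB.
  - have -> : top = -1 + (1 + top) by rewrite addKr.
    rewrite hpartM // (Dtop (hpart _ m)) ?scaler0 //.
    exact: hpart_deg.
pose P := subm xs0 xsB xsM; pose inc := subm_in xs0 xsB xsM.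
have Ph : fd_graded P by split; [apply: subm_graded | apply: subm_fdim; case: Dh].
pose f1 : {linear P -> M} := (@dsum_fst _ _ M N : {linear D -> M}) \o inc.
pose f2 : {linear P -> N} := (@dsum_snd _ _ M N : {linear D -> N}) \o inc.
have f1d : degree0 f1 by move=> i p [].
have f2d : degree0 f2 by move=> i p [].
have Ptop (p : P) : gm_deg top p -> S (inc p).
  by move=> pt; rewrite -[inc p](hpart_id Dg pt); apply: xstop (subm_inP p).
have Pex p : S p -> exists p' : P, inc p' = p.
  by move=> Sp; apply/subm_exP/xs_base.
have [K1 [I1 [C1 [k1 [q1 [j1 [c1 [[K1h I1h C1h] [k1d _ _] [k1i _ _ c1s] [ex1 exc1] [sK1 sI1]]]]]]]]] :=
  ker_coker scal_deg Ph Mh f1d.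
have [K2 [I2 [C2 [k2 [q2 [j2 [c2 [[K2h I2h C2h] [k2d q2d j2d] [k2i _ jq2 c2s] _ [sK2 sI2]]]]]]]]] :=
  ker_coker scal_deg Ph Nh f2d.
have gP i w : gchar g P i w = gchar g K1 i w + gchar g I1 i w by apply: gchar_exact.
have gP' i w : gchar g P i w = gchar g K2 i w + gchar g I2 i w by apply: gchar_exact.
have gM i w : gchar g M i w = gchar g I1 i w + gchar g C1 i w by apply: gchar_exact.
have gN i w : gchar g N i w = gchar g I2 i w + gchar g C2 i w by apply: gchar_exact.
have Rh := dsum_fd scal_deg K2h C1h; have R'h := dsum_fd scal_deg K1h C2h.
have gR i w : gchar g (dsum K2 C1) i w = gchar g K2 i w + gchar g C1 i w.
  by apply: gchar_exact => //; apply: dsum_exact; case: C1h.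
have gR' i w : gchar g (dsum K1 C2) i w = gchar g K1 i w + gchar g C2 i w.
  by apply: gchar_exact => //; apply: dsum_exact; case: C2h.
have cP1 : K0_eq (cls Ph) (K0_add (cls K1h) (cls I1h)) by apply: cls_exact.
have cP2 : K0_eq (cls Ph) (K0_add (cls K2h) (cls I2h)) by apply: cls_exact.
have cM : K0_eq (cls Mh) (K0_add (cls I1h) (cls C1h)) by apply: cls_exact.
have cN : K0_eq (cls Nh) (K0_add (cls I2h) (cls C2h)) by apply: cls_exact.
exists (dsum K2 C1), (dsum K1 C2), Rh, R'h; split.
- move=> i w; rewrite gR gR'; have := gP i w; rewrite gP' => e1.
  have := MN_all i w; rewrite gM gN => e2.
  apply: (addrI (gchar g I2 i w)); rewrite addrA [_ + gchar g K2 i w]addrC e1.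
  by rewrite -addrA e2 addrCA.
- move=> i Mi Ni.
  have Pi (p : P) : gm_deg i p -> p = 0.
    move=> [/Mi p1 /Ni p2]; apply: (@subm_in_inj _ _ _ _ xs0 xsB xsM).
    by rewrite raddf0; apply: injective_projections.
  split=> -[x y] [/= xi yi]; apply: injective_projections => /=.
  + by apply: k2i; rewrite raddf0; apply/Pi/k2d.
  + by have [m mi <-] := c1s _ _ yi; rewrite (Mi _ mi) raddf0.
  + by apply: k1i; rewrite raddf0; apply/Pi/k1d.
  + by have [m mi <-] := c2s _ _ yi; rewrite (Ni _ mi) raddf0.
- have dim0 L : fd_graded L -> (forall m : L, gm_deg top m -> m = 0) ->
      gchar g L top 1%g = 0.
    move=> Lh L0; have [r [-> rE]] := gchar_dim scal_deg top (cg_g1 rels) Lh.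
    by rewrite (rE.2 L0).
  have K10 : gchar g K1 top 1%g = 0.
    apply: dim0 => // x xt; apply: k1i; rewrite raddf0.
    have f1x : f1 (k1 x) = 0 by apply/ex1; exists x.
    apply: (@subm_in_inj _ _ _ _ xs0 xsB xsM); rewrite raddf0.
    by apply: Sinj => //; apply/Ptop/k1d.
  have C10 : gchar g C1 top 1%g = 0.
    apply: dim0 => // q qt; have [m mt <-] := c1s _ _ qt.
    have [n /Pex [p pE]] := Sfst m mt.
    by apply/exc1; exists p; rewrite -[f1 p]/((inc p).1) pE.
  have [r [rI rE]] := gchar_dim scal_deg top (cg_g1 rels) I2h.
  exists r.
    have [p pE] := Pex _ Sp0.
    move=> /rE /(_ (q2 p)) h; apply: p02.
    have -> : p0.2 = f2 p by rewrite -[f2 p]/((inc p).2) pE.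
    rewrite -jq2 h ?raddf0 //; apply: q2d.
    by rewrite -[gm_deg _ _]/(gm_deg top (inc p)) pE; apply: St.
  rewrite gM gR C10 !addr0 -rI -gP'.
  by rewrite gP K10 add0r.
- move=> RR; apply: (K0_compare (p := cls Ph) (k1 := cls K1h) (k2 := cls K2h)
    (c1 := cls C1h) (c2 := cls C2h)).
  + apply: K0_trans (K0_addr _ cM) _; apply: K0_trans (K0_addAC _ _ _) _.
    apply: K0_addr; apply: K0_trans (K0_comm _ _) _; exact: K0_sym.
  + apply: K0_trans (K0_addr _ cN) _; apply: K0_trans (K0_addAC _ _ _) _.
    apply: K0_addr; apply: K0_trans (K0_comm _ _) _; exact: K0_sym.
  + apply: K0_trans (K0_sym (cls_dsum scal_deg K2h C1h)) _.
    apply: K0_trans _ (cls_dsum scal_deg K1h C2h).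
    apply: K0_trans (K0_in_G_irr _ (fd_in_G Rh)) _; apply: K0_trans RR _.
    exact: K0_in_G_irr.
Qed.
End TopDegree.

(** By induction on the number n of degrees where M and N may be nonzero and, *)
(** for a given n, on the dimension r of the top component: top_step lowers r *)
(** as long as this component is nonzero, and otherwise n decreases.          *)
Lemma K0_eq_supported n : forall (M N : grmod A) (Mh : fd_graded M) (Nh : fd_graded N) lo,
  supported M lo (lo + n%:Z) -> supported N lo (lo + n%:Z) ->
  (forall i w, gchar g M i w = gchar g N i w) -> K0_eq (cls Mh) (cls Nh).
Proof.
elim: n => [|n IHn] M N Mh Nh lo Ms Ns MN.
  have Z (L : grmod A) : fd_graded L -> supported L lo (lo + 0%:Z) -> forall m : L, m = 0.
    move=> [Lg _] Ls m; apply: (hpart_eq0 scal_deg Lg) => i.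
    apply: (Ls i); last exact: hpart_deg.
    by rewrite addr0; apply/negP => /andP [/le_lt_trans h /h]; rewrite ltxx.
  by apply: cls_trivial; apply: Z.
pose top := lo + n%:Z.
have topE i : (lo <= i < lo + n.+1%:Z) = (lo <= i < top) || (i == top).
  rewrite -addn1 PoszD addrA ltzD1 [i <= _]le_eqVlt andb_orr orbC -/top.
  case: eqP => [->|] //=; rewrite ?andbF ?orbF ?orbT //.
  by rewrite andbT /top lerDl orbT.
have above (L : grmod A) : supported L lo (lo + n.+1%:Z) -> forall m : L, gm_deg (1 + top) m -> m = 0.
  by move=> Ls m; apply: Ls; rewrite topE gtrDr -subr_eq0 addrK andbF.
have [r rM] : exists r : nat, gchar g M top 1%g = r%:R.
  by have [r [h _]] := gchar_dim scal_deg top (cg_g1 rels) Mh; exists r.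
elim/ltn_ind: r => r IHr in M N Mh Nh Ms Ns MN rM *.
have [Mne|M0] := pselect (exists2 m : M, gm_deg top m & m <> 0); last first.
  have M0' (m : M) : gm_deg top m -> m = 0.
    by move=> mt; apply: contrapT => m0; apply: M0; exists m.
  have N0 : forall m : N, gm_deg top m -> m = 0.
    have [r1 [r1M e1]] := gchar_dim scal_deg top (cg_g1 rels) Mh.
    have [r2 [r2N e2]] := gchar_dim scal_deg top (cg_g1 rels) Nh.
    apply/e2; have := MN top 1%g; rewrite r1M r2N (e1.2 M0') => /esym/eqP.
    by rewrite pnatr_eq0 => /eqP.
  have cut (L : grmod A) : supported L lo (lo + n.+1%:Z) ->
      (forall m : L, gm_deg top m -> m = 0) -> supported L lo top.
    move=> Ls L0 i m ni mi; have [it|it] := eqVneq i top.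
      by apply: L0; rewrite -it.
    by apply: (Ls i) => //; rewrite topE negb_or ni it.
  by apply: (IHn _ _ _ _ lo) => //; apply: cut.
have [R [R' [Rh [R'h [RR supp [s s0 rs] K]]]]] :=
  top_step Mh Nh (above _ Ms) (above _ Ns) (MN top) Mne MN.
apply: K; have [t [tR _]] := gchar_dim scal_deg top (cg_g1 rels) Rh.
have rts : r = (t + s)%N.
  by apply/eqP; rewrite -(eqr_nat C) natrD -tR -rs rM.
apply: (IHr t) => //.
- by rewrite rts -[X in (X < _)%N]addn0 ltn_add2l lt0n; apply/eqP.
- move=> i m ni mi; have [h _] := supp i (fun m => Ms i m ni) (fun m => Ns i m ni).
  exact: h.
- move=> i m ni mi; have [_ h] := supp i (fun m => Ms i m ni) (fun m => Ns i m ni).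
  exact: h.
Qed.

Lemma K0_eq_gchar (M N : grmod A) (Mh : fd_graded M) (Nh : fd_graded N) :
  (forall i w, gchar g M i w = gchar g N i w) -> K0_eq (cls Mh) (cls Nh).
Proof.
move=> MN; have [lo [n Ms]] := supported_ex scal_deg Mh.
have [lo' [n' Ns]] := supported_ex scal_deg Nh.
(* The interval [l, l + b) contains both supports. *)
pose a := (`|lo| + `|lo'|)%N; pose l : int := - a%:Z.
pose b := (a + (a + (n + n')))%N.
have e : l + b%:Z = (a + (n + n'))%N%:Z by rewrite /l /b (PoszD a) addKr.
have ub (x : int) (k j : nat) : (`|x| + k <= j)%N -> x + k%:Z <= j%:Z.
  move=> h; apply: (@le_trans _ _ (`|x|%N + k)%:Z); last by rewrite lez_nat.
  by rewrite PoszD lerD2r abszE ler_norm.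
have lb (x : int) (j : nat) : (`|x| <= j)%N -> - j%:Z <= x.
  by move=> h; rewrite lerNl; apply: le_trans (ler_norm _) _; rewrite normrN -abszE lez_nat.
apply: (@K0_eq_supported b _ _ _ _ l) => //.
  by apply: Ms; [apply/lb/leq_addr | rewrite e; apply: ub; rewrite addnACA leq_addr].
apply: Ns; [apply/lb/leq_addl | rewrite e; apply: ub; rewrite addnACA leq_addl //].
Qed.
End CharacterK0.

(** * Twisted derivations of symmetric algebras *)

Section Triangular.
Variables (F : fieldType) (B : algebra F).

(** (a, b, c) stands for the matrix with diagonal entries a, c and lower left *)
(** entry b.                                                                  *)
Definition tri := (B * B * B)%type.
HB.instance Definition _ := GRing.Zmodule.on tri.
Definition tri_one : tri := (1, 0, 1).
Definition tri_mul (p q : tri) : tri :=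
  (p.1.1 * q.1.1, p.1.2 * q.1.1 + p.2 * q.1.2, p.2 * q.2).
Lemma tri_mulA : associative tri_mul.
Proof.
move=> [[a b] c] [[a' b'] c'] [[a'' b''] c'']; rewrite /tri_mul /= !mulrA.
by rewrite mulrDr mulrDl !mulrA addrA.
Qed.
Lemma tri_mul1l : left_id tri_one tri_mul.
Proof. by move=> [[a b] c]; rewrite /tri_mul /= !mul1r mul0r add0r. Qed.
Lemma tri_mul1r : right_id tri_one tri_mul.
Proof. by move=> [[a b] c]; rewrite /tri_mul /= !mulr1 mulr0 addr0. Qed.
Lemma tri_mulDl : left_distributive tri_mul +%R.
Proof.
move=> [[a b] c] [[a' b'] c'] [[a'' b''] c'']; rewrite /tri_mul /= !mulrDl.
by congr (_, _, _); rewrite addrACA.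
Qed.
Lemma tri_mulDr : right_distributive tri_mul +%R.
Proof.
move=> [[a b] c] [[a' b'] c'] [[a'' b''] c'']; rewrite /tri_mul /= !mulrDr.
by congr (_, _, _); rewrite addrACA.
Qed.
HB.instance Definition _ := GRing.Zmodule_isPzRing.Build tri
  tri_mulA tri_mul1l tri_mul1r tri_mulDl tri_mulDr.
Definition tri_scal (k : F) : tri := (al_scal k, 0, al_scal k).
Lemma tri_scal_additive : zmod_morphism tri_scal.
Proof. by move=> k l; rewrite /tri_scal rmorphB; congr (_, _, _); rewrite subr0. Qed.
Lemma tri_scal_monoid : monoid_morphism tri_scal.
Proof.
split=> [|k l]; first by rewrite /tri_scal rmorph1.
by rewrite /tri_scal rmorphM; congr (_, _, _); rewrite /= mul0r mulr0 addr0.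
Qed.
HB.instance Definition _ := GRing.isZmodMorphism.Build F tri tri_scal tri_scal_additive.
HB.instance Definition _ := GRing.isMonoidMorphism.Build F tri tri_scal tri_scal_monoid.
Lemma tri_central k (x : tri) : tri_scal k * x = x * tri_scal k.
Proof.
case: x => [[a b] c]; rewrite /tri_scal; congr (_, _, _); rewrite /= ?al_central //.
by rewrite mul0r mulr0 add0r addr0.
Qed.
Definition tri_alg : algebra F := Algebra tri_central.
End Triangular.

Section SymTheory.
Variables (F : fieldType) (W : finGroupType) (V : wrep F W).
Notation S := (sym_walg V).

Lemma svar_linear k (u v : V) : svar (k *: u + v) = al_scal k * svar u + svar v.
Proof. by rewrite /svar tvar_linear !ahD !ahM !ah_scal. Qed.
Lemma svarZ k (u : V) : svar (k *: u) = al_scal k * svar u.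
Proof.
have s0 : svar (0 : V) = 0.
  have := svar_linear 1 (0 : V) 0; rewrite scale1r addr0 rmorph1 mul1r => /eqP.
  by rewrite -subr_eq subrr => /eqP <-.
by rewrite -[k *: u]addr0 svar_linear s0 addr0.
Qed.
Lemma svarD (u v : V) : svar (u + v) = svar u + svar v.
Proof. by rewrite -{1}[u]scale1r svar_linear rmorph1 mul1r. Qed.
Lemma svarB (u v : V) : svar (u - v) = svar u - svar v.
Proof. by rewrite svarD -scaleN1r svarZ rmorphN rmorph1 mulN1r. Qed.

Lemma sym_comm (x y : S) : x * y = y * x.
Proof.
have vC (v : V) (z : S) : svar v * z = z * svar v.
  elim/sym_ind: z => [u|k|a b ha hb|a b ha hb].
  - rewrite /svar -2!(ahM (quot_proj (@sym_rel F W V))); apply/qpiE/ideal_gen.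
    by exists v, u.
  - by rewrite al_central.
  - by rewrite mulrDr mulrDl ha hb.
  - by rewrite mulrA ha -mulrA hb mulrA.
elim/sym_ind: x => [u|k|a b ha hb|a b ha hb].
- exact: vC.
- by rewrite al_central.
- by rewrite mulrDr mulrDl ha hb.
- by rewrite -mulrA hb mulrA ha -mulrA.
Qed.

Lemma sym_hom_eq (B : algebra F) (f f' : algHom S B) :
  (forall v, f (svar v) = f' (svar v)) -> forall p, f p = f' p.
Proof.
move=> e; elim/sym_ind => [v|k|x y hx hy|x y hx hy].
- exact: e.
- by rewrite !ah_scal.
- by rewrite !ahD hx hy.
- by rewrite !ahM hx hy.
Qed.

(** Twisted derivations correspond to homomorphisms into triangular matrices, *)
(** so the universal property of S(V) extends them from V.                    *)
Lemma twisted_derivation (B : algebra F) (f h : algHom S B) (d : V -> B) :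
  (forall k u v, d (k *: u + v) = al_scal k * d u + d v) ->
  (forall u v, d u * f (svar v) + h (svar u) * d v
             = d v * f (svar u) + h (svar v) * d u) ->
  exists D : S -> B, [/\ forall v, D (svar v) = d v,
    forall x y, D (x - y) = D x - D y, forall k, D (al_scal k) = 0
    & forall x y, D (x * y) = D x * f y + h x * D y].
Proof.
move=> d_lin d_sym.
pose e (v : V) : tri_alg B := (f (svar v), d v, h (svar v)).
have e_lin k u v : e (k *: u + v) = al_scal k * e u + e v.
  rewrite /e svar_linear d_lin !ahD !ahM !ah_scal; congr (_, _, _).
  by rewrite /= mul0r add0r.
have e_comm u v : e u * e v = e v * e u.
  have c x y (k : algHom S B) : k x * k y = k y * k x.
    by rewrite -(ahM k) sym_comm (ahM k).
  by congr (_, _, _); [apply: c | apply: d_sym | apply: c].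
pose E := sym_lift e_lin e_comm.
have E1 x : (E x).1.1 = f x.
  elim/sym_ind: x => [v|k|x y hx hy|x y hx hy].
  - by rewrite sym_liftE.
  - by rewrite !ah_scal.
  - by rewrite !ahD /= hx hy.
  - by rewrite !ahM /= hx hy.
have E2 x : (E x).2 = h x.
  elim/sym_ind: x => [v|k|x y hx hy|x y hx hy].
  - by rewrite sym_liftE.
  - by rewrite !ah_scal.
  - by rewrite !ahD /= hx hy.
  - by rewrite !ahM /= hx hy.
exists (fun x => (E x).1.2); split=> [v|x y|k|x y].
- by rewrite sym_liftE.
- by rewrite ahB.
- by rewrite ah_scal.
- by rewrite ahM /= E1 E2.
Qed.
End SymTheory.

(** * Divided differences *)

Section RepTheory.
Variables (F : fieldType) (W : finGroupType) (V : wrep F W).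
Lemma wr_act0 w : wr_act w (0 : V) = 0.
Proof.
have := wr_linear w 1 (0 : V) 0; rewrite !scale1r addr0 => /eqP.
by rewrite -subr_eq subrr => /eqP.
Qed.
Lemma wr_actZ w k (v : V) : wr_act w (k *: v) = k *: wr_act w v.
Proof. by have := wr_linear w k v 0; rewrite wr_act0 !addr0. Qed.
Lemma wr_actB w (u v : V) : wr_act w (u - v) = wr_act w u - wr_act w v.
Proof. by rewrite [u - v]addrC -scaleN1r wr_linear scaleN1r addrC. Qed.
End RepTheory.

Section DividedDifference.
Variables (F : fieldType) (W : finGroupType) (V : wrep F W) (s : W).
Variables (d : V -> F) (a : V).
Hypotheses (d_lin : forall k u v, d (k *: u + v) = k * d u + d v).
Hypothesis sE : forall v, v - wr_act s v = d v *: a.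
Notation S := (sym_walg V).
Notation act := (wa_act (sym_walg V)).

Lemma refl_actE v : wr_act s v = v - d v *: a.
Proof. by rewrite -sE opprB addrC subrK. Qed.

(** D is f |-> (f - s f) / a; the twisted Leibniz rule determines it without  *)
(** any division.                                                             *)
Lemma divided_difference_ex : exists D : S -> S, [/\ forall v, D (svar v) = al_scal (d v),
    forall x y, D (x - y) = D x - D y, forall k, D (al_scal k) = 0
    & forall x y, D (x * y) = D x * y + act s x * D y].
Proof.
have [||D DP] := @twisted_derivation F W V S (idHom S) (act s) (fun v => al_scal (d v)).
- by move=> k u v; rewrite d_lin rmorphD rmorphM.
- move=> u v; rewrite !sym_actE !refl_actE !svarB !svarZ !mulrBl /=.
  rewrite -![svar _ * al_scal _]al_central addrCA; congr (_ + (_ + _)).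
  congr (- _); rewrite -![al_scal _ * svar a * _]mulrA -![svar a * al_scal _]al_central.
  by rewrite !mulrA -!rmorphM mulrC.
- by exists D.
Qed.

Variable D : S -> S.
Hypotheses (D_svar : forall v, D (svar v) = al_scal (d v)).
Hypotheses (DB : forall x y, D (x - y) = D x - D y).
Hypotheses (D_scal : forall k, D (al_scal k) = 0).
Hypotheses (DM : forall x y, D (x * y) = D x * y + act s x * D y).

Lemma DD x y : D (x + y) = D x + D y. Proof. exact: (morphBD DB). Qed.
Lemma DZ k x : D (al_scal k * x) = al_scal k * D x.
Proof. by rewrite DM D_scal mul0r add0r ah_scal. Qed.
Lemma DMr x y : D (x * y) = x * D y + D x * act s y.
Proof. by rewrite sym_comm DM [D y * x]sym_comm [_ * D x]sym_comm. Qed.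

Lemma D_mulr x : svar a * D x = x - act s x.
Proof.
elim/sym_ind: x => [v|k|x y hx hy|x y hx hy].
- by rewrite D_svar sym_actE refl_actE svarB svarZ opprB addrC subrK al_central.
- by rewrite D_scal mulr0 ah_scal subrr.
- by rewrite DD mulrDr hx hy ahD opprD addrACA.
- rewrite DM mulrDr mulrA hx mulrBl mulrA [svar a * _]sym_comm -mulrA hy mulrBr.
  by rewrite ahM addrA subrK.
Qed.

Hypothesis da0 : d a != 0.
Let z := 1 - d a.

Lemma d0 : d 0 = 0.
Proof.
by have := d_lin 1 0 0; rewrite scale1r addr0 mul1r => /eqP; rewrite -subr_eq subrr => /eqP.
Qed.
Lemma dZ k v : d (k *: v) = k * d v.
Proof. by rewrite -[k *: v]addr0 d_lin d0 addr0. Qed.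
Lemma refl_root : wr_act s a = z *: a.
Proof. by rewrite refl_actE /z scalerBl scale1r. Qed.
Lemma refl_root_exp j : wr_act (s ^+ j)%g a = z ^+ j *: a.
Proof.
elim: j => [|j IH]; first by rewrite expg0 expr0 wr_act1 scale1r.
by rewrite expgSr wr_actM refl_root wr_actZ IH scalerA -exprS.
Qed.
Lemma refl_eigen_order : z ^+ #[s]%g = 1.
Proof.
have := refl_root_exp #[s]%g; rewrite expg_order wr_act1 => /(congr1 d).
by rewrite dZ -[LHS]mul1r => /(mulIf da0).
Qed.

Lemma D_act x : D (act s x) = al_scal z * act s (D x).
Proof.
have dact v : d (wr_act s v) = z * d v.
  apply: (mulIf da0); rewrite -dZ -sE.
  by rewrite -wr_actB sE wr_actZ refl_root scalerA dZ [d v * z]mulrC.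
elim/sym_ind: x => [v|k|x y hx hy|x y hx hy].
- by rewrite sym_actE !D_svar ah_scal dact rmorphM.
- by rewrite ah_scal D_scal ah0 mulr0.
- by rewrite !(ahD, DD) hx hy mulrDr.
- rewrite !ahM DM hx hy DM !ahD !ahM mulrDr -!mulrA; congr (_ + _).
  by rewrite mulrA -al_central !mulrA.
Qed.

(** \sum_j z^j s^j is a multiple of the projection on the eigenspace of s for *)
(** the eigenvalue z^-1.  No divided difference has a component there, since  *)
(** D (a x) = x - z s(x) and D commutes with the linear forms fixed by s.     *)
Definition twisted_norm (x : S) : S :=
  \sum_(j < #[s]%g) al_scal (z ^+ j) * act (s ^+ j)%g x.
Lemma tnormD x y : twisted_norm (x + y) = twisted_norm x + twisted_norm y.
Proof. by rewrite -big_split; apply: eq_bigr => j _; rewrite ahD mulrDr. Qed.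
Lemma tnormZ k x : twisted_norm (al_scal k * x) = al_scal k * twisted_norm x.
Proof.
rewrite mulr_sumr; apply: eq_bigr => j _.
by rewrite ahM ah_scal !mulrA (al_central S).
Qed.

Lemma tnorm_D x : twisted_norm (D x) = 0.
Proof.
have t0 : twisted_norm 0 = 0 by rewrite /twisted_norm big1 // => j _; rewrite ah0 mulr0.
suff Q y : twisted_norm (D y) = 0 -> twisted_norm (D (x * y)) = 0.
  by rewrite -[x]mulr1; apply: Q; rewrite -(rmorph1 (@al_scal _ S)) D_scal.
elim/sym_ind: x y => [v|k|x1 x2 h1 h2|x1 x2 h1 h2] y hy.
- (* v splits into a fixed vector of s and a multiple of a. *)
  pose k := d v / d a; pose v0 := v - k *: a.
  have dv0 : d v0 = 0.
    by rewrite /v0 addrC -scaleNr d_lin mulNr divfK // addNr.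
  have sv0 : wr_act s v0 = v0 by rewrite refl_actE dv0 scale0r subr0.
  have sjv0 j : wr_act (s ^+ j)%g v0 = v0.
    by elim: j => [|j IH]; rewrite ?expg0 ?wr_act1 // expgSr wr_actM sv0.
  have -> : svar v = svar v0 + al_scal k * svar a by rewrite svarB svarZ subrK.
  rewrite mulrDl DD tnormD.
  have -> : twisted_norm (D (svar v0 * y)) = 0.
    rewrite DM D_svar dv0 rmorph0 mul0r add0r sym_actE sv0.
    transitivity (svar v0 * twisted_norm (D y)); last by rewrite hy mulr0.
    rewrite mulr_sumr; apply: eq_bigr => j _.
    by rewrite ahM sym_actE sjv0 !mulrA al_central.
  rewrite -mulrA DZ tnormZ.
  have -> : D (svar a * y) = y + al_scal (- z) * act s y.
    rewrite DM D_svar sym_actE refl_root svarZ -mulrA D_mulr mulrBr rmorphN mulNr.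
    by rewrite addrA -mulrDl -rmorphD /z [d a + _]addrC subrK rmorph1 mul1r.
  rewrite tnormD tnormZ rmorphN mulNr /twisted_norm mulr_sumr -sumrB.
  pose f j := al_scal (z ^+ j) * act (s ^+ j)%g y.
  transitivity (al_scal k * (\sum_(j < #[s]%g) (f j - f j.+1))).
    rewrite add0r; congr (_ * _); apply: eq_bigr => j _; rewrite /f mulrA -rmorphM -exprS.
    by rewrite expgSr wa_actM.
  rewrite -(big_mkord xpredT (fun j => f j - f j.+1)).
  rewrite (@telescope_sumr_eq _ _ _ (fun j => - f j)) //; last first.
    by move=> j _; rewrite opprK addrC.
  by rewrite /f expg_order refl_eigen_order expg0 expr0 opprK addNr mulr0.
- by rewrite DZ tnormZ hy mulr0.
- by rewrite mulrDl DD tnormD h1 // h2 // addr0.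
- by rewrite -mulrA; apply/h1/h2.
Qed.

Hypothesis natr_neq0 : forall n, n.+1%:R != 0 :> F.

Lemma D_inv x : act s x = x -> D x = 0.
Proof.
move=> sx; have sDx j : al_scal (z ^+ j) * act (s ^+ j)%g (D x) = D x.
  elim: j => [|j IH]; first by rewrite expg0 expr0 wa_act1 rmorph1 mul1r.
  transitivity (al_scal (z ^+ j) * act (s ^+ j)%g (al_scal z * act s (D x))).
    by rewrite exprSr rmorphM expgSr wa_actM ahM ah_scal mulrA.
  by rewrite -D_act sx.
have := tnorm_D x; rewrite /twisted_norm.
under eq_bigr => j _ do rewrite sDx.
rewrite sumr_const card_ord -[#[s]%g]prednK ?order_gt0 // => e.
rewrite -[LHS]mul1r -(rmorph1 (@al_scal _ S)) -(mulVf (natr_neq0 #[s]%g.-1)).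
by rewrite rmorphM rmorph_nat -mulrA mulr_natl e mulr0.
Qed.
End DividedDifference.

(** The linear form d cuts out the hyperplane fixed by s, or is zero.         *)
Definition reflection_form (F : fieldType) (W : finGroupType) (V : wrep F W)
    (s : W) (d : V -> F) : Prop :=
  (forall k u v, d (k *: u + v) = k * d u + d v) /\
  ((forall v, d v = 0) \/
   exists a, d a != 0 /\ forall v, v - wr_act s v = d v *: a).

Section SymDifference.
Variables (F : fieldType) (W : finGroupType) (V : wrep F W) (s : W) (d : V -> F).
Hypothesis natr_neq0 : forall n, n.+1%:R != 0 :> F.
Hypothesis df : reflection_form s d.
Notation S := (sym_walg V).
Notation C := (coinv_walg V).
Notation act := (wa_act (sym_walg V)).
Notation proj := (quot_proj (@coinv_rel F W V)).

(** As S(V) is commutative, the twist of the Leibniz rule may be put on       *)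
(** either factor; on the right it suits the products X_v f.                  *)
Lemma sym_difference : exists D : S -> S, [/\ forall v, D (svar v) = al_scal (d v),
    forall x y, D (x - y) = D x - D y, forall k, D (al_scal k) = 0,
    forall x y, D (x * y) = x * D y + D x * act s y
    & forall x, sym_inv x -> D x = 0].
Proof.
case: df => d_lin [d0|[a [da sa]]].
  exists (fun=> 0); split=> // [v|x y|x y].
  - by rewrite d0 rmorph0.
  - by rewrite subr0.
  - by rewrite mulr0 mul0r addr0.
have [D [Dv DB Dk DM]] := divided_difference_ex d_lin sa.
exists D; split=> // [x y|x xi]; first exact: DMr.
by apply: (D_inv d_lin sa Dv DB Dk DM) => //; apply: xi.
Qed.

(** Divided differences preserve the ideal of the positive invariants, as     *)
(** they kill these and satisfy a Leibniz rule.                               *)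
Lemma coinv_difference : exists D : C -> C, [/\
    forall x y, D (x - y) = D x - D y, forall k, D (al_scal k) = 0,
    forall k x, D (al_scal k * x) = al_scal k * D x
    & forall v x, D (proj (svar v) * x)
        = proj (svar v) * D x + al_scal (d v) * wa_act C s x].
Proof.
have [D [Dv DB Dk DM Di]] := sym_difference.
pose I := in_ideal (@coinv_rel F W V).
have sI x : I x -> I (act s x).
  move=> Ix; rewrite -[act s x]subr0; apply/qpiE.
  have := @quot_actE F W S _ (@coinv_rel_stable F W V) s x.
  rewrite -[qpi _ _]/(proj (act s x)) => <-.
  have -> : proj x = 0.
    by rewrite -(ah0 proj); apply/qpiE; rewrite subr0.
  by rewrite ah0 -(ah0 proj).
have DI x : I x -> I (D x).
  elim=> {x} [x [xi _]||x y _ hx _ hy|a x hx IH|x a hx IH].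
  - by rewrite Di //; apply: ideal0.
  - by rewrite -[0](rmorph0 (@al_scal _ S)) Dk; apply: ideal0.
  - by rewrite DB; apply: idealB.
  - rewrite DM; apply: in_idealD; first exact: idealMl.
    exact/idealMl/sI.
  - rewrite DM; apply: in_idealD; [exact: idealMr|exact: idealMr].
pose E (q : C) : C := proj (D (repr q)).
have EE x : E (proj x) = proj (D x).
  apply/qpiE; rewrite -DB; apply/DI/repr_qpi.
exists E; split=> [p q|k|k q|v q].
- case: (qpi_surj p) (qpi_surj q) => x -> [y ->].
  by rewrite -[qpi _ x - _](ahB proj) !EE DB ahB.
- by rewrite -(ah_scal proj) EE Dk ah0.
- case: (qpi_surj q) => x ->; rewrite -[qpi _ x]/(proj x) -(ah_scal proj) -(ahM proj).
  by rewrite !EE DM Dk mul0r addr0 ahM.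
- case: (qpi_surj q) => x ->; rewrite -[qpi _ x]/(proj x) -(ahM proj) !EE DM ahD !ahM.
  by rewrite Dv ah_scal -[wa_act C s]/(quot_act (@coinv_rel_stable F W V) s) quot_actE.
Qed.
End SymDifference.

(** * Dunkl operators *)

Section EndAlgebra.
Variables (F : fieldType) (A : algebra F) (M : lmodType A).

Record fend := FEnd { fe_fun :> M -> M; feP : flinear fe_fun }.
HB.instance Definition _ := gen_eqMixin fend.
HB.instance Definition _ := gen_choiceMixin fend.
Lemma fend_eq (f h : fend) : (forall m, f m = h m) -> f = h.
Proof.
case: f h => f fl [h hl] /= e; have {e} e : f = h by apply: funext.
by rewrite e in fl *; congr FEnd; apply: Prop_irrelevance.
Qed.
Lemma fe0 (f : fend) : f 0 = 0. Proof. exact: (flin0 (feP f)). Qed.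
Lemma feB (f : fend) m n : f (m - n) = f m - f n. Proof. exact: (flinB (feP f)). Qed.
Lemma feD (f : fend) m n : f (m + n) = f m + f n. Proof. exact: (flinD (feP f)). Qed.
Lemma feZ (f : fend) k m : f (k *! m) = k *! f m. Proof. by case: f => f []. Qed.
Lemma fe_sum (f : fend) (I : Type) (r : seq I) (P : pred I) (E : I -> M) :
  f (\sum_(i <- r | P i) E i) = \sum_(i <- r | P i) f (E i).
Proof. exact: (flin_sum (feP f)). Qed.

Lemma fend_zeroP : flinear (fun _ : M => 0 : M).
Proof. by split=> [m n|k m]; rewrite ?subr0 ?fsc0. Qed.
Lemma fend_oppP (f : fend) : flinear (fun m => - f m).
Proof. by split=> [m n|k m]; rewrite ?feB ?opprB ?opprK 1?addrC ?feZ ?scalerN. Qed.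
Lemma fend_addP (f h : fend) : flinear (fun m => f m + h m).
Proof. by split=> [m n|k m]; rewrite ?feB ?opprD ?feZ ?fscDr // addrACA. Qed.
Lemma fend_oneP : flinear (@id M). Proof. by []. Qed.
Lemma fend_mulP (f h : fend) : flinear (fun m => f (h m)).
Proof. by split=> [m n|k m]; rewrite ?feB ?feZ. Qed.
Lemma fend_scalP (k : F) : flinear (fun m : M => k *! m).
Proof. by split=> [m n|l m]; rewrite ?fscBr // !fscA mulrC. Qed.
Definition fend_zero := FEnd fend_zeroP.
Definition fend_opp f := FEnd (fend_oppP f).
Definition fend_add f h := FEnd (fend_addP f h).
Definition fend_one := FEnd fend_oneP.
Definition fend_mul f h := FEnd (fend_mulP f h).
Definition fend_scal k := FEnd (fend_scalP k).
Lemma fend_addA : associative fend_add.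
Proof. by move=> f h k; apply: fend_eq => m; apply: addrA. Qed.
Lemma fend_addC : commutative fend_add.
Proof. by move=> f h; apply: fend_eq => m; apply: addrC. Qed.
Lemma fend_add0 : left_id fend_zero fend_add.
Proof. by move=> f; apply: fend_eq => m; apply: add0r. Qed.
Lemma fend_addN : left_inverse fend_zero fend_opp fend_add.
Proof. by move=> f; apply: fend_eq => m; apply: addNr. Qed.
HB.instance Definition _ := GRing.isZmodule.Build fend
  fend_addA fend_addC fend_add0 fend_addN.
Lemma fend_mulA : associative fend_mul. Proof. by move=> f h k; apply: fend_eq. Qed.
Lemma fend_mul1l : left_id fend_one fend_mul. Proof. by move=> f; apply: fend_eq. Qed.
Lemma fend_mul1r : right_id fend_one fend_mul. Proof. by move=> f; apply: fend_eq. Qed.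
Lemma fend_mulDl : left_distributive fend_mul +%R.
Proof. by move=> f h k; apply: fend_eq. Qed.
Lemma fend_mulDr : right_distributive fend_mul +%R.
Proof. by move=> f h k; apply: fend_eq => m; apply: feD. Qed.
HB.instance Definition _ := GRing.Zmodule_isPzRing.Build fend
  fend_mulA fend_mul1l fend_mul1r fend_mulDl fend_mulDr.
Lemma fend_scal_additive : zmod_morphism fend_scal.
Proof. by move=> k l; apply: fend_eq => m; apply: fscBl. Qed.
Lemma fend_scal_monoid : monoid_morphism fend_scal.
Proof.
by split=> [|k l]; apply: fend_eq => m; [apply: fsc1 | rewrite /= fscA].
Qed.
HB.instance Definition _ := GRing.isZmodMorphism.Build F fend fend_scal fend_scal_additive.
HB.instance Definition _ := GRing.isMonoidMorphism.Build F fend fend_scal fend_scal_monoid.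
Lemma fend_central k (f : fend) : fend_scal k * f = f * fend_scal k.
Proof. by apply: fend_eq => m /=; rewrite feZ. Qed.
Definition fend_alg : algebra F := Algebra fend_central.

Lemma fend_mulE (f h : fend_alg) m : (f * h) m = f (h m). Proof. by []. Qed.
Lemma fend_addE (f h : fend_alg) m : (f + h) m = f m + h m. Proof. by []. Qed.
Lemma fend_oppE (f : fend_alg) m : (- f) m = - f m. Proof. by []. Qed.
Lemma fend_scalE k m : (al_scal k : fend_alg) m = k *! m. Proof. by []. Qed.
Lemma fend_sumE (I : Type) (r : seq I) (P : pred I) (E : I -> fend_alg) m :
  (\sum_(i <- r | P i) E i) m = \sum_(i <- r | P i) (E i) m.
Proof. by elim/big_rec2: _ => // i f h _ <-. Qed.
End EndAlgebra.

Section Tuples.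
Variables (F : fieldType) (B : algebra F) (n : nat).
Definition tuples := {ffun 'I_n -> B}.
HB.instance Definition _ := GRing.Zmodule.on tuples.
Definition tscale (k : base_alg F) (c : tuples) : tuples := [ffun j => al_scal (k : F) * c j].
Lemma tscaleA k l c : tscale k (tscale l c) = tscale (k * l) c.
Proof. by apply/ffunP => j; rewrite !ffunE mulrA -rmorphM. Qed.
Lemma tscale1 : left_id 1 tscale.
Proof. by move=> c; apply/ffunP => j; rewrite ffunE rmorph1 mul1r. Qed.
Lemma tscaleDr : right_distributive tscale +%R.
Proof. by move=> k c c'; apply/ffunP => j; rewrite !ffunE mulrDr. Qed.
Lemma tscaleDl c : {morph tscale^~ c : k l / k + l}.
Proof. by move=> k l; apply/ffunP => j; rewrite !ffunE rmorphD mulrDl. Qed.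
HB.instance Definition _ := GRing.Zmodule_isLmodule.Build (base_alg F) tuples
  tscaleA tscale1 tscaleDr tscaleDl.
End Tuples.

(** B (x) E for an n-dimensional space E: a vector is known by its n          *)
(** coordinates in B, with respect to a basis of E.                           *)
Record tuple_module (F : fieldType) (B : algebra F) (n : nat) := TupleModule {
  tm_mod :> lmodType (base_alg F);
  tm_at : tm_mod -> 'I_n -> B;
  tm_mk : ('I_n -> B) -> tm_mod;
  tm_mkE : forall f j, tm_at (tm_mk f) j = f j;
  tm_eq : forall c c', (forall j, tm_at c j = tm_at c' j) -> c = c';
  tm_atB : forall c c' j, tm_at (c - c') j = tm_at c j - tm_at c' j;
  tm_atZ : forall k c j, tm_at (k *! c) j = al_scal k * tm_at c j
}.

Lemma tuple_module_ex (F : fieldType) (B : algebra F) n : tuple_module B n.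
Proof.
apply: (@TupleModule F B n (tuples B n) (fun (c : tuples B n) j => c j)
  (fun f => [ffun j => f j] : tuples B n)).
- by move=> f j; rewrite ffunE.
- by move=> c c' h; apply/ffunP.
- by move=> c c' j; rewrite !ffunE.
- by move=> k c j; rewrite ffunE.
Qed.

Section Dunkl.
Variables (F : fieldType) (W : finGroupType) (V U : wrep F W).
Hypothesis natr_neq0 : forall n, n.+1%:R != 0 :> F.
Variables (mu : W -> F) (d : W -> V -> F) (d' : W -> U -> F).
Hypotheses (df : forall s, reflection_form s (d s)).
Hypotheses (df' : forall s, reflection_form s (d' s)).
Definition refl_coef s u v := mu s * d' s u * d s v.
Notation kap := refl_coef.
Hypothesis kap_act : forall w s u v,
  kap (w * s * w^-1)%g (wr_act w u) (wr_act w v) = kap s u v.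
Variables (n : nat) (rho : W -> 'M[F]_n).
Hypotheses (rho1 : rho 1%g = 1%:M) (rhoM : forall w w', rho (w * w')%g = rho w' *m rho w).
Notation C := (coinv_walg V).
Notation act := (wa_act (coinv_walg V)).
Notation proj := (quot_proj (@coinv_rel F W V)).

(** vmod is coinv(V) (x) E, in coordinates for a basis of the W-module E on   *)
(** which W acts by rho.                                                      *)
Variable vmod : tuple_module C n.
Notation vat := (@tm_at _ _ _ vmod).
Notation vmk := (@tm_mk _ _ _ vmod).
Let vatB j (c c' : vmod) : vat (c - c') j = vat c j - vat c' j := tm_atB c c' j.
Lemma vat0 j : vat 0 j = 0. Proof. exact: (morphB0 (vatB j)). Qed.
Lemma vatD c c' j : vat (c + c') j = vat c j + vat c' j.
Proof. exact: (morphBD (vatB j)). Qed.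
Lemma vat_sum (I : Type) (r : seq I) (P : pred I) (E : I -> vmod) j :
  vat (\sum_(i <- r | P i) E i) j = \sum_(i <- r | P i) vat (E i) j.
Proof. exact: (big_morph (fun c => vat c j) (fun c c' => vatD c c' j) (vat0 j)). Qed.
Definition vconst (x : 'I_n -> F) : vmod := vmk (fun j => al_scal (x j)).

Definition vX_fun (b : C) (c : vmod) : vmod := vmk (fun j => b * vat c j).
Lemma vX_lin b : flinear (vX_fun b).
Proof.
split=> [c c'|k c]; apply: tm_eq => j.
  by rewrite tm_atB !tm_mkE tm_atB mulrBr.
by rewrite tm_atZ !tm_mkE tm_atZ !mulrA (al_central C).
Qed.
Definition vX (b : C) : fend_alg vmod := FEnd (vX_lin b).
Lemma vXE b c j : vat (vX b c) j = b * vat c j. Proof. exact: tm_mkE. Qed.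

Definition vg_fun w (c : vmod) : vmod :=
  vmk (fun j => \sum_i al_scal (rho w i j) * act w (vat c i)).
Lemma vg_lin w : flinear (vg_fun w).
Proof.
split=> [c c'|k c]; apply: tm_eq => j.
  rewrite tm_atB !tm_mkE -sumrB; apply: eq_bigr => i _.
  by rewrite tm_atB ahB mulrBr.
rewrite tm_atZ !tm_mkE mulr_sumr; apply: eq_bigr => i _.
by rewrite tm_atZ ahM ah_scal !mulrA (al_central C).
Qed.
Definition vg w : fend_alg vmod := FEnd (vg_lin w).
Lemma vgE w c j : vat (vg w c) j = \sum_i al_scal (rho w i j) * act w (vat c i).
Proof. exact: tm_mkE. Qed.

Variable D : W -> C -> C.
Hypotheses (DB : forall s x y, D s (x - y) = D s x - D s y).
Hypotheses (D_scal : forall s k, D s (al_scal k) = 0).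
Hypotheses (DZ : forall s k x, D s (al_scal k * x) = al_scal k * D s x).
Hypotheses (DM : forall s v x, D s (proj (svar v) * x)
  = proj (svar v) * D s x + al_scal (d s v) * act s x).

Lemma coinv_ind (P : C -> Prop) :
  (forall v, P (proj (svar v))) -> (forall k, P (al_scal k)) ->
  (forall x y, P x -> P y -> P (x + y)) ->
  (forall x y, P x -> P y -> P (x * y)) -> forall x, P x.
Proof.
move=> Pv Pk PD PM x; case: (qpi_surj x) => y ->; rewrite -[qpi _ y]/(proj y).
elim/sym_ind: y => [v|k|a b ha hb|a b ha hb].
- exact: Pv.
- by rewrite ah_scal.
- by rewrite ahD; apply: PD.
- by rewrite ahM; apply: PM.
Qed.
Lemma coinv_comm (x y : C) : x * y = y * x.
Proof.
case: (qpi_surj x) (qpi_surj y) => a -> [b ->].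
by rewrite -[qpi _ a]/(proj a) -[qpi _ b]/(proj b) -!(ahM proj) sym_comm.
Qed.

Lemma vX1 b b' : vX (b * b') = vX b * vX b'.
Proof. by apply: fend_eq => c; apply: tm_eq => j; rewrite !vXE mulrA. Qed.
Lemma vXD b b' : vX (b + b') = vX b + vX b'.
Proof. by apply: fend_eq => c; apply: tm_eq => j; rewrite vatD !vXE mulrDl. Qed.
Lemma vX_scal k : vX (al_scal k) = al_scal k.
Proof. by apply: fend_eq => c; apply: tm_eq => j; rewrite vXE tm_atZ. Qed.

Lemma vg1 : vg 1%g = 1.
Proof.
apply: fend_eq => c; apply: tm_eq => j; rewrite vgE rho1 (bigD1 j) // mxE eqxx.
rewrite rmorph1 mul1r wa_act1 big1 /= ?addr0 // => i /negPf ij.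
by rewrite mxE ij rmorph0 mul0r.
Qed.
Lemma vgM w w' : vg (w * w')%g = vg w * vg w'.
Proof.
apply: fend_eq => c; apply: tm_eq => j; rewrite fend_mulE !vgE.
transitivity (\sum_i \sum_k al_scal (rho w k j) *
    (al_scal (rho w' i k) * act w (act w' (vat c i)))).
  apply: eq_bigr => i _; rewrite rhoM mxE rmorph_sum mulr_suml wa_actM.
  by apply: eq_bigr => k _; rewrite rmorphM mulrA -[al_scal (rho w k j) * _]al_central.
rewrite exchange_big; apply: eq_bigr => k _; rewrite vgE ah_sum mulr_sumr.
by apply: eq_bigr => i _; rewrite ahM ah_scal.
Qed.
Lemma vg_vX w b : vg w * vX b = vX (act w b) * vg w.
Proof.
apply: fend_eq => c; apply: tm_eq => j; rewrite !fend_mulE vXE !vgE mulr_sumr.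
by apply: eq_bigr => i _; rewrite vXE ahM !mulrA -(al_central C).
Qed.
Lemma vg_const w x : vg w (vconst x) = vconst (fun j => \sum_i x i * rho w i j).
Proof.
apply: tm_eq => j; rewrite vgE tm_mkE rmorph_sum; apply: eq_bigr => i _.
by rewrite tm_mkE ah_scal -rmorphM mulrC.
Qed.

(** The Dunkl operators at t = 0: no derivative, only a combination of the    *)
(** divided differences, one for each s, composed with the action of s on E.  *)
Definition vY_fun u (c : vmod) : vmod :=
  vmk (fun j => \sum_s al_scal (mu s * d' s u) *
                  \sum_i al_scal (rho s i j) * D s (vat c i)).
Lemma vY_lin u : flinear (vY_fun u).
Proof.
split=> [c c'|k c]; apply: tm_eq => j.
  rewrite tm_atB !tm_mkE -sumrB; apply: eq_bigr => s _; rewrite -mulrBr -sumrB.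
  by congr (_ * _); apply: eq_bigr => i _; rewrite tm_atB DB mulrBr.
rewrite tm_atZ !tm_mkE mulr_sumr; apply: eq_bigr => s _.
rewrite mulrA -(al_central C) -mulrA; congr (_ * _); rewrite mulr_sumr.
by apply: eq_bigr => i _; rewrite tm_atZ DZ !mulrA (al_central C).
Qed.
Definition vY u : fend_alg vmod := FEnd (vY_lin u).
Lemma vYE u c j : vat (vY u c) j = \sum_s al_scal (mu s * d' s u) *
                  \sum_i al_scal (rho s i j) * D s (vat c i).
Proof. exact: tm_mkE. Qed.
Lemma vY_const u x : vY u (vconst x) = 0.
Proof.
apply: tm_eq => j; rewrite vYE vat0 big1 // => s _; rewrite big1 ?mulr0 // => i _.
by rewrite tm_mkE D_scal mulr0.
Qed.
Lemma vY_linear k u v : vY (k *: u + v) = al_scal k * vY u + vY v.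
Proof.
apply: fend_eq => c; apply: tm_eq => j; rewrite fend_addE vatD fend_mulE fend_scalE.
rewrite tm_atZ !vYE mulr_sumr -big_split; apply: eq_bigr => s _ /=.
case: (df' s) => lin _; rewrite lin mulrDr rmorphD mulrDl; congr (_ + _).
by rewrite mulrCA rmorphM mulrA.
Qed.
Notation Xv v := (vX (proj (svar v))).
Lemma vY_vX u v : vY u * Xv v = Xv v * vY u + \sum_s al_scal (kap s u v) * vg s.
Proof.
apply: fend_eq => c; apply: tm_eq => j.
rewrite fend_addE vatD fend_sumE vat_sum !fend_mulE vXE !vYE mulr_sumr -big_split.
apply: eq_bigr => s _; rewrite fend_mulE fend_scalE tm_atZ vgE.
have key (k l : F) (p x y : C) :
    p * (al_scal k * x) + al_scal (k * l) * y = al_scal k * (p * x + al_scal l * y).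
  by rewrite mulrDr !mulrA -rmorphM -(al_central C).
rewrite /= key; congr (_ * _); rewrite !mulr_sumr -big_split; apply: eq_bigr => i _ /=.
have e (k l : F) (p x y : C) :
    al_scal k * (p * x + al_scal l * y) = p * (al_scal k * x) + al_scal l * (al_scal k * y).
  by rewrite mulrDr !mulrA -!rmorphM -(al_central C) mulrC.
by rewrite vXE DM e.
Qed.

(** An operator commuting with the variables is determined by its values on   *)
(** E; this is how identities between Dunkl operators are proved.             *)
Lemma commute_const0 (T : fend_alg vmod) :
  (forall v, T * Xv v = Xv v * T) -> (forall x, T (vconst x) = 0) -> T = 0.
Proof.
move=> TX Tc.
have TXb b : T * vX b = vX b * T.
  elim/coinv_ind: b => [v|k|a b ha hb|a b ha hb].
  - exact: TX.
  - by rewrite vX_scal al_central.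
  - by rewrite vXD mulrDr mulrDl ha hb.
  - by rewrite vX1 mulrA ha -mulrA hb mulrA.
apply: fend_eq => c.
have -> : c = \sum_i vX (vat c i) (vconst (fun j => (j == i)%:R)).
  apply: tm_eq => j; rewrite vat_sum (bigD1 j) //= vXE tm_mkE eqxx rmorph1 mulr1.
  rewrite big1 ?addr0 // => i /negPf ij.
  by rewrite vXE tm_mkE eq_sym ij rmorph0 mulr0.
rewrite fe_sum big1 // => i _.
have e := congr1 (fun f : fend_alg vmod => f (vconst (fun j => (j == i)%:R))) (TXb (vat c i)).
by apply: (etrans e); rewrite -[LHS]/(vX _ (T _)) Tc fe0.
Qed.

Lemma vg_vY w u : vg w * vY u = vY (wr_act w u) * vg w.
Proof.
suff e : vg w * vY u * vg w^-1%g - vY (wr_act w u) = 0.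
  have {}e := subr0_eq e; rewrite -e -[in RHS]mulrA -vgM mulVg vg1 mulr1 //.
apply: commute_const0 => [v|x]; last first.
  by rewrite fend_addE fend_oppE !fend_mulE vg_const !vY_const fe0 subrr.
rewrite mulrBl mulrBr vY_vX opprD addrA -!mulrA.
have -> : vg w^-1%g * Xv v = Xv (wr_act w^-1%g v) * vg w^-1%g.
  rewrite vg_vX; congr (vX _ * _).
  by rewrite -[act]/(quot_act (@coinv_rel_stable F W V)) quot_actE sym_actE.
rewrite [vY u * (_ * _)]mulrA vY_vX mulrDl mulrDr mulrA mulrA vg_vX.
have -> : act w (proj (svar (wr_act w^-1%g v))) = proj (svar v).
  rewrite -[act]/(quot_act (@coinv_rel_stable F W V)) quot_actE sym_actE.
  by rewrite -wr_actM mulgV wr_act1.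
have eS : vg w * ((\sum_s al_scal (kap s u (wr_act w^-1%g v)) * vg s) * vg w^-1%g)
    = \sum_s al_scal (kap s (wr_act w u) v) * vg s.
  rewrite mulr_suml mulr_sumr [RHS](reindex_inj (mulIg w^-1%g)) /=.
  rewrite [RHS](reindex_inj (mulgI w)) /=; apply: eq_bigr => s _.
  rewrite -[in RHS](wr_act1 v) -(mulgV w) wr_actM kap_act.
  by rewrite !vgM !mulrA (al_central (fend_alg vmod)).
by rewrite eS addrAC addrK -!mulrA.
Qed.

Lemma vY_comm u u' : vY u * vY u' = vY u' * vY u.
Proof.
apply: subr0_eq; apply: commute_const0 => [v|x]; last first.
  by rewrite fend_addE fend_oppE !fend_mulE !vY_const !fe0 subrr.
have half a b : vY a * vY b * Xv v = Xv v * (vY a * vY b) +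
    (\sum_s al_scal (kap s a v) * (vg s * vY b) + \sum_s al_scal (kap s b v) * (vY a * vg s)).
  rewrite -mulrA vY_vX mulrDr mulrA vY_vX mulrDl -!mulrA -addrA; congr (_ + (_ + _)).
    by rewrite mulr_suml; apply: eq_bigr => s _; rewrite mulrA.
  rewrite mulr_sumr; apply: eq_bigr => s _.
  by rewrite !mulrA (al_central (fend_alg vmod)).
(* For each s the mixed terms are symmetric in a and b: both sides are
   multiples of d'_s(a) d'_s(b) Y_r s, with r spanning the image of 1 - s. *)
have sym s a b : al_scal (kap s a v) * (vg s * vY b) - al_scal (kap s a v) * (vY b * vg s)
    = al_scal (kap s b v) * (vg s * vY a) - al_scal (kap s b v) * (vY a * vg s).
  case: (df' s) => lin [d0|[r [_ sr]]].
    by rewrite /refl_coef !d0 mulr0 mul0r !rmorph0 !mul0r.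
  have Ys c : vg s * vY c - vY c * vg s = al_scal (- d' s c) * (vY r * vg s).
    rewrite vg_vY -mulrBl mulrA; congr (_ * _).
    have -> : wr_act s c = - d' s c *: r + c by rewrite scaleNr -sr opprB subrK.
    by rewrite vY_linear addrK.
  rewrite -!mulrBr !Ys !mulrA -!rmorphM; congr (al_scal _ * _ * _).
  by rewrite /refl_coef !mulrN; congr (- _); rewrite -!mulrA; congr (_ * _); ring.
have eS : \sum_s al_scal (kap s u v) * (vg s * vY u') + \sum_s al_scal (kap s u' v) * (vY u * vg s)
    = \sum_s al_scal (kap s u' v) * (vg s * vY u) + \sum_s al_scal (kap s u v) * (vY u' * vg s).
  apply: subr0_eq; rewrite [X in _ - X]addrC opprD addrACA -!sumrB -big_split big1 // => s _.
  by rewrite /= sym addrA subrK subrr.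
by rewrite mulrBl mulrBr !half eS opprD addrACA subrr addr0.
Qed.

Lemma dunkl_rels : cherednik_gen kap (fun v => Xv v) vY vg.
Proof.
split.
- by move=> k u v; rewrite svar_linear ahD ahM ah_scal vXD vX1 vX_scal.
- exact: vY_linear.
- by move=> u v; rewrite -!vX1 coinv_comm.
- exact: vY_comm.
- exact: vg1.
- exact: vgM.
- move=> w v; rewrite vg_vX; congr (vX _ * _).
  by rewrite -[act]/(quot_act (@coinv_rel_stable F W V)) quot_actE sym_actE.
- exact: vg_vY.
- exact: vY_vX.
Qed.

(** Subtracting its constant term puts an invariant into the ideal.           *)
Lemma coinv_inv p : sym_inv p -> proj p = al_scal (const_term V p).
Proof.
move=> p_inv; rewrite -(ah_scal proj); apply/qpiE/ideal_gen; split=> [w|].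
  by rewrite ahB p_inv ah_scal.
by rewrite ahB ah_scal subrr.
Qed.

Lemma vX_invariant p : sym_inv p ->
  sym_lift (cg_Xlin dunkl_rels) (cg_XX dunkl_rels) p = al_scal (const_term V p).
Proof.
move=> /coinv_inv p_inv; rewrite -vX_scal -p_inv.
elim/sym_ind: {p_inv} p => [v|k|x y hx hy|x y hx hy].
- by rewrite sym_liftE.
- by rewrite !ah_scal vX_scal.
- by rewrite !ahD hx hy vXD.
- by rewrite !ahM hx hy vX1.
Qed.

(** For q in S(U), the commutator of q(Y) and X_v is                          *)
(** \sum_s mu(s) d_s(v) D'_s(q)(Y) s with D'_s the divided differences on     *)
(** S(U).  When q is invariant these vanish, so q(Y) commutes with the        *)
(** variables; on E it acts by its constant term, hence everywhere.           *)
Lemma vY_invariant q : sym_inv q ->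
  sym_lift (cg_Ylin dunkl_rels) (cg_YY dunkl_rels) q = al_scal (const_term U q).
Proof.
pose pol := sym_lift (cg_Ylin dunkl_rels) (cg_YY dunkl_rels).
have /choice [D' D'P] s := sym_difference natr_neq0 (df' s).
have D'v s := let: And5 h _ _ _ _ := D'P s in h.
have D'B s := let: And5 _ h _ _ _ := D'P s in h.
have D'k s := let: And5 _ _ h _ _ := D'P s in h.
have D'M s := let: And5 _ _ _ h _ := D'P s in h.
have D'i s := let: And5 _ _ _ _ h := D'P s in h.
have D'D s := morphBD (D'B s).
have gpol s x : vg s * pol x = pol (wa_act (sym_walg U) s x) * vg s.
  exact: (@sym_lift_act F W U _ _ _ _ _ vg_vY).
have comm v x : pol x * Xv v = Xv v * pol x +
    \sum_s al_scal (mu s * d s v) * (pol (D' s x) * vg s).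
  elim/sym_ind: x => [u|k|x y hx hy|x y hx hy].
  - rewrite sym_liftE vY_vX; congr (_ + _); apply: eq_bigr => s _.
    rewrite D'v ah_scal mulrA -rmorphM; congr (al_scal _ * _).
    by rewrite /refl_coef; ring.
  - rewrite ah_scal al_central big1 ?addr0 // => s _.
    by rewrite D'k ah0 mul0r mulr0.
  - rewrite ahD mulrDl mulrDr hx hy addrACA -big_split; congr (_ + _).
    by apply: eq_bigr => s _; rewrite D'D ahD mulrDl mulrDr.
  - rewrite ahM -mulrA hy mulrDr mulrA hx mulrDl -mulrA -addrA; congr (_ + _).
    rewrite mulr_suml mulr_sumr -big_split; apply: eq_bigr => s _.
    rewrite D'M ahD !ahM mulrDl mulrDr addrC -!mulrA gpol; congr (_ + _).
    by rewrite !mulrA (al_central (fend_alg vmod)).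
move=> q_inv; apply: subr0_eq; apply: commute_const0 => [v|x].
  rewrite mulrBl mulrBr al_central -/pol comm big1 ?addr0 // => s _.
  by rewrite D'i // ah0 mul0r mulr0.
rewrite fend_addE fend_oppE fend_scalE -/pol; apply/eqP; rewrite subr_eq0; apply/eqP.
elim/sym_ind: {q_inv} q => [u|k|a b ha hb|a b ha hb].
- by rewrite sym_liftE const_term_svar vY_const fsc0r.
- by rewrite !ah_scal.
- by rewrite !ahD fend_addE ha hb fscDl.
- by rewrite !ahM fend_mulE hb feZ ha fscA mulrC.
Qed.
End Dunkl.

(** All divided differences exist, so coinv(V) (x) E carries Dunkl operators. *)
Lemma dunkl_representation (F : fieldType) (W : finGroupType) (V U : wrep F W)
    (mu : W -> F) (d : W -> V -> F) (d' : W -> U -> F) n (rho : W -> 'M[F]_n)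
    (vmod : tuple_module (coinv_walg V) n) :
  (forall p, p.+1%:R != 0 :> F) ->
  (forall s, reflection_form s (d s)) -> (forall s, reflection_form s (d' s)) ->
  (forall w s u v, refl_coef mu d d' (w * s * w^-1)%g (wr_act w u) (wr_act w v)
                   = refl_coef mu d d' s u v) ->
  rho 1%g = 1%:M -> (forall w w', rho (w * w')%g = rho w' *m rho w) ->
  exists Y : U -> fend_alg vmod,
  exists R : cherednik_gen (refl_coef mu d d')
      (fun v => vX vmod (quot_proj (@coinv_rel F W V) (svar v))) Y (vg rho vmod),
  [/\ forall u x, Y u (vconst vmod x) = 0,
      forall p, sym_inv p -> sym_lift (cg_Xlin R) (cg_XX R) p = al_scal (const_term V p)
    & forall q, sym_inv q -> sym_lift (cg_Ylin R) (cg_YY R) q = al_scal (const_term U q)].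
Proof.
move=> char0 df df' kact rho1 rhoM.
have /choice [D DP] s := coinv_difference char0 (df s).
have DB s := let: And4 h _ _ _ := DP s in h.
have Dk s := let: And4 _ h _ _ := DP s in h.
have DZ s := let: And4 _ _ h _ := DP s in h.
have DM s := let: And4 _ _ _ h := DP s in h.
exists (vY mu d' rho vmod DB DZ).
exists (@dunkl_rels _ _ _ _ _ _ _ df' kact _ _ rho1 rhoM vmod D DB Dk DZ DM).
split.
- by move=> u x; apply: vY_const.
- by move=> p; apply: vX_invariant.
- by move=> q; apply: vY_invariant.
Qed.

(** * Coinvariant algebras *)

Lemma prod_XsubC_Xn (R : comNzRingType) (I : finType) (x : I -> R) (i : I) n :
  \prod_i ('X - (x i)%:P) = 'X^n -> x i ^+ n = 0.
Proof.
move=> e; rewrite -hornerXn -e horner_prod (bigD1 i) //= hornerXsubC.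
by rewrite subrr mul0r.
Qed.

Section Coinvariants.
Variables (F : fieldType) (W : finGroupType) (V : wrep F W).
Hypothesis natr_neq0 : forall n, n.+1%:R != 0 :> F.
Notation S := (sym_walg V).
Notation C := (coinv_walg V).
Notation proj := (quot_proj (@coinv_rel F W V)).
Notation cvar v := (proj (svar v)).

Lemma coinv_actE w p : wa_act C w (proj p) = proj (wa_act S w p).
Proof. by rewrite -[wa_act C w]/(quot_act (@coinv_rel_stable F W V) w) quot_actE. Qed.
Lemma coinv_act_var w v : wa_act C w (cvar v) = cvar (wr_act w v).
Proof. by rewrite coinv_actE sym_actE. Qed.
Lemma coinv_surj (x : C) : exists p, x = proj p.
Proof. by case: (qpi_surj x) => p ->; exists p. Qed.

(** The coinvariant algebra has no invariants but the scalars: average a      *)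
(** representative over W.                                                    *)
Lemma coinv_fixed (x : C) :
  (forall w, wa_act C w x = x) -> x = al_scal (coinv_const V x).
Proof.
case: (coinv_surj x) => p -> pw; rewrite coinv_constE.
pose a := \sum_w wa_act S w p.
have a_inv : sym_inv a.
  move=> w; rewrite ah_sum [RHS](reindex_inj (mulgI w)).
  by apply: eq_bigr => v _; rewrite wa_actM.
have aE : proj a = #|W|%:R * proj p.
  rewrite ah_sum (eq_bigr (fun=> proj p)) => [|w _]; last by rewrite -coinv_actE pw.
  by rewrite sumr_const mulr_natl.
have ac : const_term V a = #|W|%:R * const_term V p.
  rewrite ah_sum (eq_bigr (fun=> const_term V p)) => [|w _]; last exact: const_term_act.
  by rewrite sumr_const mulr_natl.
have := coinv_inv a_inv; rewrite aE ac rmorphM rmorph_nat => e.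
have W0 : #|W|%:R != 0 :> F.
  by have /card_gt0P : exists w : W, w \in W; [exists 1%g|case: #|W|].
rewrite -[LHS]mul1r -[RHS]mul1r -(rmorph1 (@al_scal _ C)) -(mulVf W0) rmorphM rmorph_nat.
by rewrite -!mulrA e.
Qed.

(** In the commutative ring coinv(V), the polynomial \prod_w (T - w v) has    *)
(** invariant coefficients, so it is T^|W|, and v is a root.                  *)
Definition ccoinv : Type := C.
HB.instance Definition _ := GRing.PzRing.on ccoinv.
HB.instance Definition _ := GRing.PzRing_hasCommutativeMul.Build ccoinv (@coinv_comm _ _ V).
Lemma ccoinv_neq0 : (1 : ccoinv) != 0.
Proof.
apply/eqP => /(congr1 (coinv_const V)); rewrite (ah1 (coinv_const V)) (ah0 (coinv_const V)).
by apply/eqP; apply: oner_neq0.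
Qed.
HB.instance Definition _ := GRing.PzSemiRing_isNonZero.Build ccoinv ccoinv_neq0.

Lemma coinv_nilpotent v : (cvar v : ccoinv) ^+ #|W| = 0.
Proof.
pose f w (x : ccoinv) : ccoinv := wa_act C w x.
have f_add w : zmod_morphism (f w) by move=> x y; apply: (ahB (wa_act C w)).
have f_mon w : monoid_morphism (f w).
  by split=> [|x y]; [apply: (ah1 (wa_act C w)) | apply: (ahM (wa_act C w))].
pose fm w : {rmorphism ccoinv -> ccoinv} :=
  HB.pack (f w) (GRing.isZmodMorphism.Build _ _ _ (f_add w))
    (GRing.isMonoidMorphism.Build _ _ _ (f_mon w)).
pose c (x : ccoinv) : F := coinv_const V x.
have c_add : zmod_morphism c by move=> x y; apply: (ahB (coinv_const V)).
have c_mon : monoid_morphism c.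
  by split=> [|x y]; [apply: (ah1 (coinv_const V)) | apply: (ahM (coinv_const V))].
pose cm : {rmorphism ccoinv -> F} :=
  HB.pack c (GRing.isZmodMorphism.Build _ _ _ c_add)
    (GRing.isMonoidMorphism.Build _ _ _ c_mon).
pose x : ccoinv := cvar v.
pose P : {poly ccoinv} := \prod_(w : W) ('X - (f w x)%:P).
have Pf w : map_poly (fm w) P = P.
  rewrite rmorph_prod [RHS](reindex_inj (mulgI w)); apply: eq_bigr => u _.
  apply: (etrans (map_polyXsubC (fm w) _)); congr ('X - _%:P).
  exact: esym (wa_actM w u (x : C)).
have Pc : map_poly cm P = 'X^#|W|.
  rewrite rmorph_prod (eq_bigr (fun=> 'X)) ?prodr_const ?cardT // => u _.
  apply: (etrans (map_polyXsubC cm _)).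
  have -> : cm (f u x) = 0.
    rewrite -[cm _]/(coinv_const V (wa_act C u (cvar v))) coinv_act_var coinv_constE.
    exact: const_term_svar.
  by rewrite polyC0 subr0.
have PX : P = 'X^#|W|.
  apply/polyP => i.
  have -> : P`_i = al_scal (coinv_const V P`_i) :> C.
    apply: coinv_fixed => w; rewrite -[wa_act C w _]/(fm w P`_i).
    by rewrite -coef_map Pf.
  rewrite -[coinv_const V _]/(cm P`_i) -coef_map Pc !coefXn.
  by rewrite -[al_scal _]/((@al_scal F C : {rmorphism F -> C}) _) rmorph_nat.
have f1 : f 1%g x = x := @wa_act1 F W C (cvar v).
by have := @prod_XsubC_Xn ccoinv W (f^~ x) 1%g _ PX; rewrite /= f1.
Qed.

Inductive mono : nat -> C -> Prop :=
| mono0 : mono 0 1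
| monoS n v x of mono n x : mono n.+1 (cvar v * x).

Inductive lspan (s : seq C) : C -> Prop :=
| ls_mem x of x \in s : lspan s x
| ls_0 : lspan s 0
| ls_D x y of lspan s x & lspan s y : lspan s (x + y)
| ls_Z k x of lspan s x : lspan s (al_scal k * x).

Lemma coinv_mulCA (x y z : C) : x * (y * z) = y * (x * z).
Proof. by rewrite mulrA [x * y]coinv_comm mulrA. Qed.

(** Variables being nilpotent, finitely many monomials in vs suffice to span  *)
(** the subalgebra that they generate.                                        *)
Lemma mono_span (vs : seq V) : exists s : seq C, [/\ forall x, x \in s -> exists n, mono n x,
  lspan s 1 & forall v, v \in vs -> forall z, lspan s z -> lspan s (cvar v * z)].
Proof.
elim: vs => [|v vs [s [sm s1 sv]]].
  exists [:: 1]; split=> // [x|]; last by apply: ls_mem; rewrite inE.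
  by rewrite inE => /eqP ->; exists 0%N; apply: mono0.
pose t := [seq (cvar v : C) ^+ k * x | k <- iota 0 #|W|, x <- s].
have W0 : (0 < #|W|)%N by apply/card_gt0P; exists 1%g.
have tk k z : (k < #|W|)%N -> lspan s z -> lspan t ((cvar v : C) ^+ k * z).
  move=> kW; elim=> {z} [x xs||x y _ hx _ hy|l x _ hx].
  - by apply/ls_mem/allpairs_f => //; rewrite mem_iota.
  - by rewrite mulr0; apply: ls_0.
  - by rewrite mulrDr; apply: ls_D.
  - by rewrite coinv_mulCA; apply: ls_Z.
exists t; split.
- move=> _ /allpairsP [[k x] [/= _ /sm [n xn] ->]].
  elim: k => [|k [m IH]]; first by exists n; rewrite expr0 mul1r.
  by exists m.+1; rewrite exprS -mulrA; apply: monoS.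
- by rewrite -[1]mul1r -[X in X * _](expr0 (cvar v : C)); apply: tk.
- move=> u uv z; elim=> {z} [_ /allpairsP [[k x] [/= + xs ->]]||x y _ hx _ hy|l x _ hx].
  + rewrite mem_iota add0n => /andP [_ kW]; move: uv; rewrite inE => /orP [/eqP ->|uv].
      rewrite mulrA -exprS; have [kW'|Wk] := ltnP k.+1 #|W|.
        by apply: tk => //; apply: ls_mem.
      have -> : k.+1 = #|W| by apply/eqP; rewrite eqn_leq kW Wk.
      have -> : (cvar v : C) ^+ #|W| = 0 by apply: coinv_nilpotent.
      by rewrite mul0r; apply: ls_0.
    by rewrite coinv_mulCA; apply: tk => //; apply: sv => //; apply: ls_mem.
  + by rewrite mulr0; apply: ls_0.
  + by rewrite mulrDr; apply: ls_D.
  + by rewrite coinv_mulCA; apply: ls_Z.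
Qed.

Lemma coinv_basis (m : nat) (e : 'I_m -> V) :
  (forall v, exists c : 'I_m -> F, v = \sum_i c i *: e i) ->
  exists n (b : 'I_n -> C) (dg : 'I_n -> nat), [/\ forall k, mono (dg k) (b k),
    forall x, exists c : 'I_n -> F, x = \sum_k al_scal (c k) * b k
    & forall c : 'I_n -> F, \sum_k al_scal (c k) * b k = 0 -> forall k, c k = 0].
Proof.
move=> se; have [s [sm s1 sv]] := mono_span (codom e).
have svv v z : lspan s z -> lspan s (cvar v * z).
  move=> sz; have [c ->] := se v.
  have -> : cvar (\sum_i c i *: e i) = \sum_i al_scal (c i) * cvar (e i).
    have h : {morph (fun u : V => cvar u) : x y / x + y >-> x + y}.
      by move=> x y; rewrite svarD ahD.
    have h0 : cvar (0 : V) = 0 by rewrite -(scale0r (0 : V)) svarZ rmorph0 mul0r ah0.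
    rewrite (big_morph _ h h0); apply: eq_bigr => i _.
    by rewrite svarZ ahM ah_scal.
  rewrite mulr_suml; elim/big_ind: _ => [||i _]; [exact: ls_0|exact: ls_D|].
  by rewrite -mulrA; apply/ls_Z/sv => //; apply: codom_f.
have all x : lspan s x.
  suff h z : lspan s z -> lspan s (x * z) by rewrite -[x]mulr1; apply: h.
  elim/coinv_ind: x z => [v|k|x y hx hy|x y hx hy] z sz.
  - exact: svv.
  - exact: ls_Z.
  - by rewrite mulrDl; apply: ls_D; [apply: hx | apply: hy].
  - by rewrite -mulrA; apply/hx/hy.
(* As 1-tuples the coinvariants form a vector space, where bases exist. *)
have T := tuple_module_ex C 1.
pose g (i : 'I_(size s)) : T := tm_mk T (fun=> s`_i).
have atE (I : finType) (b : I -> T) c j : tm_at (comb b c) j = \sum_i al_scal (c i) * tm_at (b i) j.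
  by rewrite vat_sum; apply: eq_bigr => i _; rewrite tm_atZ.
have sg : spans g.
  move=> x; suff [c xc] : exists c : 'I_(size s) -> F, tm_at x ord0 = \sum_i al_scal (c i) * s`_i.
    exists c; apply: tm_eq => j; rewrite atE [j]ord1 xc; apply: eq_bigr => i _.
    by rewrite tm_mkE.
  elim: (all (tm_at x ord0)) => {x} [x xs||x y _ [c ->] _ [c' ->]|k x _ [c ->]].
  - have xi : (index x s < size s)%N by rewrite index_mem.
    exists (fun i => (i == Ordinal xi)%:R); rewrite (bigD1 (Ordinal xi)) //= eqxx rmorph1.
    rewrite mul1r nth_index // big1 ?addr0 // => i /negPf ->.
    by rewrite rmorph0 mul0r.
  - by exists (fun=> 0); rewrite big1 // => i _; rewrite rmorph0 mul0r.
  - exists (fun i => c i + c' i); rewrite -big_split; apply: eq_bigr => i _.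
    by rewrite rmorphD mulrDl.
  - exists (fun i => k * c i); rewrite mulr_sumr; apply: eq_bigr => i _.
    by rewrite rmorphM mulrA.
have [n [f [sf ff]]] := spans_basis sg.
have /choice [dg dgE] k : exists n, mono n (s`_(f k)) by apply/sm/mem_nth.
exists n, (fun k => s`_(f k)), dg; split=> // [x|c c0].
  have [c xc] := sf (tm_mk T (fun=> x)); exists c.
  have := congr1 (fun t => tm_at t ord0) xc; rewrite tm_mkE atE => ->.
  by apply: eq_bigr => i _; rewrite /= tm_mkE.
apply: (ff c); apply: tm_eq => j; rewrite atE vat0 -[RHS]c0; apply: eq_bigr => i _.
by rewrite /= tm_mkE.
Qed.
End Coinvariants.

Lemma coinv_inv0 (F : fieldType) (W : finGroupType) (V : wrep F W) p :
  @coinv_rel F W V p -> quot_proj (@coinv_rel F W V) p = 0.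
Proof. by move=> [pi pc]; rewrite coinv_inv // pc rmorph0. Qed.

Section Scaling.
Variables (F : fieldType) (W : finGroupType) (V : wrep F W) (q : F).
Notation S := (sym_walg V).
Notation C := (coinv_walg V).
Notation proj := (quot_proj (@coinv_rel F W V)).
Notation cvar v := (proj (svar v)).

Lemma sym_scale_subproof k (u v : V) :
  svar (q *: (k *: u + v)) = al_scal k * svar (q *: u) + svar (q *: v) :> S.
Proof.
by rewrite scalerDr scalerA mulrC -scalerA svarD svarZ.
Qed.
Lemma sym_scale_comm (u v : V) : svar (q *: u) * svar (q *: v)
  = svar (q *: v) * svar (q *: u) :> S.
Proof. exact: sym_comm. Qed.
Definition sym_scale : algHom S S := sym_lift sym_scale_subproof sym_scale_comm.
Lemma sym_scale_svar v : sym_scale (svar v) = al_scal q * svar v.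
Proof. by rewrite sym_liftE svarZ. Qed.
Lemma sym_scale_act w p : sym_scale (wa_act S w p) = wa_act S w (sym_scale p).
Proof.
elim/sym_ind: p => [v|k|x y hx hy|x y hx hy].
- by rewrite sym_actE !sym_scale_svar ahM ah_scal sym_actE.
- by rewrite !ah_scal.
- by rewrite !ahD hx hy.
- by rewrite !ahM hx hy.
Qed.
Lemma sym_scale_const p : const_term V (sym_scale p) = const_term V p.
Proof.
elim/sym_ind: p => [v|k|x y hx hy|x y hx hy].
- by rewrite sym_scale_svar ahM !const_term_svar mulr0.
- by rewrite !ah_scal.
- by rewrite !ahD hx hy.
- by rewrite !ahM hx hy.
Qed.
Lemma sym_scale_inv p : sym_inv p -> sym_inv (sym_scale p).
Proof. by move=> pi w; rewrite -sym_scale_act pi. Qed.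

Lemma coinv_scale_kills p : coinv_rel p -> ah_comp proj sym_scale p = 0.
Proof.
move=> [pi pc]; apply: coinv_inv0; split; first exact: sym_scale_inv.
by rewrite sym_scale_const.
Qed.
Definition coinv_scale : algHom C C := quot_lift coinv_scale_kills.
Lemma coinv_scale_var v : coinv_scale (cvar v) = al_scal q * cvar v.
Proof.
by rewrite /coinv_scale quot_liftE -[LHS]/(proj (sym_scale _)) sym_scale_svar ahM ah_scal.
Qed.
Lemma coinv_scale_act w x : coinv_scale (wa_act C w x) = wa_act C w (coinv_scale x).
Proof.
elim/coinv_ind: x => [v|k|x y hx hy|x y hx hy].
- by rewrite coinv_act_var !coinv_scale_var ahM ah_scal coinv_act_var.
- by rewrite !ah_scal.
- by rewrite !ahD hx hy.
- by rewrite !ahM hx hy.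
Qed.
Lemma coinv_scale_mono n x : mono n x -> coinv_scale x = al_scal (q ^+ n) * x.
Proof.
elim=> {n x} [|n v x _ IH]; first by rewrite ah1 rmorph1 mul1r.
rewrite ahM coinv_scale_var IH exprS rmorphM -!mulrA; congr (_ * _).
by rewrite !mulrA al_central.
Qed.
End Scaling.

Section CoinvMatrix.
Variables (F : fieldType) (W : finGroupType) (V : wrep F W).
Hypothesis natr_neq0 : forall n, n.+1%:R != 0 :> F.
Notation C := (coinv_walg V).
Variables (n : nat) (b : 'I_n -> C) (dg : 'I_n -> nat) (beta : W -> 'M[F]_n).
Hypotheses (bm : forall k, mono (dg k) (b k)).
Hypotheses (bf : forall c : 'I_n -> F, \sum_k al_scal (c k) * b k = 0 -> forall k, c k = 0).
Hypotheses (betaE : forall w k, wa_act C w (b k) = \sum_l al_scal (beta w k l) * b l).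
Hypothesis pow2 : forall i j, (2%:R : F) ^+ i = 2%:R ^+ j -> i = j.

Lemma bf_eq (c c' : 'I_n -> F) :
  \sum_k al_scal (c k) * b k = \sum_k al_scal (c' k) * b k -> c =1 c'.
Proof.
move=> e k; apply/eqP; rewrite -subr_eq0; apply/eqP.
apply: (bf (c := fun k => c k - c' k)).
under eq_bigr => i _ do rewrite rmorphB mulrBl.
by rewrite sumrB e subrr.
Qed.
Lemma coinv_matrix1 : beta 1%g = 1%:M.
Proof.
apply/matrixP => k; apply: bf_eq; rewrite -betaE wa_act1 (bigD1 k) //= mxE eqxx.
rewrite rmorph1 mul1r big1 ?addr0 // => l /negPf lk.
by rewrite mxE eq_sym lk rmorph0 mul0r.
Qed.
Lemma coinv_matrixM w w' : beta (w * w')%g = beta w' *m beta w.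
Proof.
apply/matrixP => k; apply: bf_eq; rewrite -betaE wa_actM betaE ah_sum.
under eq_bigr => l _ do rewrite ahM ah_scal betaE mulr_sumr.
rewrite exchange_big; apply: eq_bigr => m _; rewrite mxE rmorph_sum mulr_suml.
by apply: eq_bigr => l _; rewrite mulrA -rmorphM.
Qed.
(** The automorphism multiplying the variables by 2 commutes with W, and its  *)
(** eigenvalues 2^dg separate the degrees.                                    *)
Lemma coinv_matrix_block w k l : dg k != dg l -> beta w k l = 0.
Proof.
move=> kl; have e := coinv_scale_act 2%:R w (b k).
have := @bf_eq (fun l => 2%:R ^+ dg k * beta w k l) (fun l => 2%:R ^+ dg l * beta w k l).
move=> /(_ _)/(_ l) h; apply/eqP; move/negPf: kl => kl.
have : 2%:R ^+ dg k * beta w k l = 2%:R ^+ dg l * beta w k l.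
  apply: h.
  transitivity (wa_act C w (coinv_scale V 2%:R (b k))).
    rewrite (coinv_scale_mono _ (bm k)) ahM ah_scal betaE mulr_sumr.
    by apply: eq_bigr => i _; rewrite rmorphM mulrA.
  rewrite -e betaE ah_sum; apply: eq_bigr => i _.
  by rewrite ahM ah_scal (coinv_scale_mono _ (bm i)) mulrA -rmorphM mulrC [_ * beta _ _ _]mulrC.
move/eqP; rewrite -subr_eq0 -mulrBl mulf_eq0 subr_eq0 => /orP [/eqP /pow2 /eqP|//].
by rewrite kl.
Qed.
End CoinvMatrix.

(** * Complex conjugation *)

Section Conjugate.
Variables (K : numClosedFieldType) (B : algebra K).
Definition conj_scal (k : K) : B := al_scal k^*.
Lemma conj_scal_additive : zmod_morphism conj_scal.
Proof. by move=> k l; rewrite /conj_scal !rmorphB. Qed.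
Lemma conj_scal_monoid : monoid_morphism conj_scal.
Proof. by split=> [|k l]; rewrite /conj_scal ?rmorph1 ?rmorphM ?rmorph1. Qed.
HB.instance Definition _ := GRing.isZmodMorphism.Build K B conj_scal conj_scal_additive.
HB.instance Definition _ := GRing.isMonoidMorphism.Build K B conj_scal conj_scal_monoid.
Lemma conj_central k (x : B) : conj_scal k * x = x * conj_scal k.
Proof. exact: al_central. Qed.
Definition conj_alg : algebra K := Algebra conj_central.
End Conjugate.

(** A conjugate-linear W-map extends to coinvariants, by the universal        *)
(** property with the scalars acting through conjugation.                     *)
Lemma coinv_conj (K : numClosedFieldType) (W : finGroupType) (V V' : wrep K W)
    (J : V -> V') :
  (forall k u v, J (k *: u + v) = k^* *: J u + J v) ->
  (forall w v, J (wr_act w v) = wr_act w (J v)) ->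
  exists h : coinv_walg V -> coinv_walg V',
  [/\ forall x y, h (x + y) = h x + h y, forall x y, h (x * y) = h x * h y,
      forall k, h (al_scal k) = al_scal k^*,
      forall v, h (quot_proj (@coinv_rel K W V) (svar v))
                = quot_proj (@coinv_rel K W V') (svar (J v))
    & forall w x, h (wa_act (coinv_walg V) w x) = wa_act (coinv_walg V') w (h x)].
Proof.
move=> J_lin J_act.
pose C' := coinv_walg V'; pose pr := quot_proj (@coinv_rel K W V').
pose e (v : V) : conj_alg C' := pr (svar (J v)).
have e_lin k u v : e (k *: u + v) = al_scal k * e u + e v.
  by rewrite /e J_lin svar_linear ahD ahM ah_scal.
have e_comm u v : e u * e v = e v * e u by apply: (@coinv_comm K W V').
pose f := sym_lift e_lin e_comm.
have fv v : f (svar v) = pr (svar (J v)) by rewrite sym_liftE.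
have f_act w p : f (wa_act (sym_walg V) w p) = wa_act C' w (f p).
  elim/sym_ind: p => [v|k|x y hx hy|x y hx hy].
  - by rewrite sym_actE !fv J_act coinv_act_var.
  - by rewrite !ah_scal.
  - by rewrite !ahD hx hy.
  - by rewrite !ahM hx hy.
have f_const p : coinv_const V' (f p) = (const_term V p)^*.
  elim/sym_ind: p => [v|k|x y hx hy|x y hx hy].
  - by rewrite fv coinv_constE !const_term_svar rmorph0.
  - by rewrite !ah_scal.
  - by rewrite !ahD rmorphD hx hy.
  - by rewrite !ahM rmorphM hx hy.
have char0 n : n.+1%:R != 0 :> K by rewrite pnatr_eq0.
have f_kills p : coinv_rel p -> f p = 0.
  move=> [pi pc]; have fi w : wa_act C' w (f p) = f p by rewrite -f_act pi.
  by rewrite (coinv_fixed char0 fi) f_const pc rmorph0 rmorph0.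
pose h := quot_lift f_kills.
exists h; split.
- exact: (ahD h).
- exact: (ahM h).
- by move=> k; apply: (ah_scal h k).
- by move=> v; rewrite /h quot_liftE fv.
- move=> w x; have [p ->] := coinv_surj x.
  rewrite coinv_actE; apply: (etrans (quot_liftE f_kills _)).
  by rewrite f_act; congr (wa_act C' w _); apply/esym/(quot_liftE f_kills p).
Qed.

(** An invariant hermitian form identifies h with h^*, conjugate-linearly.     *)
Section HermitianDual.
Import VectorInternalTheory.
Variables (K : numClosedFieldType) (W : finGroupType) (h : frep K W).
Notation h' := (dual_frep h).

Definition herm (z y : h) : K :=
  \sum_w \sum_i v2r (fr_act h w z) 0 i * (v2r (fr_act h w y) 0 i)^*.
Lemma herm_linear y : linear (fun z => herm z y : K^o).
Proof.
move=> k u v; rewrite /herm scaler_sumr -big_split; apply: eq_bigr => w _ /=.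
rewrite scaler_sumr -big_split; apply: eq_bigr => i _ /=.
by rewrite !linearP !mxE mulrDl -mulrA.
Qed.
Definition herm_lin y : {linear h -> K^o} :=
  HB.pack (fun z => herm z y : K^o) (GRing.isLinear.Build K h K^o *:%R _ (herm_linear y)).
Definition herm_dual (y : h) : h' := linfun (herm_lin y).
Lemma herm_dualE y z : (herm_dual y : dual_sp h) z = herm z y.
Proof. by rewrite lfunE. Qed.

Lemma herm_conjlinear z k u v : herm z (k *: u + v) = k^* * herm z u + herm z v.
Proof.
rewrite /herm mulr_sumr -big_split; apply: eq_bigr => w _ /=.
rewrite mulr_sumr -big_split; apply: eq_bigr => i _ /=.
by rewrite !linearP !mxE rmorphD rmorphM mulrDr mulrCA.
Qed.
Lemma herm_dual_conjlinear k u v : herm_dual (k *: u + v) = k^* *: herm_dual u + herm_dual v.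
Proof.
apply/lfunP => z; rewrite herm_dualE herm_conjlinear.
by rewrite [RHS]add_lfunE [in RHS]scale_lfunE !herm_dualE.
Qed.
Lemma herm_dual_act w v : herm_dual (@wr_act K W h w v) = @wr_act K W h' w (herm_dual v).
Proof.
apply/lfunP => z; rewrite herm_dualE [RHS]dual_actE herm_dualE /herm.
rewrite [LHS](reindex_inj (mulIg w^-1%g)); apply: eq_bigr => u _.
by rewrite -[wr_act w v]/(fr_act h w v) -fr_wactM mulgKV fr_actM comp_lfunE.
Qed.
Lemma herm_dual_inj : injective herm_dual.
Proof.
have inj0 y : herm_dual y = 0 -> y = 0.
  move=> /(congr1 (fun f : 'Hom(h, K^o) => f y)); rewrite herm_dualE zero_lfunE => /eqP.
  rewrite psumr_eq0 => [/allP /(_ 1%g (mem_index_enum _))|w _]; last first.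
    by apply: sumr_ge0 => i _; apply: mul_conjC_ge0.
  rewrite fr_act1 id_lfunE psumr_eq0 => [/allP e|i _]; last exact: mul_conjC_ge0.
  rewrite -[y]v2rK; have -> : v2r y = 0.
    by apply/rowP => i; rewrite mxE; apply/eqP; rewrite -mul_conjC_eq0; apply: (implyP (e i (mem_index_enum i))).
  exact: linear0.
move=> u v e; apply/eqP; rewrite -subr_eq0; apply/eqP/inj0.
by rewrite addrC -scaleN1r herm_dual_conjlinear rmorphN rmorph1 scaleN1r e addNr.
Qed.

Lemma herm_dual_surj x : exists y, herm_dual y = x.
Proof.
(* The composite with coordinatewise conjugation is linear, so injectivity
   implies surjectivity by dimension. *)
pose cj (y : h) : h := r2v (map_mx Num.conj (v2r y)).
have cjK y : cj (cj y) = y.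
  rewrite /cj r2vK -[RHS]v2rK; congr r2v; apply/rowP => i.
  by rewrite !mxE conjCK.
have cj_lin k u v : cj (k *: u + v) = k^* *: cj u + cj v.
  by rewrite /cj linearP map_mxD map_mxZ linearP.
have L_lin : linear (fun y => herm_dual (cj y) : 'Hom(h, K^o)).
  by move=> k u v; rewrite cj_lin herm_dual_conjlinear conjCK.
pose L : {linear h -> 'Hom(h, K^o)} :=
  HB.pack (fun y => herm_dual (cj y) : 'Hom(h, K^o)) (GRing.isLinear.Build K _ _ *:%R _ L_lin).
pose l := linfun L.
have l0 : lker l == 0%VS.
  apply/lker0P => u v; rewrite !lfunE => /herm_dual_inj e.
  by rewrite -[u]cjK e cjK.
have lf : limg l = fullv.
  apply/eqP; rewrite eqEdim subvf /= limg_dim_eq ?(eqP l0) ?capv0 //.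
  by rewrite !dimvf /dim /= muln1.
have : x \in limg l by rewrite lf memvf.
by move=> /memv_imgP [y _ ->]; exists (cj y); rewrite lfunE.
Qed.

Lemma herm_dual_inverse : exists J' : h' -> h,
  [/\ forall k u v, J' (k *: u + v) = k^* *: J' u + J' v,
      forall w x, J' (@wr_act K W h' w x) = @wr_act K W h w (J' x),
      cancel herm_dual J' & cancel J' herm_dual].
Proof.
have /choice [J' J'K] := herm_dual_surj.
exists J'; split=> // [k u v|w x|y]; apply: herm_dual_inj; rewrite J'K //.
  by rewrite herm_dual_conjlinear !J'K conjCK.
by rewrite herm_dual_act J'K.
Qed.
End HermitianDual.

(** * Induced modules *)

Section InducedTheory.
Variables (F : fieldType) (B : algebra F) (A : gralg F) (phi : algHom B A).
Variable N : lmodType B.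
Notation ind_sp := (@ind_sp F B A phi N).
Notation tens := (@tens F B A phi N).

Lemma tens_addl a a' n : tens (a + a') n = tens a n + tens a' n.
Proof.
apply/eqP; rewrite -subr_eq0 opprD addrA; apply/eqP.
rewrite -!ipiB; apply: (etrans _ (raddf0 (\pi_{ideal_quot (@tensor_pred F B A phi N)}))).
by apply/ipiE; rewrite subr0; apply: tr_addl.
Qed.
Lemma tens_addr a n n' : tens a (n + n') = tens a n + tens a n'.
Proof.
apply/eqP; rewrite -subr_eq0 opprD addrA; apply/eqP.
rewrite -!ipiB; apply: (etrans _ (raddf0 (\pi_{ideal_quot (@tensor_pred F B A phi N)}))).
by apply/ipiE; rewrite subr0; apply: tr_addr.
Qed.
Lemma tens_bal a b n : tens (a * phi b) n = tens a (b *: n).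
Proof. by apply/ipiE; apply: tr_bal. Qed.
Lemma tens0l n : tens 0 n = 0.
Proof.
have := tens_addl 0 0 n; rewrite addr0 => /eqP.
by rewrite -subr_eq subrr => /eqP.
Qed.
Lemma tens0r a : tens a 0 = 0.
Proof.
have := tens_addr a 0 0; rewrite addr0 => /eqP.
by rewrite -subr_eq subrr => /eqP.
Qed.
Lemma tensNr a n : tens a (- n) = - tens a n.
Proof.
by apply/eqP; rewrite -subr_eq0 opprK -tens_addr addNr tens0r.
Qed.
Lemma tensNl a n : tens (- a) n = - tens a n.
Proof.
by apply/eqP; rewrite -subr_eq0 opprK -tens_addl addNr tens0l.
Qed.
Lemma scale_tens a b n : a *: tens b n = tens (a * b) n.
Proof. by rewrite -[LHS]/(ind_scale a (ipi phi _)) ind_scaleE fact_pair. Qed.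
Lemma tensE a n : tens a n = a *: tens 1 n.
Proof. by rewrite scale_tens mulr1. Qed.
Lemma tens_scal k a n : tens a (k *! n) = k *! tens a n.
Proof. by rewrite -tens_bal scale_tens ah_scal al_central. Qed.

Lemma ind_sp_ind (P : ind_sp -> Prop) :
  (forall a n, P (tens a n)) -> P 0 -> (forall x y, P x -> P y -> P (x - y)) ->
  forall x, P x.
Proof.
move=> Pt P0 PB x; case: (ipi_surj x) => y ->.
elim/free_ind: y => [a n||y z hy hz]; first exact: Pt.
  by rewrite -[ipi _ _]/(\pi_{ideal_quot (@tensor_pred F B A phi N)} 0) raddf0.
by rewrite ipiB; apply: PB.
Qed.

Lemma tens_lift_ex (Z : zmodType) (G : A -> N -> Z) :
  (forall a a' n, G (a + a') n = G a n + G a' n) ->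
  (forall a n n', G a (n + n') = G a n + G a n') ->
  (forall a b n, G (a * phi b) n = G a (b *: n)) ->
  exists T : ind_sp -> Z, (forall x y, T (x - y) = T x - T y) /\
    forall a n, T (tens a n) = G a n.
Proof.
move=> Gl Gr Gb.
pose L (x : free_AN A N) : Z := fglift (fun p : A * N => G p.1 p.2 : zmodule Z) x.
have LB x y : L (x - y) = L x - L y by apply: (@lift_is_additive _ _ (zmodule Z)).
have L0 := morphB0 LB.
have Lp a n : L (fpair a n) = G a n by rewrite /L liftU scale1r.
have Lrel x : tensor_rel phi x -> L x = 0.
  elim=> {x} [a a' n|a n n'|a b n||x y _ hx _ hy].
  - by rewrite !LB !Lp Gl -addrA -opprD subrr.
  - by rewrite !LB !Lp Gr -addrA -opprD subrr.
  - by rewrite LB !Lp Gb subrr.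
  - exact: L0.
  - by rewrite LB hx hy subrr.
pose T (q : ind_sp) : Z := L (repr q).
have TE x : T (ipi phi x) = L x.
  by apply/eqP; rewrite -subr_eq0 -LB; apply/eqP/Lrel/repr_ipi.
exists T; split=> [x y|a n]; last by rewrite TE Lp.
by case: (ipi_surj x) (ipi_surj y) => u -> [v ->]; rewrite -ipiB !TE LB.
Qed.
End InducedTheory.

(** Directness of the sum of the components: these consist of eigenvectors of *)
(** Phi for distinct eigenvalues.                                             *)
Lemma graded_by_euler (F : fieldType) (A : gralg F) (M : grmod A)
    (I : finType) (e : I -> M) (d : I -> int) (ev : int -> F) (Phi : M -> M) :
  (forall k, @ga_deg F A 0 (al_scal k)) ->
  (forall i, gm_deg i (0 : M)
     /\ forall m n : M, gm_deg i m -> gm_deg i n -> gm_deg i (m - n)) ->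
  (forall i j (a : A) (m : M), ga_deg i a -> gm_deg j m -> gm_deg (i + j) (a *: m)) ->
  spans e -> (forall k, gm_deg (d k) (e k)) ->
  injective ev -> (forall x y, Phi (x - y) = Phi x - Phi y) ->
  (forall i m, gm_deg i m -> Phi m = ev i *! m) -> is_graded M.
Proof.
move=> scal0 d0 dM se ed ev_inj PhiB PhiE.
have dZ i k (m : M) : gm_deg i m -> gm_deg i (k *! m).
  by move=> mi; rewrite -(add0r i); apply: dM.
have dD i (m n : M) : gm_deg i m -> gm_deg i n -> gm_deg i (m + n).
  move=> mi ni; case: (d0 i) => z0 dB.
  by rewrite -[n]opprK -[- n]sub0r; apply: (dB) => //; apply: (dB).
have Phi0 := morphB0 PhiB; have PhiD := morphBD PhiB.
split=> //.
  move=> m; have [c ->] := se m.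
  exists (undup (codom d)), (fun i => \sum_(k | d k == i) c k *! e k); split.
    move=> i; elim/big_ind: _ => [||k /eqP <-]; [by case: (d0 i)|exact: dD|exact: dZ].
  under [RHS]eq_bigr => i _ do rewrite big_mkcond.
  rewrite exchange_big; apply: eq_bigr => k _.
  rewrite (bigD1_seq (d k)) ?undup_uniq ?mem_undup ?codom_f //= eqxx.
  by rewrite big1 ?addr0 // => i; rewrite eq_sym => /negPf ->.
elim=> [|i s IH] f //= /andP [ni us] fd; rewrite big_cons => fs.
have f0 j : j \in s -> f j = 0.
  move=> js; have := IH (fun j => (ev j - ev i) *! f j) us.
  have -> : \sum_(j <- s) (ev j - ev i) *! f j = 0.
    have : Phi (f i + \sum_(j <- s) f j) - ev i *! (f i + \sum_(j <- s) f j) = 0.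
      by rewrite fs Phi0 fsc0 subrr.
    rewrite PhiD (big_morph Phi PhiD Phi0) (PhiE i) // fscDr fsc_sum opprD addrACA subrr add0r.
    rewrite -sumrB; apply: etrans; apply: eq_bigr => k _.
    by rewrite (PhiE k) // fscBl.
  move=> /(_ _ _ j js) h; apply: (@fsc_eq0 _ _ _ (ev j - ev i)).
    by rewrite subr_eq0 (inj_eq ev_inj); apply: contraNneq ni => <-.
  by apply: h => // k; apply: dZ.
move=> j; rewrite inE => /orP [/eqP ->|/f0 //].
by move: fs; rewrite big_seq big1 ?addr0 // => k /f0.
Qed.

(** * Standard modules *)

(** Invariants of positive degree in the variables X vanish in A.             *)
Definition inv_scalar (F : fieldType) (W : finGroupType) (V : wrep F W)
    (A : algebra F) (X : V -> A) : Prop :=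
  forall f : algHom (sym_walg V) A, (forall v, f (svar v) = X v) ->
  forall p, sym_inv p -> f p = al_scal (const_term V p).

(** What is used of a restricted Cherednik algebra: its presentation, with    *)
(** the universal property, and its grading, whose components an automorphism *)
(** E tells apart.  This notion is stable under passing to the opposite       *)
(** algebra, and what follows is applied to both.                             *)
Record triangular (F : fieldType) (W : finGroupType) (V U : wrep F W)
    (kap : W -> U -> V -> F) (A : gralg F) (X : V -> A) (Y : U -> A) (g : W -> A)
    : Prop := Triangular {
  tr_rels : cherednik_gen kap X Y g;
  tr_gens : generated X Y g;
  tr_Xdeg : forall v, @ga_deg F A (-1) (X v);
  tr_Ydeg : forall u, @ga_deg F A 1 (Y u);
  tr_gdeg : forall w, @ga_deg F A 0 (g w);
  tr_scaldeg : forall k, @ga_deg F A 0 (al_scal k);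
  tr_degM : forall i j a b, @ga_deg F A i a -> @ga_deg F A j b -> @ga_deg F A (i + j) (a * b);
  tr_euler : exists (E : algHom A A) (ev : int -> F),
    injective ev /\ forall i a, @ga_deg F A i a -> E a = al_scal (ev i) * a;
  tr_Xinv : inv_scalar X;
  tr_lift : forall (B : algebra F) (X' : V -> B) (Y' : U -> B) (g' : W -> B),
    cherednik_gen kap X' Y' g' -> inv_scalar X' -> inv_scalar Y' ->
    exists f : algHom A B, [/\ forall v, f (X v) = X' v, forall u, f (Y u) = Y' u
                             & forall w, f (g w) = g' w]
}.

Section Standard.
Variables (F : fieldType) (W : finGroupType) (V U : wrep F W).
Hypothesis natr_neq0 : forall n, n.+1%:R != 0 :> F.
Variables (mu : W -> F) (d : W -> V -> F) (d' : W -> U -> F).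
Hypotheses (df : forall s, reflection_form s (d s)).
Hypotheses (df' : forall s, reflection_form s (d' s)).
Hypothesis kap_act : forall w s u v,
  refl_coef mu d d' (w * s * w^-1)%g (wr_act w u) (wr_act w v) = refl_coef mu d d' s u v.
Variables (A : gralg F) (X : V -> A) (Y : U -> A) (g : W -> A).
Hypothesis tri : triangular (refl_coef mu d d') X Y g.
Variables (Bo : algebra F) (phi : algHom Bo A) (yB : U -> Bo) (gB : W -> Bo).
Hypotheses (phi_y : forall u, phi (yB u) = Y u) (phi_g : forall w, phi (gB w) = g w).
Hypotheses (gB1 : gB 1%g = 1) (gBM : forall w w', gB (w * w')%g = gB w * gB w').
Hypothesis gensB : generated yB yB gB.
Variables (N : grmod Bo) (delta : int).
Hypotheses (N_y : forall u (m : N), yB u *: m = 0).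
Hypotheses (N_delta : forall m : N, gm_deg delta m).
Hypotheses (N_other : forall i (m : N), gm_deg i m -> i <> delta -> m = 0).
Variables (n : nat) (l : 'I_n -> N) (rho : W -> 'M[F]_n).
Hypotheses (lb : is_basis l) (lg : forall w j, gB w *: l j = comb l (rho w j)).
Notation C := (coinv_walg V).
Notation proj := (quot_proj (@coinv_rel F W V)).
Notation cvar v := (proj (svar v)).
Variables (p : nat) (b : 'I_p -> C) (dg : 'I_p -> nat) (beta : W -> 'M[F]_p).
Hypotheses (bm : forall k, mono (dg k) (b k)).
Hypotheses (bs : forall x, exists c : 'I_p -> F, x = \sum_k al_scal (c k) * b k).
Hypotheses (bf : forall c : 'I_p -> F, \sum_k al_scal (c k) * b k = 0 -> forall k, c k = 0).
Hypotheses (betaE : forall w k, wa_act C w (b k) = \sum_i al_scal (beta w k i) * b i).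

Let rels := tr_rels tri.
Let gens := tr_gens tri.

Lemma xbar_kills q : coinv_rel q -> sym_lift (cg_Xlin rels) (cg_XX rels) q = 0.
Proof.
move=> [qi qc]; rewrite (tr_Xinv tri _ qi) ?qc ?rmorph0 // => v.
by rewrite sym_liftE.
Qed.
Definition xbar : algHom C A := quot_lift xbar_kills.
Lemma xbar_var v : xbar (cvar v) = X v.
Proof. by apply: (etrans (quot_liftE xbar_kills _)); rewrite sym_liftE. Qed.
Lemma xbar_act w x : g w * xbar x = xbar (wa_act C w x) * g w.
Proof.
elim/coinv_ind: x => [v|k|x y hx hy|x y hx hy].
- by rewrite coinv_act_var !xbar_var (cg_gX rels).
- by rewrite !ah_scal al_central.
- by rewrite !ahD mulrDr mulrDl hx hy.
- by rewrite !ahM mulrA hx -mulrA hy mulrA.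
Qed.
Lemma xbar_deg m x : mono m x -> @ga_deg F A (- m%:Z) (xbar x).
Proof.
elim=> {m x} [|m v x _ IH].
  by rewrite ah1 oppr0 -(rmorph1 (@al_scal _ A)); apply: (tr_scaldeg tri).
rewrite ahM xbar_var -addn1 PoszD opprD addrC.
exact: (tr_degM tri) (tr_Xdeg tri v) IH.
Qed.

Let M : grmod A := ind phi N.
Let tn (a : A) (m : N) : M := tens phi a m.
Definition std_basis (x : 'I_p * 'I_n) : M := xbar (b x.1) *: tn 1 (l x.2).
Definition std_deg (x : 'I_p * 'I_n) : int := delta - (dg x.1)%:Z.

Lemma tnE a m : tn a m = a *: tn 1 m. Proof. exact: tensE. Qed.
Lemma tnBl a a' m : tn (a - a') m = tn a m - tn a' m.
Proof. by rewrite /tn tens_addl tensNl. Qed.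
Lemma tnBr a m m' : tn a (m - m') = tn a m - tn a m'.
Proof. by rewrite /tn tens_addr tensNr. Qed.
Lemma tn_comb (c : 'I_n -> F) : tn 1 (comb l c) = \sum_j c j *! tn 1 (l j).
Proof.
rewrite /comb (big_morph (tn 1) (tens_addr phi 1) (tens0r phi N 1)).
by apply: eq_bigr => j _; apply: tens_scal.
Qed.
Lemma tn_g w m : g w *: tn 1 m = tn 1 (gB w *: m).
Proof. by rewrite -tnE -phi_g -[phi _]mul1r; apply: tens_bal. Qed.
Lemma tn_y u m : Y u *: tn 1 m = 0.
Proof. by rewrite -tnE -phi_y -[phi _]mul1r /tn tens_bal N_y tens0r. Qed.

Lemma rho_1 : rho 1%g = 1%:M.
Proof.
apply/matrixP => i j; rewrite mxE eq_sym -(coord_basis lb) -[l i in RHS]scale1r -gB1 lg.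
by rewrite combK.
Qed.
Lemma rho_M w w' : rho (w * w')%g = rho w' *m rho w.
Proof.
apply/matrixP => i j; have e := lg (w * w')%g i.
rewrite -[LHS](combK lb) -e gBM -scalerA lg /comb.
have gl : flinear (fun m : N => gB w *: m).
  by split=> [m m'|k m]; [apply: scalerBr | rewrite fscC].
rewrite -[\sum_i _]/(comb l (rho w' i)) (flin_comb gl) coord_comb // mxE.
by apply: eq_bigr => k _ /=; rewrite lg combK.
Qed.

(** The vectors 1 (x) m are killed by Y and stable under W, so their          *)
(** X-multiples form a submodule.                                             *)
Lemma std_gen (x : M) : exists c : 'I_n -> C, x = \sum_j xbar (c j) *: tn 1 (l j).
Proof.
pose S (m : M) := exists n, m = tn 1 n.
have SZ k (m : M) : S m -> S (k *! m).
  by move=> [m' ->]; exists (k *! m'); rewrite /tn tens_scal.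
have Sg w (m : M) : S m -> S (g w *: m).
  by move=> [m' ->]; exists (gB w *: m'); apply: tn_g.
have Sy u (m : M) : S m -> Y u *: m = 0 by move=> [m' ->]; apply: tn_y.
have xsM := xspan_stable rels gens SZ Sg Sy.
have all : xspan X S x.
  elim/ind_sp_ind: x => [a m||y z hy hz]; [|exact: xs_0|exact: xs_B].
  by rewrite -[tens _ _ _]/(tn a m) tnE; apply/xsM/xs_base; exists m.
elim: all => {x} [m [m' ->]||m m' _ [c ->] _ [c' ->]|v m _ [c ->]].
- exists (fun j => al_scal (coord l m' j)); rewrite -[in LHS](coordK m' lb.1) tn_comb.
  by apply: eq_bigr => j _; rewrite ah_scal.
- by exists (fun=> 0); rewrite big1 // => j _; rewrite ah0 scale0r.
- exists (fun j => c j - c' j); rewrite -sumrB; apply: eq_bigr => j _.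
  by rewrite ahB scalerBl.
- exists (fun j => cvar v * c j); rewrite scaler_sumr; apply: eq_bigr => j _.
  by rewrite ahM xbar_var scalerA.
Qed.

Lemma std_spans : spans std_basis.
Proof.
move=> x; have [c ->] := std_gen x; have /choice [e eE] j := bs (c j).
exists (fun x => e x.2 x.1); rewrite /comb.
rewrite -(pair_bigA _ (fun k j => e j k *! std_basis (k, j))) exchange_big.
apply: eq_bigr => j _; rewrite (eE j) ah_sum scaler_suml; apply: eq_bigr => k _.
by rewrite ahM ah_scal -scalerA.
Qed.

(** A acts on coinv(V) (x) N through Dunkl operators, with 1 (x) N a module   *)
(** over the Borel subalgebra isomorphic to N.  By Frobenius reciprocity the  *)
(** induced module maps to coinv(V) (x) N, and it sends std_basis to a basis. *)
Lemma std_free : free std_basis.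
Proof.
have T := tuple_module_ex C n.
have [Y' [R [Yc Xi Yi]]] := dunkl_representation T natr_neq0 df df' kap_act rho_1 rho_M.
have Xi' : inv_scalar (fun v => vX T (cvar v)).
  move=> f fX q qi; rewrite -(Xi q qi); apply: sym_hom_eq => v.
  by rewrite fX sym_liftE.
have Yi' : inv_scalar Y'.
  move=> f fX q qi; rewrite -(Yi q qi); apply: sym_hom_eq => v.
  by rewrite fX sym_liftE.
have [f [fX fY fg]] := tr_lift tri R Xi' Yi'.
have fxbar x : f (xbar x) = vX T x.
  elim/coinv_ind: x => [v|k|x y hx hy|x y hx hy].
  - by rewrite xbar_var fX.
  - by rewrite !ah_scal vX_scal.
  - by rewrite !ahD hx hy vXD.
  - by rewrite !ahM hx hy vX1.
pose vc (m : N) : T := vconst T (coord l m).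
have vcB m m' : vc (m - m') = vc m - vc m'.
  by apply: tm_eq => j; rewrite tm_atB !tm_mkE coordB // rmorphB.
have vc0 := morphB0 vcB; have vcD := morphBD vcB.
have vcb c (m : N) : f (phi c) (vc m) = vc (c *: m).
  move: c m; apply: gensB => [u m|u m|w m|k m|c c' hc hc' m|c c' hc hc' m].
  - by rewrite phi_y fY N_y vc0 Yc.
  - by rewrite phi_y fY N_y vc0 Yc.
  - have gl : flinear (fun m : N => gB w *: m).
      by split=> [m1 m2|k m1]; [apply: scalerBr | rewrite fscC].
    rewrite phi_g fg vg_const; apply: tm_eq => j; rewrite !tm_mkE; congr (al_scal _).
    rewrite -[m in RHS](coordK m lb.1) (flin_comb gl) coord_comb //.
    by apply: eq_bigr => i _ /=; rewrite lg combK.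
  - rewrite !ah_scal fend_scalE; apply: tm_eq => j.
    by rewrite tm_atZ !tm_mkE coordZ // rmorphM.
  - by rewrite (ahB phi) (ahB f) scalerBl vcB -hc -hc' fend_addE fend_oppE.
  - by rewrite (ahM phi) (ahM f) -scalerA -hc -hc' fend_mulE.
have [|||Th [ThB ThE]] := @tens_lift_ex F Bo A phi N T (fun a m => f a (vc m)).
- by move=> a a' m; rewrite (ahD f) fend_addE.
- by move=> a m m'; rewrite vcD feD.
- by move=> a c m; rewrite (ahM f) fend_mulE vcb.
have Th0 := morphB0 ThB; have ThD := morphBD ThB.
move=> c c0 [k j]; move: k.
suff : \sum_k al_scal (c (k, j)) * b k = 0 by move/(bf (c := fun k => c (k, j))).
have : tm_at (Th (comb std_basis c)) j = 0 by rewrite c0 Th0 vat0.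
rewrite (big_morph Th ThD Th0) vat_sum.
rewrite (eq_bigr (fun x => tm_at (Th (c (x.1, x.2) *! std_basis (x.1, x.2))) j)); last by case.
rewrite -(pair_bigA _ (fun k i => tm_at (Th (c (k, i) *! std_basis (k, i))) j)) /= => h.
apply: etrans h; apply: eq_bigr => k _.
have e i : tm_at (Th (c (k, i) *! std_basis (k, i))) j
    = al_scal (c (k, i)) * b k * al_scal (i == j)%:R.
  rewrite /std_basis -tnE -/(tn _ _) scale_tens ThE ahM ah_scal fend_mulE fend_scalE tm_atZ.
  by rewrite fxbar vXE tm_mkE coord_basis // eq_sym mulrA.
rewrite (bigD1 j) //= e eqxx rmorph1 mulr1 big1 ?addr0 // => i /negPf ij.
by rewrite e ij rmorph0 mulr0.
Qed.

Lemma std_is_basis : is_basis std_basis.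
Proof. by split; [apply: std_spans | apply: std_free]. Qed.

Lemma std_g w k j : g w *: std_basis (k, j)
  = comb std_basis (fun x => beta w k x.1 * rho w j x.2).
Proof.
rewrite /std_basis scalerA xbar_act -scalerA tn_g lg tn_comb betaE ah_sum scaler_suml /comb.
rewrite -(pair_bigA _ (fun k' j' => (beta w k k' * rho w j j') *! std_basis (k', j'))).
apply: eq_bigr => k' _; rewrite scaler_sumr; apply: eq_bigr => j' _.
by rewrite ahM ah_scal -scalerA -fscC fscA.
Qed.

Lemma std_homogeneous x : gm_deg (std_deg x) (std_basis x).
Proof.
rewrite /std_basis -tnE /std_deg addrC; apply: (id_tens phi).
  exact/xbar_deg/bm.
exact: N_delta.
Qed.

(** The automorphism E is the identity on the group and multiplies the Y by a *)
(** scalar, and the Y kill N; so a (x) m |-> E(a) (x) m is well defined, and  *)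
(** a scalar on each component.                                               *)
Lemma std_graded : is_graded M.
Proof.
have [E [ev [ev_inj Eev]]] := tr_euler tri.
have ev0 : al_scal (ev 0) = 1 :> A.
  have := Eev 0 _ (tr_scaldeg tri 1).
  by rewrite ah_scal rmorph1 mulr1.
have Eb (a : A) c (m : N) : tn (a * E (phi c)) m = tn a (c *: m).
  move: c a m; apply: gensB => [u a m|u a m|w a m|k a m|c c' hc hc' a m|c c' hc hc' a m].
  - rewrite phi_y (Eev 1) ?N_y; last exact: tr_Ydeg tri u.
    by rewrite mulrA -phi_y /tn tens_bal N_y !tens0r.
  - rewrite phi_y (Eev 1) ?N_y; last exact: tr_Ydeg tri u.
    by rewrite mulrA -phi_y /tn tens_bal N_y !tens0r.
  - rewrite phi_g (Eev 0); last exact: tr_gdeg tri w.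
    by rewrite ev0 mul1r -phi_g; apply: tens_bal.
  - by rewrite !ah_scal -[X in a * X](ah_scal phi); apply: tens_bal.
  - by rewrite (ahB phi) (ahB E) mulrBr scalerBl tnBl tnBr hc hc'.
  - by rewrite !ahM mulrA hc' hc scalerA.
have [|||Ph [PhB PhE]] := @tens_lift_ex F Bo A phi N M (fun a m => tn (E a) m).
- by move=> a a' m; rewrite (ahD E) /tn tens_addl.
- by move=> a m m'; rewrite /tn tens_addr.
- by move=> a c m; rewrite (ahM E) Eb.
apply: (@graded_by_euler F A M _ std_basis std_deg (fun i => ev (i - delta)) Ph).
- exact: tr_scaldeg tri.
- by move=> i; split=> [|x y]; [apply: id_zero | apply: id_sub].
- move=> i j a m ai; elim=> {j m} [i' j' a' m ai' mj|j|j x y _ hx _ hy].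
  + rewrite scale_tens addrA; apply: id_tens => //.
    exact: tr_degM tri _ _ _ _ ai ai'.
  + by rewrite scaler0; apply: id_zero.
  + by rewrite scalerBr; apply: id_sub.
- exact: std_spans.
- exact: std_homogeneous.
- by move=> i j /ev_inj /addIr.
- exact: PhB.
- have Ph0 := morphB0 PhB; move=> i m; elim=> {i m} [i j a m ai mj|i|i x y _ hx _ hy].
  + have [->|/eqP jd] := eqVneq j delta; last first.
      by rewrite (N_other mj jd) tens0r fsc0 Ph0.
    by rewrite PhE (Eev _ _ ai) addrK /tn scale_tens.
  + by rewrite Ph0 fsc0.
  + by rewrite PhB hx hy fscBr.
Qed.

Lemma std_basis_ex : exists e : 'I_p * 'I_n -> M,
  [/\ is_basis e, forall x, gm_deg (delta - (dg x.1)%:Z) (e x)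
    & forall w x, coord e (g w *: e x) x = beta w x.1 x.1 * rho w x.2 x.2].
Proof.
exists std_basis; split; [exact: std_is_basis|exact: std_homogeneous|].
by move=> w [k j]; rewrite std_g (combK std_is_basis).
Qed.
End Standard.

(** * Duals of graded modules *)

Section ResBasis.
Variables (F : fieldType) (A B : algebra F) (f : algHom B A) (M : grmod A).
Variables (I : finType) (e : I -> M).
Let re : I -> res f M := e.
Lemma res_comb c : comb re c = comb e c.
Proof.
rewrite /comb; elim/big_rec2: _ => // i x y _ ->; congr (_ + _).
by rewrite -[LHS]/(f (al_scal (c i)) *: e i) ah_scal.
Qed.
Lemma res_basis : is_basis e -> is_basis re.
Proof.
move=> [se fe]; split=> [m|c]; last by rewrite res_comb; apply: fe.
by have [c ->] := se m; exists c; rewrite res_comb.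
Qed.
Lemma coord_res m k : is_basis e -> coord re m k = coord e m k.
Proof.
move=> eb; have rb := res_basis eb.
have mE : m = comb re (coord e m).
  by rewrite res_comb; have [se _] := eb; have := coordK (m : M) se; move=> {1}<-.
by rewrite {1}mE; apply: combK.
Qed.
End ResBasis.

Section DualBasis.
Variables (F : fieldType) (A : algebra F) (M : lmodType A).

Lemma df0 (f : dual_mod M) : f 0 = 0.
Proof. by have /eqP := dfD f 0 0; rewrite addr0 -subr_eq subrr => /eqP. Qed.

Lemma dual_sumE (J : Type) (r : seq J) (E : J -> dual_mod M) m :
  (\sum_(k <- r) E k) m = \sum_(k <- r) E k m.
Proof. by elim: r => [|i s IH]; rewrite ?big_nil // !big_cons -IH. Qed.

Variables (I : finType) (e : I -> M).
Hypothesis eb : is_basis e.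
Lemma dual_basis_subproof k : is_functional (fun m : M => coord e m k).
Proof. by split=> [m n|x m]; rewrite ?coordD ?coordZ. Qed.
Definition dual_basis k : dual_mod M := DualMod (dual_basis_subproof k).

Lemma comb_dualE c m : comb dual_basis c m = \sum_k c k * coord e m k.
Proof.
rewrite /comb dual_sumE; apply: eq_bigr => k _.
by rewrite -[LHS]/(coord e (al_scal (c k) *: m) k) coordZ.
Qed.
Lemma dual_basisP : is_basis dual_basis.
Proof.
split=> [f|c c0 k].
  exists (fun k => f (e k)); apply: dual_eq => m.
  rewrite comb_dualE -{1}(coordK m eb.1) (big_morph f (dfD f) (df0 f)).
  by apply: eq_bigr => k _; rewrite dfZ mulrC.
have := comb_dualE c (e k); rewrite c0 (bigD1 k) //= coord_basis // eqxx mulr1.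
by rewrite big1 ?addr0 // => i /negPf ik; rewrite coord_basis // ik mulr0.
Qed.
Lemma coord_dual f k : coord dual_basis f k = f (e k).
Proof.
have := comb_dualE (coord dual_basis f) (e k); rewrite (coordK f dual_basisP.1).
rewrite (bigD1 k) //= coord_basis // eqxx mulr1 big1 ?addr0 => [-> //|j /negPf jk].
by rewrite coord_basis // jk mulr0.
Qed.
End DualBasis.

Section GradedDual.
Variables (F : fieldType) (A : gralg F) (N : grmod (op_gralg A)).
Hypothesis scal0 : forall k, @ga_deg F A 0 (al_scal k).
Hypothesis Ng : is_graded N.
Variables (I : finType) (e : I -> N) (d : I -> int).
Hypotheses (eb : is_basis e) (ed : forall k, gm_deg (d k) (e k)).
Let scal0' : forall k, @ga_deg F (op_gralg A) 0 (al_scal k).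
Proof. by move=> k; rewrite /= oppr0; apply: scal0. Qed.

(** The dual of a module over the opposite algebra, as a module over A.       *)
Definition codual : grmod A := res (to_opop A) (dual N).

Lemma dual_part_subproof (i : int) (f : dual_mod N) :
  is_functional (fun m : N => f (hpart i m)).
Proof.
split=> [m n|k m]; first by rewrite hpartD // dfD.
by rewrite (hpart_flin scal0' Ng i).2 dfZ.
Qed.
Definition dual_part i (f : codual) : codual :=
  DualMod (dual_part_subproof i (f : dual_mod N)) : dual_mod N.

(** The component of degree i of a functional f is f o p_i, with p_i the      *)
(** projection on the component of degree i; as N has a finite basis, f is a  *)
(** finite sum of these.                                                      *)
Lemma codual_graded : is_graded codual.
Proof.
apply: (@is_graded_intro _ _ _ dual_part).
- move=> i; split=> [j m _ _|f f' fi fi' j m ji mj] //.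
  rewrite -[LHS]/((f : dual_mod N) m - (f' : dual_mod N) m).
  by rewrite (fi j) // (fi' j) // subrr.
- move=> i j a f ai fj k m kij mk.
  rewrite -[LHS]/((f : dual_mod N) ((a : op_alg A) *: m)).
  apply: (fj (- i + k)); first by apply: contra kij => /eqP <-; rewrite addNKr.
  by apply: (gm_degM Ng) => //=; rewrite opprK.
- by move=> i f f'; apply: dual_eq.
- move=> i f j m ji mj; rewrite /= (hpart_hom Ng _ mj) eq_sym (negPf ji).
  exact: df0.
- move=> i j f fi; apply: dual_eq => m.
  rewrite -[LHS]/((f : dual_mod N) (hpart j m)).
  have [->|ji] := eqVneq j i; last by apply: (fi j) => //; apply: (hpart_deg scal0' Ng).
  have [s [us _ f0 e0]] := hpart_decomp scal0' Ng m.
  rewrite [in RHS]e0 (big_morph (f : dual_mod N) (dfD f) (df0 f)).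
  have [si|si] := boolP (i \in s); last first.
    rewrite f0 // df0 big_seq big1 // => k ks; apply: (fi k); last exact: (hpart_deg scal0' Ng).
    by apply: contraNneq si => <-.
  rewrite (bigD1_seq i) //= big1 ?addr0 // => k ki.
  by apply: (fi k) => //; apply: (hpart_deg scal0' Ng).
- move=> f; exists (undup (codom d)); apply: dual_eq => m.
  have sumE (s : seq int) : ((\sum_(i <- s) dual_part i f : codual) : dual_mod N) m
      = \sum_(i <- s) (f : dual_mod N) (hpart i m).
    elim: s => [|i s IH]; first by rewrite !big_nil.
    by rewrite !big_cons -IH.
  rewrite sumE -(big_morph (f : dual_mod N) (dfD f) (df0 f)); congr ((f : dual_mod N) _).
  have [c ->] := eb.1 m.
  under [RHS]eq_bigr => i _ do rewrite (hpart_comb scal0' Ng ed) /comb.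
  rewrite exchange_big; apply: eq_bigr => k _.
  rewrite (bigD1_seq (d k)) ?undup_uniq ?mem_undup ?codom_f // eqxx.
  by rewrite big1 ?Monoid.mulm1 // => i /negPf; rewrite eq_sym => ->; rewrite fsc0r.
Qed.

Definition codual_basis (k : I) : codual := dual_basis eb k.
Lemma codual_basisP : is_basis codual_basis.
Proof. exact: (@res_basis F _ A (to_opop A) (dual N) I (dual_basis eb) (dual_basisP eb)). Qed.
Lemma codual_basis_deg k : gm_deg (d k) (codual_basis k).
Proof.
move=> j m jk mj; rewrite -[LHS]/(coord e m k).
by apply: (gm_deg_comb scal0' Ng eb ed mj); rewrite eq_sym.
Qed.

Lemma codual_gchar (W : finGroupType) (g : W -> A) i w :
  gchar g codual i w
  = \sum_(k | d k == i) coord e ((g w : op_alg A) *: e k) k.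
Proof.
rewrite (gcharE scal0 g codual_graded codual_basisP codual_basis_deg).
apply: eq_bigr => k _; rewrite (@coord_res F _ A (to_opop A) (dual N) I (dual_basis eb) _ _ (dual_basisP eb)).
exact: coord_dual.
Qed.
End GradedDual.

(** * The opposite of a Cherednik algebra *)

Section OppositeTriangular.
Variables (F : fieldType) (W : finGroupType) (V U : wrep F W).

Lemma cherednik_gen_ext (kap kap' : W -> U -> V -> F) (A : algebra F) X Y g :
  (forall s u v, kap s u v = kap' s u v) ->
  @cherednik_gen F W V U kap A X Y g -> cherednik_gen kap' X Y g.
Proof.
move=> e [h1 h2 h3 h4 h5 h6 h7 h8 h9]; split=> // u v; rewrite h9; congr (_ + _).
by apply: eq_bigr => s _; rewrite e.
Qed.

(** Exchanging the two sets of variables and inverting W presents the         *)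
(** opposite algebra.                                                         *)
Lemma cherednik_gen_op (kap : W -> U -> V -> F) (A : algebra F) X Y g :
  @cherednik_gen F W V U kap A X Y g ->
  @cherednik_gen F W U V (fun s v u => kap s^-1%g u v) (op_alg A) Y X
    (fun w => g w^-1%g).
Proof.
move=> [h1 h2 h3 h4 h5 h6 h7 h8 h9]; split.
- by move=> k u v; rewrite h2 al_central.
- by move=> k u v; rewrite h1 al_central.
- by move=> u v; apply: (h4 v u).
- by move=> u v; apply: (h3 v u).
- by rewrite invg1 h5.
- by move=> w w'; rewrite invMg h6.
- move=> w u; rewrite -[LHS]/(Y u * g w^-1%g) -[RHS]/(g w^-1%g * Y (wr_act w u)).
  by rewrite h8 -wr_actM mulVg wr_act1.
- move=> w v; rewrite -[LHS]/(X v * g w^-1%g) -[RHS]/(g w^-1%g * X (wr_act w v)).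
  by rewrite h7 -wr_actM mulVg wr_act1.
- move=> v u; rewrite -[LHS]/(Y u * X v) h9 [in RHS](reindex_inj (@invg_inj W)).
  rewrite -[in RHS]/(X v * Y u + _); congr (_ + _); apply: eq_bigr => s _.
  by rewrite !invgK al_central.
Qed.

Lemma generated_op (I J : Type) (A : algebra F) (X : I -> A) (Y : J -> A) (g : W -> A) :
  generated X Y g -> @generated F (op_alg A) J I W Y X (fun w => g w^-1%g).
Proof.
move=> G P PY PX Pg Pk PB PM; apply: G => // [w|a b Pa Pb].
  by rewrite -(invgK w).
exact: (PM b a Pb Pa).
Qed.

Lemma inv_scalar_op (A : algebra F) (X : V -> A) :
  inv_scalar X -> @inv_scalar F W V (op_alg A) X.
Proof.
move=> Xi f fX p pi.
have f_mon : monoid_morphism (f : sym_walg V -> A).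
  split=> [|x y]; first exact: (ah1 f).
  by rewrite sym_comm; apply: (ahM f).
pose f' : algHom (sym_walg V) A :=
  @AlgHom F (sym_walg V) A f (ah_additive f) f_mon (ah_scal f).
exact: (Xi f' fX p pi).
Qed.
End OppositeTriangular.

(** s and s^-1 fix the same hyperplane.                                       *)
Lemma reflection_form_inv (F : fieldType) (W : finGroupType) (V : wrep F W)
    (s : W) (d : V -> F) : reflection_form s d -> reflection_form s^-1%g d.
Proof.
move=> [lin [d0|[a [da sa]]]]; split=> //; [by left|right].
pose z := 1 - d a; have sz : wr_act s a = z *: a by rewrite (refl_actE sa) scalerBl scale1r.
have z0 : z != 0.
  apply: contraNneq da => z0; have a0 : a = 0.
    by rewrite -(wr_act1 a) -(mulVg s) wr_actM sz z0 scale0r wr_act0.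
  by rewrite a0 (d0 lin).
have szV : wr_act s^-1%g a = z^-1 *: a.
  rewrite -[LHS]scale1r -(mulVf z0) -scalerA -wr_actZ -sz -wr_actM mulVg.
  by rewrite wr_act1.
exists (- z^-1 *: a); split=> [|v].
  by rewrite (dZ lin) mulf_neq0 // oppr_eq0 invr_eq0.
rewrite -[v in v - _](wr_act1 v) -(mulVg s) wr_actM -wr_actB -opprB sa.
rewrite -scaleNr wr_actZ szV !scalerA; congr (_ *: _).
by rewrite mulNr mulrN.
Qed.

Lemma triangular_op (F : fieldType) (W : finGroupType) (V U : wrep F W)
    (kap : W -> U -> V -> F) (A : gralg F) X Y g :
  @triangular F W V U kap A X Y g -> inv_scalar Y ->
  @triangular F W U V (fun s v u => kap s^-1%g u v) (op_gralg A) Y X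
    (fun w => g w^-1%g).
Proof.
move=> T Yi; split.
- exact: cherednik_gen_op (tr_rels T).
- exact: generated_op (tr_gens T).
- by move=> u; apply: (tr_Ydeg T).
- by move=> v; apply: (tr_Xdeg T).
- by move=> w /=; rewrite oppr0; apply: (tr_gdeg T).
- by move=> k /=; rewrite oppr0; apply: (tr_scaldeg T).
- by move=> i j a b ai bj /=; rewrite opprD addrC; apply: (tr_degM T).
- have [E [ev [ev_inj Eev]]] := tr_euler T.
  exists (op_hom E), (fun i => ev (- i)); split=> [i j /ev_inj /oppr_inj //|i a ai].
  by apply: etrans (Eev _ _ ai) _; rewrite al_central.
- exact: inv_scalar_op.
- move=> B X' Y' g' R Xi' Yi'.
  have R' : cherednik_gen kap (Y' : V -> op_alg B) (X' : U -> op_alg B) (fun w => g' w^-1%g).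
    by apply: cherednik_gen_ext (cherednik_gen_op R) => s u v; rewrite invgK.
  have [f [fX fY fg]] := tr_lift T R' (inv_scalar_op Yi') (inv_scalar_op Xi').
  have f_mon : monoid_morphism (f : op_alg A -> B).
    by split=> [|x y]; [apply: (ah1 f) | apply: (ahM f)].
  pose f' : algHom (op_alg A) B := @AlgHom F (op_alg A) B f (ah_additive f) f_mon (ah_scal f).
  exists f'; split=> [v|u|w]; [exact: fY|exact: fX|].
  by apply: (etrans (fg _)); rewrite invgK.
Qed.

(** * Roots of complex reflections *)

Lemma sub_lfunE (K : fieldType) (V1 V2 : vectType K) (f g : 'Hom(V1, V2)) x :
  (f - g)%VF x = f x - g x.
Proof. by rewrite add_lfunE opp_lfunE. Qed.

Section Roots.
Variables (K : numClosedFieldType) (W : finGroupType) (h : frep K W).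
Variables (c : W -> K) (al : W -> dual_sp h) (alv : W -> h).
Hypotheses (rd : root_data al alv) (ci : conj_invariant h c).
Notation h' := (dual_frep h).
Notation act w y := (fr_act h w y).
Notation ev x y := ((x : 'Hom(h, K^o)) y : K).

Lemma root_neq0 s : s \in reflections h -> alv s != 0.
Proof.
case/rd => _ _ e; apply/eqP => a0; move: e; rewrite a0 linear0 => /esym/eqP.
by rewrite pnatr_eq0.
Qed.

(** Both root lines together force s - 1 to be a multiple of the rank one map *)
(** y |-> al_s(y) alv_s.                                                      *)
Lemma reflection_formula s : s \in reflections h ->
  exists2 k : K, k != 0 & forall y, act s y - y = (k * ev (al s) y) *: alv s.
Proof.
move=> sr; have [al_img alv_img alE] := rd sr.
have /choice [f fE] (y : h) : exists k : K, act s y - y = k *: alv s.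
  apply/vlineP; rewrite alv_img.
  have -> : act s y - y = (fr_act h s - \1)%VF y by rewrite sub_lfunE id_lfunE.
  by rewrite memv_img ?memvf.
have [g gE] : exists g : K, forall y, ev (al s) (act s^-1%g y) - ev (al s) y = g * ev (al s) y.
  have : (dual_act h s - \1)%VF (al s) \in <[al s]>%VS by rewrite al_img memv_img ?memvf.
  case/vlineP => g ge; exists g => y.
  have := congr1 (fun x : dual_sp h => ev x y) ge.
  by rewrite sub_lfunE id_lfunE [LHS]sub_lfunE dual_actE scale_lfunE.
(* Evaluate s^-1 al_s, a multiple of al_s, at s z. *)
have fal z : (1 + g) * (ev (al s) z + 2%:R * f z) = ev (al s) z.
  have := gE (act s z); rewrite -fr_wactM mulVg fr_wact1.
  have -> : act s z = z + f z *: alv s by rewrite -fE addrC subrK.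
  rewrite linearD linearZ /= alE => e.
  have {e} e : ev (al s) z = ev (al s) z + f z * 2%:R + g * (ev (al s) z + f z * 2%:R).
    by rewrite -e addrC subrK.
  by rewrite [in RHS]e; ring.
have g1 : 1 + g != 0.
  apply/eqP => g0; have := fal (alv s); rewrite g0 mul0r alE => /esym/eqP.
  by rewrite pnatr_eq0.
have n2 : 2%:R != 0 :> K by rewrite pnatr_eq0.
pose k := - g / (2%:R * (1 + g)).
have fk z : f z = k * ev (al s) z.
  apply: (mulfI (mulf_neq0 n2 g1)); rewrite /k mulrA mulrCA divff ?mulf_neq0 // mulr1.
  have := fal z; rewrite mulrDr => e; apply: (addrI ((1 + g) * ev (al s) z)).
  have -> : (1 + g) * ev (al s) z + 2%:R * (1 + g) * f z = ev (al s) z.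
    by rewrite -[RHS]e; ring.
  by ring.
exists k => [|y]; last by rewrite fE fk.
apply/eqP => k0; move: sr; rewrite inE => /eqP.
have -> : (\1 - fr_act h s)%VF = 0.
  apply/lfunP => y; rewrite sub_lfunE id_lfunE zero_lfunE -opprB fE fk k0 mul0r.
  by rewrite scale0r oppr0.
have -> : lker (0 : 'End(h)) = fullv by apply/vspaceP => y; rewrite memv_ker zero_lfunE eqxx memvf.
by move/eqP; rewrite eqn_leq ltnn.
Qed.

Lemma reflection_root s (k : K) : s \in reflections h ->
  (forall y, act s y - y = (k * ev (al s) y) *: alv s) ->
  act s (alv s) = (1 + 2%:R * k) *: alv s.
Proof.
move=> sr e; have [_ _ alE] := rd sr.
by rewrite -[LHS](subrK (alv s)) e alE scalerDl scale1r addrC [k * _]mulrC.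
Qed.

Definition refl_form_y s (y : h) : K := if s \in reflections h then ev (al s) y else 0.
Definition refl_form_x s (x : h') : K := if s \in reflections h then ev x (alv s) else 0.
Definition refl_mu s : K := if s \in reflections h then - c s else 0.

Lemma refl_form_yP s : @reflection_form K W h s (refl_form_y s).
Proof.
split=> [k u v|].
  by rewrite /refl_form_y; case: ifP => _; [exact: (linearP (al s : 'Hom(h, K^o)) k u v) | rewrite mulr0 addr0].
rewrite /refl_form_y; have [sr|_] := boolP (s \in reflections h); [right|by left].
have [_ _ alE] := rd sr; have [k k0 e] := reflection_formula sr.
exists (- k *: alv s); split=> [|y].
  by rewrite linearZ /= alE; apply: mulf_neq0; rewrite ?oppr_eq0 ?pnatr_eq0.
by rewrite -opprB -[wr_act s y]/(act s y) e scalerA mulrN scaleNr mulrC.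
Qed.

Lemma refl_form_xP s : @reflection_form K W h' s (refl_form_x s).
Proof.
split=> [k u v|].
  rewrite /refl_form_x; case: ifP => _; last by rewrite mulr0 addr0.
  by rewrite add_lfunE scale_lfunE.
rewrite /refl_form_x; have [sr|_] := boolP (s \in reflections h); [right|by left].
have [_ _ alE] := rd sr; have [k k0 e] := reflection_formula sr.
have sa := reflection_root sr e.
have z0 : 1 + 2%:R * k != 0.
  apply/eqP => z0; move: sa; rewrite z0 scale0r => /(congr1 (fr_act h s^-1%g)).
  by rewrite -fr_wactM mulVg fr_wact1 linear0 => /eqP; rewrite (negPf (root_neq0 sr)).
pose nu := k / (1 + 2%:R * k).
have sV y : act s^-1%g y = y - (nu * ev (al s) y) *: alv s.
  have -> : y - (nu * ev (al s) y) *: alv s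
      = act s^-1%g (act s (y - (nu * ev (al s) y) *: alv s)).
    by rewrite -fr_wactM mulVg fr_wact1.
  congr (fr_act h s^-1%g _); rewrite linearB linearZ /= sa -[act s y](subrK y) e.
  rewrite scalerA addrAC -scalerBl; have -> : k * ev (al s) y - nu * ev (al s) y * (1 + 2%:R * k) = 0.
    by rewrite /nu mulrAC divfK // subrr.
  by rewrite scale0r add0r.
exists (nu *: al s); split=> [|x].
  rewrite scale_lfunE alE; apply: mulf_neq0; last by rewrite pnatr_eq0.
  by apply: mulf_neq0; rewrite ?invr_eq0.
apply/lfunP => y; rewrite sub_lfunE -[wr_act s x]/(dual_act h s x) dual_actE sV.
rewrite linearB linearZ /= opprB addrC subrK !scale_lfunE.
exact: mulrC.
Qed.

Lemma reflections_conj w s : s \in reflections h -> (w * s * w^-1)%g \in reflections h.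
Proof.
rewrite !inE => /eqP <-; apply/eqP; congr _.+1.
have -> : lker (\1 - fr_act h (w * s * w^-1)%g)%VF
    = (fr_act h w @: lker (\1 - fr_act h s)%VF)%VS.
  apply/vspaceP => y; apply/idP/memv_imgP => [|[x + ->]].
    rewrite memv_ker sub_lfunE id_lfunE subr_eq0 => /eqP e; exists (act w^-1%g y).
      rewrite memv_ker sub_lfunE id_lfunE subr_eq0 {1}e -!fr_wactM.
      by rewrite mulgA mulgA mulVg mul1g.
    by rewrite -fr_wactM mulgV fr_wact1.
  rewrite !memv_ker !sub_lfunE !id_lfunE !subr_eq0 => /eqP e.
  by rewrite -fr_wactM mulgKV fr_wactM -e.
apply: limg_dim_eq; have -> : lker (fr_act h w) = 0%VS; last exact: capv0.
apply/eqP/lker0P => u v /(congr1 (fr_act h w^-1%g)).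
by rewrite -!fr_wactM mulVg !fr_wact1.
Qed.

Definition cherednik_coef := @refl_coef K W h' h refl_mu refl_form_x refl_form_y.

(** For t = w s w^-1, both al_t and w(al_s), and both alv_t and w(alv_s), are *)
(** proportional; as t - 1 = w (s - 1) w^-1, the products al (x) alv agree.   *)
Lemma refl_coef_act w s (u : h) (v : h') :
  cherednik_coef (w * s * w^-1)%g
    (@wr_act K W h w u) (@wr_act K W h' w v)
  = cherednik_coef s u v.
Proof.
rewrite /cherednik_coef /refl_coef /refl_mu; have [sr|nsr] := boolP (s \in reflections h); last first.
  have -> : (w * s * w^-1)%g \in reflections h = false.
    apply: contraNF nsr => /(reflections_conj w^-1%g).
    by rewrite invgK !mulgA mulVg mul1g mulgKV.
  by rewrite !mul0r.
set t := (w * s * w^-1)%g; have tr : t \in reflections h by apply: reflections_conj.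
rewrite tr /refl_form_x /refl_form_y sr tr.
have -> : c t = c s by rewrite -(ci w^-1%g sr) /conjg invgK mulgA.
have [k k0 ke] := reflection_formula sr; have [k' k0' ke'] := reflection_formula tr.
have sa := reflection_root sr ke; have ta := reflection_root tr ke'.
have tw y : act t (act w y) = act w (act s y) by rewrite /t -!fr_wactM mulgKV.
have twa : act t (act w (alv s)) - act w (alv s) = (2%:R * k) *: act w (alv s).
  by rewrite tw sa linearZ /= scalerDl scale1r addrC addKr.
have wn0 : act w (alv s) != 0.
  apply: contra (root_neq0 sr) => /eqP /(congr1 (fr_act h w^-1%g)).
  by rewrite -fr_wactM mulVg fr_wact1 linear0 => ->.
have n2 : 2%:R != 0 :> K by rewrite pnatr_eq0.
have [m wm] : exists m, act w (alv s) = m *: alv t.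
  exists ((2%:R * k)^-1 * (k' * ev (al t) (act w (alv s)))).
  rewrite -scalerA -ke' twa scalerA mulVf ?scale1r //.
  by rewrite mulf_neq0.
have kk : k' = k.
  apply: (mulfI n2); have : (2%:R * k' - 2%:R * k) *: act w (alv s) = 0.
    have e : act t (act w (alv s)) = (1 + 2%:R * k') *: act w (alv s).
      by rewrite wm linearZ /= ta !scalerA mulrC.
    by rewrite scalerBl -twa e scalerDl scale1r [X in _ - (X - _)]addrC addrK subrr.
  by move/eqP; rewrite scaler_eq0 (negPf wn0) orbF subr_eq0 => /eqP.
have e : k * (ev (al t) (act w u) * ev (@wr_act K W h' w v) (alv t))
       = k * (ev (al s) u * ev v (alv s)).
  rewrite -[@wr_act K W h' w v]/(dual_act h w v).
  have := congr1 (fun y => ev (dual_act h w v) y) (ke' (act w u)).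
  rewrite tw -linearB ke linearZ linearZ [X in _ = X]linearZ /= dual_actE.
  by rewrite -fr_wactM mulVg fr_wact1 kk -![_ *: _]/(_ * _) !mulrA => ->.
by rewrite -!mulrA; congr (_ * _); apply: (mulfI k0).
Qed.
End Roots.

(** * Restricted rational Cherednik algebras *)

(** Scaling the variables preserves invariants and constant terms.            *)
Lemma inv_scalar_scale (F : fieldType) (W : finGroupType) (V : wrep F W) (B : algebra F)
    (X : V -> B) (k : F) : k != 0 -> inv_scalar X -> inv_scalar (fun v => al_scal k * X v).
Proof.
move=> k0 Xi f fX p pi; pose f' := ah_comp f (sym_scale V k^-1).
have f'X v : f' (svar v) = X v.
  rewrite -[LHS]/(f (sym_scale V k^-1 (svar v))) sym_scale_svar ahM ah_scal fX mulrA.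
  by rewrite -rmorphM mulVf // rmorph1 mul1r.
have := Xi f' f'X _ (sym_scale_inv k pi); rewrite sym_scale_const => <-.
rewrite -[RHS]/(f (sym_scale V k^-1 (sym_scale V k p))); congr (f _).
pose j := ah_comp (sym_scale V k^-1) (sym_scale V k).
rewrite -[RHS]/(j p); apply: (@sym_hom_eq F W V _ (idHom _) j) => v.
rewrite -[RHS]/(sym_scale V k^-1 (sym_scale V k (svar v))) sym_scale_svar ahM ah_scal.
by rewrite sym_scale_svar mulrA -rmorphM mulfV // rmorph1 mul1r.
Qed.

Section Instance.
Variables (K : numClosedFieldType) (W : finGroupType) (h : frep K W).
Variables (c : W -> K) (al : W -> dual_sp h) (alv : W -> h).
Notation h' := (dual_frep h).
Notation H := (cherednik c al alv).
Notation A := (rcherednik_gr c al alv).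
Notation pr := (quot_proj (@cherednik_rel K W h c al alv)).
Notation kap := (cherednik_coef c al alv).

Definition rx (x : h') : A := rproj c al alv (cx c al alv x).
Definition ry (y : h) : A := rproj c al alv (cy c al alv y).
Definition rg (w : W) : A := rw c al alv w.

Lemma rcherednik_rels : @cherednik_gen K W h' h kap A rx ry rg.
Proof.
split.
- by move=> k u v; rewrite /rx cx_lin (ahD (rproj _ _ _)) (ahM (rproj _ _ _)) ah_scal.
- by move=> k u v; rewrite /ry cy_lin (ahD (rproj _ _ _)) (ahM (rproj _ _ _)) ah_scal.
- by move=> u v; rewrite /rx -!(ahM (rproj c al alv)) cx_comm.
- by move=> u v; rewrite /ry -!(ahM (rproj c al alv)) cy_comm.
- exact: rw1.
- exact: rwM.
- by move=> w v; rewrite /rg /rw /rx -!(ahM (rproj c al alv)) cw_cx.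
- by move=> w v; rewrite /rg /rw /ry -!(ahM (rproj c al alv)) cw_cy.
- move=> u v; rewrite /rx /ry -!(ahM (rproj c al alv)).
  have e : cy c al alv u * cx c al alv v = cx c al alv v * cy c al alv u
      + \sum_s al_scal (kap s u v) * cw c al alv s.
    have : pr ((ty u * tx v - tx v * ty u)
       - - \sum_(s in reflections h)
           al_scal (c s * (al s : 'Hom(h, K^o)) u * (v : 'Hom(h, K^o)) (alv s)) * tw h s) = 0.
      by rewrite -(ah0 pr); apply/qpiE; rewrite subr0; apply/ideal_gen/rel_yx.
    rewrite opprK ahD ahB !ahM ah_sum => e0; apply/eqP.
    rewrite -subr_eq0 opprD addrA -[X in _ == X]e0 -/(cy c al alv u) -/(cx c al alv v).
    rewrite (inj_eq (addrI _)) -sumrN [X in _ == X]big_mkcond; apply/eqP.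
    apply: eq_bigr => s _; rewrite /cherednik_coef /refl_coef /refl_mu /refl_form_x /refl_form_y.
    case: ifP => sr; last by rewrite !mul0r rmorph0 mul0r oppr0.
    by rewrite ahM ah_scal -mulNr -rmorphN !mulNr opprK.
  rewrite e (ahD (rproj c al alv)) ah_sum; congr (_ + _); apply: eq_bigr => s _.
  by rewrite (ahM (rproj c al alv)) ah_scal.
Qed.

Lemma rcherednik_gens : @generated K A _ _ _ rx ry rg.
Proof.
move=> P Px Py Pg Pk PB PM a.
have P0 : P 0 by rewrite -(rmorph0 (@al_scal _ A)).
have PD x y : P x -> P y -> P (x + y).
  move=> hx hy; rewrite -[y]opprK -[- y]sub0r; apply: (PB) => //.
  exact: PB.
case: (qpi_surj a) => r ->; rewrite -[qpi _ r]/(rproj c al alv r).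
case: (qpi_surj r) => t ->; rewrite -[qpi _ t]/(pr t).
rewrite (sk_decomp t) (ah_sum pr) (ah_sum (rproj c al alv)).
elim/big_ind: _ => // w _.
have -> : sk_mon (t w) w = sk_in _ (t w) * tw h w.
  by rewrite [RHS]sk_monM ah1 mulr1 mul1g.
rewrite (ahM pr) (ahM (rproj c al alv)); apply: (PM); last exact: Pg.
elim/tens_ind: (t w) => [[y x]|k|x y hx hy|x y hx hy].
- have -> : ((y, x) : dbl_wrep h) = 1 *: ((y, 0) : dbl_wrep h) + (0, x).
    by rewrite scale1r; apply: injective_projections; rewrite /= ?addr0 ?add0r.
  rewrite tvar_linear rmorph1 mul1r (ahD (sk_in _)) (ahD pr) (ahD (rproj c al alv)).
  by apply: PD; [apply: Py | apply: Px].
- by rewrite (ah_scal (sk_in _)) (ah_scal pr) (ah_scal (rproj c al alv)).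
- by rewrite (ahD (sk_in _)) (ahD pr) (ahD (rproj c al alv)); apply: PD.
- by rewrite (ahM (sk_in _)) (ahM pr) (ahM (rproj c al alv)); apply: PM.
Qed.

Lemma rx_invariant : @inv_scalar K W h' A rx.
Proof.
move=> f fX p pi; pose f' := ah_comp (rproj c al alv) (pol_x c al alv).
have ff' : f p = f' p.
  by apply: sym_hom_eq => v; rewrite fX -[RHS]/(rproj c al alv (pol_x c al alv (svar v))) sym_liftE.
have : coinv_rel (p - al_scal (const_term h' p)).
  by split=> [w|]; rewrite ahB ah_scal ?pi ?subrr.
move=> /(rpol_x_kills c al alv); rewrite -/f' (ahB f') (ah_scal f') => e.
by rewrite ff'; apply: subr0_eq.
Qed.

Lemma ry_invariant : @inv_scalar K W h A ry.
Proof.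
move=> f fX p pi; pose f' := ah_comp (rproj c al alv) (pol_y c al alv).
have ff' : f p = f' p.
  by apply: sym_hom_eq => v; rewrite fX -[RHS]/(rproj c al alv (pol_y c al alv (svar v))) sym_liftE.
have : coinv_rel (p - al_scal (const_term h p)).
  by split=> [w|]; rewrite ahB ah_scal ?pi ?subrr.
move=> /(rpol_y_kills c al alv); rewrite -/f' (ahB f') (ah_scal f') => e.
by rewrite ff'; apply: subr0_eq.
Qed.

Lemma rcherednik_lift (B : algebra K) (X' : h' -> B) (Y' : h -> B) (g' : W -> B) :
  @cherednik_gen K W h' h kap B X' Y' g' -> @inv_scalar K W h' B X' -> @inv_scalar K W h B Y' ->
  exists f : algHom A B, [/\ forall v, f (rx v) = X' v, forall u, f (ry u) = Y' u
                           & forall w, f (rg w) = g' w].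
Proof.
move=> [Xl Yl XX YY g1 gM gX gY YX] Xi Yi.
have X0 : X' 0 = 0.
  have := Xl 1 0 0; rewrite scale1r addr0 rmorph1 mul1r => /eqP.
  by rewrite -subr_eq subrr => /eqP.
have Y0 : Y' 0 = 0.
  have := Yl 1 0 0; rewrite scale1r addr0 rmorph1 mul1r => /eqP.
  by rewrite -subr_eq subrr => /eqP.
pose e (v : dbl_wrep h) : B := Y' v.1 + X' v.2.
have e_lin k u v : e (k *: u + v) = al_scal k * e u + e v.
  by rewrite /e /= Xl Yl mulrDr addrACA.
pose f0 : algHom (tens_walg (dbl_wrep h)) B := tens_lift e_lin.
have f0g w b : g' w * f0 b = f0 (wa_act (tens_walg (dbl_wrep h)) w b) * g' w.
  rewrite -[wa_act (tens_walg (dbl_wrep h)) w b]/(tens_act (dbl_wrep h) w b).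
  elim/tens_ind: b => [v|k|x y hx hy|x y hx hy].
  - by rewrite tens_actE !tens_liftE /e mulrDr mulrDl gX gY.
  - by rewrite !ah_scal al_central.
  - by rewrite !ahD mulrDr mulrDl hx hy.
  - by rewrite !ahM mulrA hx -mulrA hy mulrA.
pose f1 := @skew_lift K W (tens_walg (dbl_wrep h)) B f0 g' g1 gM f0g.
have f1in b : f1 (sk_in _ b) = f0 b.
  by apply: (etrans (skew_lift_mon _ _ _ _)); rewrite g1 mulr1.
have f1x x : f1 (tx x) = X' x by rewrite f1in tens_liftE /e /= Y0 add0r.
have f1y y : f1 (ty y) = Y' y by rewrite f1in tens_liftE /e /= X0 addr0.
have f1w w : f1 (tw h w) = g' w.
  by apply: (etrans (skew_lift_mon _ _ _ _)); rewrite ah1 mul1r.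
have f1_kills t : cherednik_rel c al alv t -> f1 t = 0.
  case=> {t} [x x'|y y'|y x].
  - by rewrite ahB !ahM !f1x XX subrr.
  - by rewrite ahB !ahM !f1y YY subrr.
  - rewrite opprK ahD ahB !ahM !f1x !f1y YX ah_sum [X' x * _ + _]addrC addrK.
    rewrite -[RHS](subrr (\sum_s al_scal (kap s y x) * g' s)); congr (_ + _).
    rewrite -sumrN [LHS]big_mkcond; apply: eq_bigr => s _.
    rewrite /cherednik_coef /refl_coef /refl_mu /refl_form_x /refl_form_y.
    case: ifP => sr; last by rewrite !mul0r rmorph0 mul0r oppr0.
    by rewrite ahM ah_scal f1w -[in RHS]mulNr -rmorphN !mulNr opprK.
pose f2 := quot_lift f1_kills.
have f2x x : f2 (cx c al alv x) = X' x by rewrite /f2 quot_liftE f1x.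
have f2y y : f2 (cy c al alv y) = Y' y by rewrite /f2 quot_liftE f1y.
have f2px p : sym_inv p -> f2 (pol_x c al alv p) = al_scal (const_term h' p).
  apply: (Xi (ah_comp f2 (pol_x c al alv))) => v.
  by rewrite -[LHS]/(f2 (pol_x c al alv (svar v))) sym_liftE f2x.
have f2py p : sym_inv p -> f2 (pol_y c al alv p) = al_scal (const_term h p).
  apply: (Yi (ah_comp f2 (pol_y c al alv))) => v.
  by rewrite -[LHS]/(f2 (pol_y c al alv (svar v))) sym_liftE f2y.
have f2_kills r : in_Rplus r -> f2 r = 0.
  move=> [s [si s0 ->]]; rewrite ah_sum; apply: (@etrans _ _ (al_scal (\sum_(pq <- s) const_term h' pq.1 * const_term h pq.2)));
    last by rewrite s0 rmorph0.
  rewrite rmorph_sum.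
  rewrite !big_seq; apply: eq_bigr => pq /si [pi qi].
  by rewrite ahM f2px // f2py // -rmorphM.
exists (quot_lift f2_kills); split=> [v|u|w].
- by rewrite -(f2x v); apply: quot_liftE.
- by rewrite -(f2y u); apply: quot_liftE.
- rewrite -f1w; apply: (etrans (quot_liftE f2_kills _)).
  exact: quot_liftE f1_kills _.
Qed.
End Instance.

(** * Borel subalgebras *)

Section Borel.
Variables (F : fieldType) (W : finGroupType) (V : wrep F W).
Notation C := (coinv_walg V).

Definition bvar (v : V) : borel V := sk_in C (quot_proj (@coinv_rel F W V) (svar v)).
Definition bgrp (w : W) : borel V := sk_grp C w.

Lemma borel_generated : generated bvar bvar bgrp.
Proof.
move=> P Pv _ Pg Pk PB PM a.
have P0 : P 0 by rewrite -(rmorph0 (@al_scal _ (borel V))).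
have PD x y : P x -> P y -> P (x + y).
  move=> hx hy; rewrite -[y]opprK -[- y]sub0r; apply: (PB) => //.
  exact: PB.
rewrite (sk_decomp a); elim/big_ind: _ => // w _.
have -> : sk_mon (a w) w = sk_in C (a w) * bgrp w.
  by rewrite [RHS]sk_monM ah1 mulr1 mul1g.
apply: (PM); last exact: Pg.
elim/coinv_ind: (a w) => [v|k|x y hx hy|x y hx hy].
- exact: Pv.
- by rewrite (ah_scal (sk_in C)).
- by rewrite (ahD (sk_in C)); apply: PD.
- by rewrite (ahM (sk_in C)); apply: PM.
Qed.

Lemma borel_proj_var v : borel_proj V (bvar v) = 0.
Proof.
apply: (etrans (skew_lift_mon _ _ _ _)).
rewrite -[ah_comp _ _ _]/(sk_in (triv_walg F W) (coinv_const V _)).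
by rewrite coinv_constE const_term_svar (ah0 (sk_in (triv_walg F W))) mul0r.
Qed.
Lemma borel_proj_grp w : borel_proj V (bgrp w) = sk_grp (triv_walg F W) w.
Proof.
apply: (etrans (skew_lift_mon _ _ _ _)).
by rewrite (ah1 (ah_comp _ _)) mul1r.
Qed.
End Borel.

(** * Simple modules of the group algebra *)

(** T being concentrated in degree 0, each homogeneous component is a         *)
(** submodule, so a simple module has only one.                               *)
Lemma graded_simple_degree (F : fieldType) (W : finGroupType)
    (la : grmod (group_gralg F W)) : graded_simple la ->
  exists delta, (forall m : la, gm_deg delta m)
    /\ forall i (m : la), gm_deg i m -> i <> delta -> m = 0.
Proof.
move=> [[Mg _] [m m0] simple]; have [Z M sums _] := Mg.
have [s [f [fd mf]]] := sums m.
have [delta d0] : exists i, f i <> 0.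
  apply: contrapT => h; apply: m0; rewrite mf big1 // => i _.
  by apply: contrapT => fi; apply: h; exists i.
have [|all0|all] := simple (fun x => gm_deg delta x).
- split=> [|x y|a x xd|x xd].
  + by case: (Z delta).
  + by case: (Z delta) => _; apply.
  + by rewrite -(add0r delta); apply: M => //; left.
  + exists [:: delta], (fun i => if i == delta then x else 0); split=> [i|].
      case: eqP => [->|_] //; split=> //; first by case: (Z i).
      by case: (Z delta).
    by rewrite big_seq1 eqxx.
- by case: d0; apply: all0.
exists delta; split=> // i x xi ne.
rewrite -(hpart_id Mg (all x)) (hpart_hom Mg delta xi).
by case: eqP => // e; case: ne.
Qed.

Lemma group_module_basis (F : fieldType) (W : finGroupType)
    (M : lmodType (group_alg F W)) : fin_gen M ->
  exists n (l : 'I_n -> M), is_basis l.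
Proof.
move=> [s se]; pose e (x : W * 'I_(size s)) : M := sk_grp (triv_walg F W) x.1 *: s`_x.2.
have es : spans e.
  move=> m; have [a ->] := se m; exists (fun x : W * 'I_(size s) => a x.2 x.1 : F).
  rewrite /comb -(pair_bigA _ (fun w (i : 'I_(size s)) => (a i w : F) *! e (w, i))) exchange_big.
  apply: eq_bigr => i _ /=; rewrite {1}(sk_decomp (a i)) scaler_suml.
  apply: eq_bigr => w _; rewrite scalerA; congr (_ *: _).
  by rewrite [RHS]sk_monM wa_act1 mulr1 mul1g.
have [n [f fb]] := spans_basis (spans_ord es).
by exists n, (fun k => e (enum_val (f k))).
Qed.

(** * Triangularity of the restricted Cherednik algebra *)

Lemma pow2_inj (K : numClosedFieldType) : injective (fun i : int => (2%:R : K) ^ i).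
Proof.
(* K is only partially ordered: compare the powers in rat. *)
move=> i j /=; have e k : (2%:R : K) ^ k = ratr (2%:R ^ k).
  by rewrite fmorphXz ?rmorph_nat.
by rewrite !e => /fmorph_inj; apply: (@ieexprIz rat 2%:R).
Qed.

Lemma scal_mulACA (F : fieldType) (A : algebra F) (k l : F) (x y : A) :
  (al_scal k * x) * (al_scal l * y) = al_scal (k * l) * (x * y).
Proof. by rewrite -mulrA [x * (_ * _)]mulrA -(al_central A l x) rmorphM -!mulrA. Qed.

Lemma cherednik_gen_scale (F : fieldType) (W : finGroupType) (V U : wrep F W)
    (kap : W -> U -> V -> F) (A : algebra F) X Y g (k l : F) :
  @cherednik_gen F W V U kap A X Y g -> k * l = 1 ->
  cherednik_gen kap (fun v => al_scal k * X v) (fun u => al_scal l * Y u) g.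
Proof.
move=> [Xl Yl XX YY g1 gM gX gY YX] kl; split=> //.
- move=> i u v; rewrite Xl mulrDr !mulrA; congr (_ * _ + _).
  exact: al_central.
- move=> i u v; rewrite Yl mulrDr !mulrA; congr (_ * _ + _).
  exact: al_central.
- by move=> u v; rewrite !scal_mulACA XX.
- by move=> u v; rewrite !scal_mulACA YY.
- by move=> w v; rewrite mulrA -al_central -!mulrA gX.
- by move=> w v; rewrite mulrA -al_central -!mulrA gY.
- by move=> u v; rewrite !scal_mulACA [l * k]mulrC kl rmorph1 !mul1r YX.
Qed.

Section Triangular.
Variables (K : numClosedFieldType) (W : finGroupType) (h : frep K W).
Variables (c : W -> K) (al : W -> dual_sp h) (alv : W -> h).
Notation h' := (dual_frep h).
Notation A := (rcherednik_gr c al alv).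
Notation kap := (cherednik_coef c al alv).
Notation rx := (@rx K W h c al alv).
Notation ry := (@ry K W h c al alv).
Notation rg := (@rg K W h c al alv).
Let two_neq0 : (2%:R : K) != 0. Proof. by rewrite pnatr_eq0. Qed.

(** Multiplying a generator of degree d by 2^d respects the relations, and 2  *)
(** is not a root of unity.                                                   *)
Lemma rcherednik_euler : exists E : algHom A A,
  forall i a, @ga_deg K A i a -> E a = al_scal (2%:R ^ i) * a.
Proof.
pose q : K := 2%:R^-1.
have q0 : q != 0 by rewrite invr_eq0.
have rels' := cherednik_gen_scale (rcherednik_rels c al alv) (mulVf two_neq0).
have [E [EX EY Eg]] := rcherednik_lift rels'
  (inv_scalar_scale q0 (@rx_invariant K W h c al alv))
  (inv_scalar_scale two_neq0 (@ry_invariant K W h c al alv)).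
exists E => i a; elim=> {i a} [x|y|w|k|i|i a b _ ha _ hb|i j a b _ ha _ hb].
- by rewrite (EX x) exprN1.
- by rewrite (EY y) expr1z.
- by rewrite (Eg w) expr0z rmorph1 mul1r.
- by rewrite ah_scal expr0z rmorph1 mul1r.
- by rewrite ah0 mulr0.
- by rewrite ahB ha hb mulrBr.
- by rewrite ahM ha hb scal_mulACA expfzDr.
Qed.

Lemma rcherednik_triangular : @triangular K W h' h kap A rx ry rg.
Proof.
have [E Eev] := rcherednik_euler.
split.
- exact: rcherednik_rels.
- exact: rcherednik_gens.
- exact: gd_x.
- exact: gd_y.
- exact: gd_w.
- exact: gd_scal.
- exact: gd_mul.
- by exists E, (fun i => 2%:R ^ i); split; first exact: pow2_inj.
- exact: rx_invariant.
- exact: rcherednik_lift.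
Qed.
End Triangular.

(** The equivariant conjugate-linear bijection of h with h^* extends to       *)
(** coinvariants and sends monomials to monomials; in the image of a basis,   *)
(** W acts by the conjugate matrices.                                         *)
Lemma coinv_dual_basis (K : numClosedFieldType) (W : finGroupType) (h : frep K W)
    p (b : 'I_p -> coinv_walg h) (dg : 'I_p -> nat) (beta : W -> 'M[K]_p) :
  (forall k, mono (dg k) (b k)) ->
  (forall x, exists c : 'I_p -> K, x = \sum_k al_scal (c k) * b k) ->
  (forall c : 'I_p -> K, \sum_k al_scal (c k) * b k = 0 -> forall k, c k = 0) ->
  (forall w k, wa_act (coinv_walg h) w (b k) = \sum_i al_scal (beta w k i) * b i) ->
  exists b' : 'I_p -> coinv_walg (dual_frep h),
  [/\ forall k, mono (dg k) (b' k),
      forall x, exists c : 'I_p -> K, x = \sum_k al_scal (c k) * b' k,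
      forall c : 'I_p -> K, \sum_k al_scal (c k) * b' k = 0 -> forall k, c k = 0
    & forall w k, wa_act (coinv_walg (dual_frep h)) w (b' k)
                  = \sum_i al_scal (map_mx Num.conj (beta w) k i) * b' i].
Proof.
move=> bm bs bf bE; have [J' [J'l J'a JK J'K]] := herm_dual_inverse h.
have [H [HD HM Hk Hv Ha]] :=
  @coinv_conj K W h (dual_frep h) _ (@herm_dual_conjlinear K W h) (@herm_dual_act K W h).
have [H' [HD' HM' Hk' Hv' Ha']] := @coinv_conj K W (dual_frep h) h J' J'l J'a.
have H0 : H 0 = 0 by rewrite -(rmorph0 (@al_scal K _)) Hk rmorph0 rmorph0.
have H0' : H' 0 = 0 by rewrite -(rmorph0 (@al_scal K _)) Hk' rmorph0 rmorph0.
have HK x : H' (H x) = x.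
  elim/coinv_ind: x => [v|k|x y hx hy|x y hx hy].
  - by rewrite Hv Hv' JK.
  - by rewrite Hk Hk' conjCK.
  - by rewrite HD HD' hx hy.
  - by rewrite HM HM' hx hy.
have HK' x : H (H' x) = x.
  elim/coinv_ind: x => [v|k|x y hx hy|x y hx hy].
  - by rewrite Hv' Hv J'K.
  - by rewrite Hk' Hk conjCK.
  - by rewrite HD' HD hx hy.
  - by rewrite HM' HM hx hy.
have Hsum (a : 'I_p -> K) : H (\sum_k al_scal (a k) * b k) = \sum_k al_scal (a k)^* * H (b k).
  by rewrite (big_morph H HD H0); apply: eq_bigr => k _; rewrite HM Hk.
have Hmono n x : mono n x -> mono n (H x).
  elim=> {n x} [|n v x _ IH]; last by rewrite HM Hv; apply: monoS.
  rewrite -(rmorph1 (@al_scal K _)) Hk rmorph1 rmorph1; exact: mono0.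
exists (fun k => H (b k)); split=> [k|x|a a0 k|w k].
- exact: Hmono.
- have [a e] := bs (H' x); exists (fun k => (a k)^*).
  by rewrite -Hsum -e HK'.
- have : \sum_k al_scal (a k)^* * b k = 0.
    rewrite -[LHS]HK Hsum -[RHS]H0' -[in RHS]a0; congr (H' _).
    by apply: eq_bigr => i _; rewrite conjCK.
  by move/bf/(_ k)/eqP; rewrite conjC_eq0 => /eqP.
- rewrite -Ha bE Hsum; apply: eq_bigr => i _.
  by rewrite mxE.
Qed.

Section Cherednik.
Variables (K : numClosedFieldType) (W : finGroupType) (h : frep K W).
Variables (c : W -> K) (al : W -> dual_sp h) (alv : W -> h).
Hypotheses (rd : root_data al alv) (ci : conj_invariant h c).
Notation h' := (dual_frep h).
Notation A := (rcherednik_gr c al alv).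
Notation rx := (@rx K W h c al alv).
Notation ry := (@ry K W h c al alv).
Notation rg := (@rg K W h c al alv).

Definition op_mu s := refl_mu h c s^-1%g.
Definition op_form_y s := refl_form_y al s^-1%g.
Definition op_form_x s := refl_form_x alv s^-1%g.

Lemma op_triangular : @triangular K W h h'
  (@refl_coef K W h h' op_mu op_form_y op_form_x) (op_gralg A) ry rx (fun w => rg w^-1%g).
Proof.
have <- : (fun s v u => cherednik_coef c al alv s^-1%g u v)
    = @refl_coef K W h h' op_mu op_form_y op_form_x.
  apply: funext => s; apply: funext => v; apply: funext => u.
  by rewrite /cherednik_coef /refl_coef /op_mu /op_form_y /op_form_x mulrAC.
exact: triangular_op (rcherednik_triangular c al alv) (@ry_invariant K W h c al alv).
Qed.

Lemma op_form_yP s : @reflection_form K W h s (op_form_y s).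
Proof. by have := reflection_form_inv (refl_form_yP rd s^-1%g); rewrite invgK. Qed.
Lemma op_form_xP s : @reflection_form K W h' s (op_form_x s).
Proof. by have := reflection_form_inv (refl_form_xP rd s^-1%g); rewrite invgK. Qed.

Lemma op_coef_act w s (v : h') (u : h) :
  @refl_coef K W h h' op_mu op_form_y op_form_x (w * s * w^-1)%g
    (@wr_act K W h' w v) (@wr_act K W h w u)
  = @refl_coef K W h h' op_mu op_form_y op_form_x s v u.
Proof.
have e t x y : @refl_coef K W h h' op_mu op_form_y op_form_x t x y
    = cherednik_coef c al alv t^-1%g y x.
  by rewrite /cherednik_coef /refl_coef /op_mu /op_form_y /op_form_x mulrAC.
rewrite !e; have -> : (w * s * w^-1)^-1%g = (w * s^-1 * w^-1)%g.
  by rewrite !invMg invgK mulgA.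
exact: refl_coef_act.
Qed.

Lemma borel_plus_var y : borel_plus_in c al alv (bvar y) = ry y.
Proof.
apply: (etrans (skew_lift_mon _ _ _ _)).
rewrite rw1 mulr1; apply: (etrans (quot_liftE _ _)).
by rewrite -[LHS]/(rproj c al alv (pol_y c al alv (svar y))) sym_liftE.
Qed.
Lemma borel_plus_grp w : borel_plus_in c al alv (bgrp h w) = rg w.
Proof.
by apply: (etrans (skew_lift_mon _ _ _ _)); rewrite ah1 mul1r.
Qed.
Lemma borel_minus_var x : borel_minus_in c al alv (bvar (V := h') x) = rx x.
Proof.
apply: (etrans (skew_lift_mon _ _ _ _)).
rewrite rw1 mulr1; apply: (etrans (quot_liftE _ _)).
by rewrite -[LHS]/(rproj c al alv (pol_x c al alv (svar x))) sym_liftE.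
Qed.
Lemma borel_minus_grp w : borel_minus_in c al alv (bgrp h' w) = rg w.
Proof.
by apply: (etrans (skew_lift_mon _ _ _ _)); rewrite ah1 mul1r.
Qed.
End Cherednik.

(** * Bases of the standard and costandard modules *)

Section Compare.
Variables (K : numClosedFieldType) (W : finGroupType) (h : frep K W).
Variables (c : W -> K) (al : W -> dual_sp h) (alv : W -> h).
Hypotheses (rd : root_data al alv) (ci : conj_invariant h c).
Notation h' := (dual_frep h).
Notation A := (rcherednik_gr c al alv).
Notation rg := (@rg K W h c al alv).
Notation triv := (triv_walg K W).
Variables (la : grmod (group_gralg K W)) (delta : int).
Hypotheses (la_delta : forall m : la, gm_deg delta m).
Hypotheses (la_other : forall i (m : la), gm_deg i m -> i <> delta -> m = 0).
Variables (n : nat) (l : 'I_n -> la).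
Hypothesis lb : is_basis l.
Let rho w : 'M[K]_n := \matrix_(j, j') coord l (sk_grp triv w *: l j) j'.

Variables (p : nat) (b : 'I_p -> coinv_walg h) (dg : 'I_p -> nat) (beta : W -> 'M[K]_p).
Hypotheses (bm : forall k, mono (dg k) (b k)).
Hypotheses (bs : forall x, exists a : 'I_p -> K, x = \sum_k al_scal (a k) * b k).
Hypotheses (bf : forall a : 'I_p -> K, \sum_k al_scal (a k) * b k = 0 -> forall k, a k = 0).
Hypotheses (bE : forall w k, wa_act (coinv_walg h) w (b k) = \sum_i al_scal (beta w k i) * b i).

Let char0 k : k.+1%:R != 0 :> K. Proof. by rewrite pnatr_eq0. Qed.

(** The standard module is C[h]^co (x) la, so W acts on its first factor by   *)
(** the conjugates of the matrices on the coinvariants of h.                  *)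
Lemma standard_basis :
  let M := @standard K (group_gralg K W) _ A (borel_plus_in c al alv) (borel_proj h) la in
  is_graded M /\
  exists e : 'I_p * 'I_n -> M,
    [/\ is_basis e, forall x, gm_deg (delta - (dg x.1)%:Z) (e x)
      & forall w x, coord e (rg w *: e x) x = (beta w x.1 x.1)^* * rho w x.2 x.2].
Proof.
have [b' [bm' bs' bf' bE']] := coinv_dual_basis bm bs bf bE.
pose N := res (borel_proj h) la.
have lb' : is_basis (l : 'I_n -> N) by apply: res_basis.
have lg w j : bgrp h w *: (l j : N) = comb (l : 'I_n -> N) (rho w j).
  rewrite -[LHS]/(borel_proj h (bgrp h w) *: l j) borel_proj_grp res_comb.
  have e : sk_grp triv w *: l j = comb l (rho w j).
    by rewrite -[LHS](coordK _ lb.1); apply: eq_comb => j'; rewrite mxE.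
  exact: e.
have Ny y (m : N) : bvar (V := h) y *: m = 0.
  by rewrite -[LHS]/(borel_proj h (bvar (V := h) y) *: (m : la)) borel_proj_var scale0r.
split.
  exact: (std_graded (rcherednik_triangular c al alv) (borel_plus_var c al alv)
    (borel_plus_grp c al alv) (@borel_generated K W h) Ny la_delta la_other lb' bm' bs').
have [e [eb ed eg]] := std_basis_ex char0 (refl_form_xP rd) (refl_form_yP rd)
  (refl_coef_act rd ci) (rcherednik_triangular c al alv) (borel_plus_var c al alv)
  (borel_plus_grp c al alv) (sk_grp1 _) (@sk_grpM _ _ _) (@borel_generated K W h)
  Ny la_delta lb' lg bm' bs' bf' bE'.
by exists e; split=> // w x; rewrite eg mxE.
Qed.

(** Over the opposite algebra the variables are those of h, and w acts as     *)
(** w^-1: the module of which the costandard one is the dual is               *)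
(** C[h^*]^co (x) la^*.                                                       *)
Lemma costandard_basis :
  let N := @ind K _ (op_gralg A) (op_hom (borel_minus_in c al alv))
    (res (op_hom (borel_proj h')) (dual la)) in
  is_graded N /\
  exists e : 'I_p * 'I_n -> N,
    [/\ is_basis e, forall x, gm_deg (delta - (dg x.1)%:Z) (e x)
      & forall w x, coord e ((rg w : op_alg A) *: e x) x
                    = beta w^-1%g x.1 x.1 * rho w x.2 x.2].
Proof.
pose ph := op_hom (borel_minus_in c al alv).
pose N := res (op_hom (borel_proj h')) (dual la).
pose l' : 'I_n -> N := dual_basis lb.
pose gB w : op_alg (borel h') := bgrp h' w^-1%g.
have lb' : is_basis l' by apply: (@res_basis K _ _ (op_hom (borel_proj h')) (dual la) _ (dual_basis lb) (dual_basisP lb)).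
have lg w j : gB w *: l' j = comb l' ((rho w^-1%g)^T j).
  rewrite /l' res_comb; apply: dual_eq => m; rewrite comb_dualE.
  rewrite -[LHS]/(coord l (borel_proj h' (bgrp h' w^-1%g) *: m) j) borel_proj_grp.
  rewrite -{1}(coordK m lb.1) (flin_comb (scale_flin la _)) coord_comb //.
  by apply: eq_bigr => k _; rewrite !mxE mulrC.
have Ny y (m : N) : (bvar (V := h') y : op_alg (borel h')) *: m = 0.
  apply: dual_eq => u.
  rewrite -[LHS]/((m : dual_mod la) (borel_proj h' (bvar (V := h') y) *: u)).
  by rewrite borel_proj_var scale0r df0.
have gB1 : gB 1%g = 1 by rewrite /gB invg1; apply: sk_grp1.
have gBM w w' : gB (w * w')%g = gB w * gB w' by rewrite /gB invMg; apply: sk_grpM.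
have N_delta (m : N) : gm_deg delta m.
  by move=> j u jd uj; rewrite (la_other uj) ?df0 //; apply/eqP.
have N_other i (m : N) : gm_deg i m -> i <> delta -> m = 0.
  move=> mi id; apply: dual_eq => u; apply: (mi delta) => //.
  by apply/eqP => e; apply: id.
have ph_y x : ph (bvar (V := h') x) = @rx K W h c al alv x by apply: borel_minus_var.
have ph_g w : ph (gB w) = rg w^-1%g by apply: borel_minus_grp.
have gens := generated_op (@borel_generated K W h').
split.
  exact: (std_graded (op_triangular c al alv) ph_y ph_g gens Ny N_delta N_other lb' bm bs).
have [e [eb ed eg]] := std_basis_ex char0 (op_form_yP rd) (op_form_xP rd)
  (op_coef_act rd ci) (op_triangular c al alv) ph_y ph_g gB1 gBM gens
  Ny N_delta lb' lg bm bs bf bE.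
exists e; split=> // w x; have := eg w^-1%g x.
by rewrite !invgK mxE.
Qed.
End Compare.

(** * Equality in the Grothendieck group *)

(** In bases with the same degrees, the diagonal entries of w are             *)
(** conj(beta(w)) rho(w) for the standard module and beta(w^-1) rho(w) for    *)
(** the costandard one.  Their sums over a degree agree because the trace of  *)
(** w^-1 on an invariant block is conjugate to the trace of w.                *)
Lemma rcherednik_is_BGG (K : numClosedFieldType) (W : finGroupType) (h : frep K W)
    (c : W -> K) (al : W -> dual_sp h) (alv : W -> h) :
  root_data al alv -> conj_invariant h c -> rcherednik_BGG c al alv.
Proof.
move=> rd ci la simple.
have [delta [ld lo]] := graded_simple_degree simple.
have [n [l lb]] : exists n (l : 'I_n -> la), is_basis l.
  by apply: group_module_basis; case: simple => -[].
have char0 k : k.+1%:R != 0 :> K by rewrite pnatr_eq0.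
have [p [b [dg [bm bs bf]]]] := @coinv_basis K W h char0 _ (fun i => (vbasis {:h})`_i)
  (fun v => ex_intro _ _ (coord_vbasis (memvf v))).
have /choice [a aE] (x : W * 'I_p) := bs (wa_act (coinv_walg h) x.1 (b x.2)).
pose beta w : 'M[K]_p := \matrix_(k, i) a (w, k) i.
have bE w k : wa_act (coinv_walg h) w (b k) = \sum_i al_scal (beta w k i) * b i.
  by rewrite (aE (w, k)); apply: eq_bigr => i _; rewrite mxE.
pose rho w : 'M[K]_n := \matrix_(j, j') coord l (sk_grp (triv_walg K W) w *: l j) j'.
have pow2 i j : (2%:R : K) ^+ i = 2%:R ^+ j -> i = j.
  by move=> e; apply/eqP; rewrite -(eqz_nat i j); apply/eqP/(@pow2_inj K).
have block w k k' : dg k != dg k' -> beta w k k' = 0.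
  exact: coinv_matrix_block bm bf bE pow2 w k k'.
have beta1 := coinv_matrix1 bf bE.
have betaM w w' := esym (coinv_matrixM bf bE w' w).
have [Sg [e [eb ed eg]]] := standard_basis rd ci ld lo lb bm bs bf bE.
have [Ng [e' [eb' ed' eg']]] := costandard_basis rd ci ld lo lb bm bs bf bE.
pose A := rcherednik_gr c al alv.
have scal0 : forall k, @ga_deg K A 0 (al_scal k) by apply: gd_scal.
pose N := @ind K _ (op_gralg A) (op_hom (borel_minus_in c al alv))
  (res (op_hom (borel_proj (dual_frep h))) (dual la)).
pose M : grmod A := @standard K (group_gralg K W) _ A (borel_plus_in c al alv) (borel_proj h) la.
have Mh : fd_graded M by split=> //; eexists; eexists; apply: spans_ord eb.1.
have Nh : fd_graded (codual N).
  split; first exact: (codual_graded scal0 Ng eb' ed').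
  by eexists; eexists; apply: spans_ord (codual_basisP eb').1.
exists (fd_in_G Mh), (fd_in_G Nh).
have tri := rcherednik_triangular c al alv.
apply: (K0_eq_gchar (tr_rels tri) (tr_gens tri) (tr_Xdeg tri) (tr_Ydeg tri)
  (tr_gdeg tri) (tr_scaldeg tri) Mh Nh) => i w.
rewrite (gcharE scal0 _ Sg eb ed) (codual_gchar scal0 Ng eb' ed').
pose D k := delta - (dg k)%:Z == i.
have sumE (f : 'I_p -> K) (r : 'I_n -> K) :
    \sum_(x : 'I_p * 'I_n | D x.1) f x.1 * r x.2 = (\sum_(k | D k) f k) * \sum_j r j.
  rewrite big_distrlr /= (pair_big D predT (fun k j => f k * r j)) /=.
  by apply: eq_bigl => x; rewrite andbT.
under eq_bigr => x _ do rewrite eg.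
under [RHS]eq_bigr => x _ do rewrite eg'.
apply: etrans (sumE (fun k => (beta w k k)^*) (fun j => rho w j j)) _.
apply: etrans (esym (sumE (fun k => beta w^-1%g k k) (fun j => rho w j j))).
congr (_ * _); rewrite (block_trace_inv beta1 betaM) ?rmorph_sum // => v k k' kk'.
by apply: block; apply: contra kk' => /eqP e0; rewrite /D e0.
Qed.

Theorem lemma8p11 (R : realType) (W : finGroupType) (h : frep R[i] W)
  (al : W -> dual_sp h) (alv : W -> h) (c : W -> R[i]) :
  reflection_group h -> root_data al alv -> conj_invariant h c ->
  rcherednik_BGG c al alv.
Proof. by move=> _; apply: rcherednik_is_BGG. Qed.
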